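(* Enforcing bounds$(\mathbb{D})$ consistency for each of the constraints sort$(U,V)$, sort$(U,V,P)$ and keysorting$(U,V,Keys,P)$ is NP-complete.
   Context: Constraints are over variables with finite integer domains; a support of a constraint is an assignment of values from the domains to its variables satisfying it. A domain is bounds$(\mathbb{D})$ consistent for a constraint if for every variable $w_i$ and each value $\delta_i\in\{\min Dom(w_i),\max Dom(w_i)\}$ there exist values $\delta_j\in Dom(w_j)$ for $j\neq i$ such that $(\delta_1,\ldots,\delta_t)$ satisfies the constraint; enforcing it requires testing this for a given variable and bound. The constraint sort$(U,V)$, with $U=\{u_1,\ldots,u_n\}$, $V=\{v_1,\ldots,v_n\}$, is satisfied iff the values of $v_1,\ldots,v_n$ are the sorted list of the values of $u_1,\ldots,u_n$. The constraint sort$(U,V,P)$ adds $n$ variables $P$ with domains included in $\{1,\ldots,n\}$, requiring in addition that the values of $P$ be all distinct and define the permutation associating $U$ to $V$. The constraint keysorting$(U,V,Keys,P)$ (with $Keys$ a positive integer) lets each variable be an $h$-tuple sorted lexicographically on its first $Keys$ components, and requires the sorting to be stable. *)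

(* Defs.v *)
From HB Require Import structures.
From mathcomp Require Import all_boot all_order all_algebra.

Set Implicit Arguments.
Unset Strict Implicit.
Unset Printing Implicit Defensive.

Import Order.TTheory GRing.Theory Num.Theory.

(** * Deterministic multi-tape Turing machines *)

Inductive move := MoveLeft | Stay | MoveRight.

(* Tape 0 holds the input; tape 1 holds the second input (the certificate) of a
   verifier, and the output of a machine that computes a function.  A cell is
   blank ([None]), a bit, or an auxiliary symbol of the machine.  The machine
   halts when [delta] returns [None]; [accept] is consulted only then. *)
Record tm := TM {
  state : finType;
  aux : finType;
  work_tapes : nat;
  start : state;
  accept : pred state;
  delta : state -> {ffun 'I_work_tapes.+2 -> option (bool + aux)} ->
    option (state * {ffun 'I_work_tapes.+2 -> option (bool + aux) * move})
}.

Definition cell (M : tm) : Type := option (bool + aux M).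

(* [tleft] is listed from the head outwards; all cells not listed are blank, so
   the tape is infinite in both directions. *)
Record tape (M : tm) := Tape {
  tleft : seq (cell M);
  thead : cell M;
  tright : seq (cell M)
}.

Definition tape_move (M : tm) (m : move) (t : tape M) : tape M :=
  let: Tape l a r := t in
  match m with
  | MoveLeft => if l is b :: l' then Tape l' b (a :: r)
                else Tape [::] None (a :: r)
  | Stay => t
  | MoveRight => if r is b :: r' then Tape (a :: l) b r'
                 else Tape (a :: l) None [::]
  end.

Definition tape_write (M : tm) (a : cell M) (t : tape M) : tape M :=
  Tape (tleft t) a (tright t).

Definition tape_of (M : tm) (w : seq bool) : tape M :=
  if [seq Some (inl b : bool + aux M) | b <- w] is a :: r then Tape [::] a r
  else Tape [::] None [::].

Fixpoint leading_bits (A : Type) (s : seq (option (bool + A))) : seq bool :=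
  if s is Some (inl b) :: s' then b :: leading_bits s' else [::].

Definition tape_word (M : tm) (t : tape M) : seq bool :=
  leading_bits (thead t :: tright t).

Definition config (M : tm) : Type :=
  (state M * {ffun 'I_(work_tapes M).+2 -> tape M})%type.

Definition init (M : tm) (x y : seq bool) : config M :=
  (start M, [ffun i : 'I_(work_tapes M).+2 => tape_of M (nth [::] [:: x; y] i)]).

Definition step (M : tm) (c : config M) : option (config M) :=
  if delta c.1 [ffun i => thead (c.2 i)] is Some (q, a) then
    Some (q, [ffun i => tape_move (a i).2 (tape_write (a i).1 (c.2 i))])
  else None.

Definition halts_within (M : tm) (x y : seq bool) (t : nat) (c : config M)
    : Prop :=
  exists s, [/\ s <= t,
    iter s (obind (@step M)) (Some (init M x y)) = Some c & step c = None].

(** * NP-completeness *)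

Definition language := seq bool -> Prop.

Definition poly_time_computable (f : seq bool -> seq bool) : Prop :=
  exists (M : tm) (q : {poly nat}), forall x, exists c : config M,
    halts_within x [::] q.[size x]%R c /\
    tape_word (c.2 (inord 1)) = f x.

Definition poly_reducible (L L' : language) : Prop :=
  exists f, poly_time_computable f /\ forall x, L x <-> L' (f x).

Definition accepts (M : tm) (x y : seq bool) : Prop :=
  exists t (c : config M), halts_within x y t c /\ accept c.1.

Definition in_NP (L : language) : Prop :=
  exists (M : tm) (p q : {poly nat}),
    (forall x y, exists c : config M,
       halts_within x y q.[(size x + size y)%N]%R c) /\
    (forall x, L x <-> exists y, size y <= p.[size x]%R /\ accepts M x y).

Definition NP_hard (L : language) : Prop :=
  forall L', in_NP L' -> poly_reducible L' L.

Definition NP_complete (L : language) : Prop := in_NP L /\ NP_hard L.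

(** * Constraints and bounds(D) consistency *)

(* [W] is the type of variables; a domain is the finite set of the integers
   listed by a sequence. *)
Definition domains (W : Type) : Type := W -> seq int.

Definition constraint (W : Type) : Type := (W -> int) -> Prop.

Definition support (W : Type) (C : constraint W) (D : domains W)
    (d : W -> int) : Prop :=
  (forall w, d w \in D w) /\ C d.

Variant bound := Min | Max.

Definition is_bound (b : bound) (s : seq int) (v : int) : Prop :=
  v \in s /\
  forall u, u \in s -> match b with Min => (v <= u)%R | Max => (u <= v)%R end.

Definition bound_supported (W : Type) (C : constraint W) (D : domains W)
    (w : W) (b : bound) : Prop :=
  exists d, support C D d /\ is_bound b (D w) (d w).

Definition bounds_D_consistent (W : Type) (C : constraint W) (D : domains W)
    : Prop :=
  forall w b, bound_supported C D w b.

(** * The sorting constraints *)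

Definition sort_var (n : nat) : Type := ('I_n + 'I_n)%type.

Definition sort_UV (n : nat) : constraint (sort_var n) := fun d =>
  [seq d (inr i) | i : 'I_n] = sort <=%R [seq d (inl i) | i : 'I_n].

Variant sortP_var (n : nat) := PU of 'I_n | PV of 'I_n | PP of 'I_n.

(* Positions are numbered from 1: [p_i] is the position in [V] of [u_i]. *)
Definition sort_UVP (n : nat) : constraint (sortP_var n) := fun d =>
  [/\ [seq d (PV i) | i : 'I_n] = sort <=%R [seq d (PU i) | i : 'I_n],
      injective (fun i => d (PP i))
    & forall i, exists j : 'I_n,
        d (PP i) = j.+1%:Z%R /\ d (PU i) = d (PV j)].

(* [KU i k] and [KV i k] are the [k]-th components of the [h]-tuples [u_i] and
   [v_i]; every component is an integer variable with its own domain. *)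
Variant keysort_var (n h : nat) :=
  KU of 'I_n & 'I_h | KV of 'I_n & 'I_h | KP of 'I_n.

(* [seqlexi] carries the lexicographic order. *)
Definition sort_key (h keys : nat) (t : 'I_h -> int) : seqlexi int :=
  take keys [seq t k | k : 'I_h].

Definition keysorting (n h keys : nat) : constraint (keysort_var n h) :=
  fun d =>
  [/\ forall i j : 'I_n, i <= j ->
        (sort_key keys (fun k => d (KV i k)) <=
         sort_key keys (fun k => d (KV j k)))%O,
      injective (fun i => d (KP h i)),
      forall i, exists j : 'I_n,
        d (KP h i) = j.+1%:Z%R /\ forall k, d (KU i k) = d (KV j k)
    & forall i j : 'I_n, i < j ->
        sort_key keys (fun k => d (KU i k)) =
        sort_key keys (fun k => d (KU j k)) ->
        (d (KP h i) < d (KP h j))%R].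

(** * Encoding of instances as bit strings *)

(* All codes below are prefix-free: a binary digit or list item is announced by
   [true], and [false] ends the list. *)
Definition enc_seq (T : Type) (e : T -> seq bool) (s : seq T) : seq bool :=
  foldr (fun x w => true :: e x ++ w) [:: false] s.

(* Binary digits, least significant first; [0] has no digits. *)
Definition nat_digits (n : nat) : seq bool :=
  [seq odd (n %/ 2 ^ i) | i <- iota 0 (up_log 2 n.+1)].

Definition enc_nat (n : nat) : seq bool :=
  enc_seq (fun b => [:: b]) (nat_digits n).

Definition enc_int (z : int) : seq bool := (z < 0)%R :: enc_nat `|z|%N.

Definition enc_dom : seq int -> seq bool := enc_seq enc_int.

Definition enc_doms (n : nat) (D : 'I_n -> seq int) : seq bool :=
  enc_seq enc_dom [seq D i | i : 'I_n].

Definition enc_tuple_doms (n h : nat) (D : 'I_n -> 'I_h -> seq int)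
    : seq bool :=
  enc_seq (@enc_doms h) [seq D i | i : 'I_n].

Definition enc_bound (b : bound) : seq bool :=
  [:: if b is Max then true else false].

Definition enc_sort_var (n : nat) (w : sort_var n) : seq bool :=
  match w with
  | inl i => false :: enc_nat i
  | inr i => true :: enc_nat i
  end.

Definition enc_sortP_var (n : nat) (w : sortP_var n) : seq bool :=
  match w with
  | PU i => [:: false; false] ++ enc_nat i
  | PV i => [:: false; true] ++ enc_nat i
  | PP i => [:: true; false] ++ enc_nat i
  end.

Definition enc_keysort_var (n h : nat) (w : keysort_var n h) : seq bool :=
  match w with
  | KU i k => [:: false; false] ++ enc_nat i ++ enc_nat k
  | KV i k => [:: false; true] ++ enc_nat i ++ enc_nat k
  | KP i => [:: true; false] ++ enc_nat i
  end.

Definition enc_sort_UV (n : nat) (D : domains (sort_var n)) (w : sort_var n)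
    (b : bound) : seq bool :=
  enc_doms (fun i => D (inl i)) ++ enc_doms (fun i => D (inr i)) ++
  enc_sort_var w ++ enc_bound b.

Definition enc_sort_UVP (n : nat) (D : domains (sortP_var n))
    (w : sortP_var n) (b : bound) : seq bool :=
  enc_doms (fun i => D (PU i)) ++ enc_doms (fun i => D (PV i)) ++
  enc_doms (fun i => D (PP i)) ++ enc_sortP_var w ++ enc_bound b.

Definition enc_keysorting (n h keys : nat) (D : domains (keysort_var n h))
    (w : keysort_var n h) (b : bound) : seq bool :=
  enc_nat keys ++
  enc_tuple_doms (fun i k => D (KU i k)) ++
  enc_tuple_doms (fun i k => D (KV i k)) ++
  enc_doms (fun i => D (KP h i)) ++ enc_keysort_var w ++ enc_bound b.

(** * Decision problems: is the given bound of the given variable supported? *)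

Definition nonempty_domains (W : Type) (D : domains W) : Prop :=
  forall w, D w <> [::].

Definition position_domain (n : nat) (s : seq int) : Prop :=
  forall v, v \in s -> (1 <= v <= n%:Z)%R.

Definition sort_UV_bounds_D : language := fun x =>
  exists (n : nat) (D : domains (sort_var n)) (w : sort_var n) (b : bound),
    [/\ x = enc_sort_UV D w b, nonempty_domains D
      & bound_supported (@sort_UV n) D w b].

Definition sort_UVP_bounds_D : language := fun x =>
  exists (n : nat) (D : domains (sortP_var n)) (w : sortP_var n) (b : bound),
    [/\ x = enc_sort_UVP D w b, nonempty_domains D,
        forall i, position_domain n (D (PP i))
      & bound_supported (@sort_UVP n) D w b].

Definition keysorting_bounds_D : language := fun x =>
  exists (n h keys : nat) (D : domains (keysort_var n h))
         (w : keysort_var n h) (b : bound),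
    [/\ x = enc_keysorting keys D w b, 0 < keys <= h, nonempty_domains D,
        forall i, position_domain n (D (KP h i))
      & bound_supported (@keysorting n h keys) D w b].

(* Main.v *)
(* Hardness is proved from Turing machines directly.  A run of a machine on a guessed
   certificate is written, row by row, as a sequence of cells; a head-centred picture of
   the tapes makes every cell depend on three cells of the previous row and on the state
   and symbols read, so runs are tilings of one long sequence in which tile [p] must match
   tiles [p+1] and [p+W].  For each position and each tile there is a chain of boolean
   slots.  In a chain, the variable [v] of slot [s] takes one of two values [low s < high s],
   all the low values of the chain being below all its high ones: sortedness of [V] then
   says that truth propagates forward along the chain.  The variables [u] state that
   certain groups of slots contain exactly one true slot: one [u] ranges over the high
   values of the group, and all its other [u]'s over the low ones.  The first slots of the
   chains of a position form a group, and so do the last ones, so that exactly one chain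
   is true, throughout, and all the others are false; the matching of colours is a family
   of such groups as well: either the tile at [p] has outgoing colour [c], or the tile
   facing it has an ingoing colour other than [c].  As all values are distinct, adding the
   permutation, even a stable one, changes nothing.

   For membership in NP, a certificate is the whole instance together with a support; the
   verifier encodes that instance and compares the result with its input, so that inputs
   are never parsed.

   Polynomial-time functions are programmed by combinators on trees, run by a machine with
   a stack of prefix codes. *)

From mathcomp Require Import all_boot all_order all_algebra zify.
Require Import Defs.

Set Implicit Arguments.
Unset Strict Implicit.
Unset Printing Implicit Defensive.

Import Order.TTheory GRing.Theory Num.Theory.

(** * Stack machines *)

(** A value of [v] occurs in the [u]-domains of a single group, whereas the choice of a tile is
    subject to several groups: hence one copy of the choice per group, and a chain to keep the
    copies equal. Sortedness only gives implications along the chain; they become equalities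
    because, at each position, exactly one first copy and exactly one last copy are true. The groups
    work by counting: the domains fix how many [u]'s take a low value of a given group, and [v]
    takes the same values equally often. For a colour [c], exactly one of 'out is c' and 'in is not
    c' says that out is c iff in is c. The problem asks for one bound, not for solvability: a
    further pair of variables with domain {0}, below all other values, is added, and its bound is
    queried. Only T columns on each side of the heads are drawn. Errors made at the border move
    inwards by one column per row and do not reach the centre by row T. Verifiers halt in a known
    time on every certificate and a halted row repeats itself, so acceptance is read at the centre
    of row T. *)

Inductive reg := RX | RY | RR | RS | RA | RB.

Record env := Env {
  reg_x : seq bool; reg_y : seq bool; reg_r : seq bool;
  reg_s : seq bool; reg_a : seq bool; reg_b : seq bool }.

Definition get (e : env) (r : reg) : seq bool :=
  match r with
  | RX => reg_x e | RY => reg_y e | RR => reg_r e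
  | RS => reg_s e | RA => reg_a e | RB => reg_b e
  end.

Definition set (e : env) (r : reg) (v : seq bool) : env :=
  let: Env x y u s a b := e in
  match r with
  | RX => Env v y u s a b | RY => Env x v u s a b | RR => Env x y v s a b
  | RS => Env x y u v a b | RA => Env x y u s v b | RB => Env x y u s a v
  end.

(* A target [None] leaves the fragment. *)
Inductive instr (S : Type) :=
  | IPush of reg & bool & option S
  | IPop of reg & option S
  | ICase of reg & option S & option S & option S
  | IFail.
Arguments IFail {S}.

Record frag := Frag { fstate : finType; fentry : fstate; finstr : fstate -> instr fstate }.

Definition sel (T : Type) (s : seq bool) (t0 t1 t2 : T) : T :=
  match s with [::] => t0 | true :: _ => t1 | false :: _ => t2 end.

(** The outcome [None] is rejection and comes from [IFail] alone; an endless loop has no derivation.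
    The step count is exact, and [runs_tm] turns it into a bound on machine steps. *)
Inductive runs (f : frag) :
    option (fstate f) -> env -> nat -> option env -> Prop :=
  | runs_exit e : runs None e 0 (Some e)
  | runs_push s e r b t n o : finstr s = IPush r b t ->
      runs t (set e r (b :: get e r)) n o -> runs (Some s) e n.+1 o
  | runs_pop s e r t n o : finstr s = IPop r t ->
      runs t (set e r (behead (get e r))) n o -> runs (Some s) e n.+1 o
  | runs_case s e r t0 t1 t2 n o : finstr s = ICase r t0 t1 t2 ->
      runs (sel (get e r) t0 t1 t2) e n o -> runs (Some s) e n.+1 o
  | runs_fail s e : finstr s = IFail -> runs (Some s) e 0 None.

Definition exec (f : frag) := runs (Some (fentry f)).

Definition imap (S T : Type) (k : option S -> option T) (i : instr S) :=
  match i with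
  | IPush r b t => IPush r b (k t)
  | IPop r t => IPop r (k t)
  | ICase r t0 t1 t2 => ICase r (k t0) (k t1) (k t2)
  | IFail => IFail
  end.

Lemma sel_map (S T : Type) (k : S -> T) s t0 t1 t2 :
  sel s (k t0) (k t1) (k t2) = k (sel s t0 t1 t2).
Proof. by case: s => [|[]]. Qed.

Section Embedding.
Variables (f g : frag) (k : option (fstate f) -> option (fstate g)).
Hypothesis k_ins : forall s, exists2 s', k (Some s) = Some s' &
  finstr s' = imap k (finstr s).

(** Sequencing, branching and looping all reuse a fragment inside a larger one: [k] renames its
    states and chooses where its exit leads, so a run that leaves [f] is continued from [k None]. *)
Lemma runs_embed t e n e' n' o : runs t e n (Some e') ->
  runs (k None) e' n' o -> runs (k t) e (n + n') o.
Proof.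
move oE: (Some e') => o' H; elim: H oE => {t e n o'}.
- by move=> e [->].
- move=> s e r b t n o' E _ IH o'E H; have [s' -> Es'] := k_ins s.
  by rewrite addSn; apply: runs_push (IH o'E H); rewrite Es' E.
- move=> s e r t n o' E _ IH o'E H; have [s' -> Es'] := k_ins s.
  by rewrite addSn; apply: runs_pop (IH o'E H); rewrite Es' E.
- move=> s e r t0 t1 t2 n o' E _ IH o'E H; have [s' -> Es'] := k_ins s.
  rewrite addSn; apply: runs_case; first by rewrite Es' E.
  by rewrite sel_map; apply: IH.
- by [].
Qed.

Lemma runs_embed_fail t e n : runs t e n None -> runs (k t) e n None.
Proof.
move oE: None => o' H; elim: H oE => {t e n o'}.
- by [].
- move=> s e r b t n o' E _ IH o'E; have [s' -> Es'] := k_ins s.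
  by apply: runs_push (IH o'E); rewrite Es' E.
- move=> s e r t n o' E _ IH o'E; have [s' -> Es'] := k_ins s.
  by apply: runs_pop (IH o'E); rewrite Es' E.
- move=> s e r t0 t1 t2 n o' E _ IH o'E; have [s' -> Es'] := k_ins s.
  apply: runs_case; first by rewrite Es' E.
  by rewrite sel_map; apply: IH.
- move=> s e E _; have [s' -> Es'] := k_ins s.
  by apply: runs_fail; rewrite Es' E.
Qed.
End Embedding.

Definition fPush r b : frag := @Frag unit tt (fun _ => IPush r b None).
Definition fPop r : frag := @Frag unit tt (fun _ => IPop r None).
Definition fFail : frag := @Frag unit tt (fun _ => IFail).

Definition fSeq (f g : frag) : frag :=
  @Frag (fstate f + fstate g)%type (inl (fentry f)) (fun s =>
    match s with
    | inl s => imap (fun t => if t is Some s then Some (inl s)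
                              else Some (inr (fentry g))) (finstr s)
    | inr s => imap (omap inr) (finstr s)
    end).

Definition fIf (r : reg) (f0 f1 f2 : frag) : frag :=
  @Frag (option (fstate f0 + (fstate f1 + fstate f2)))%type None (fun s =>
    match s with
    | None => ICase r (Some (Some (inl (fentry f0))))
                (Some (Some (inr (inl (fentry f1)))))
                (Some (Some (inr (inr (fentry f2)))))
    | Some (inl s) => imap (omap (Some \o inl)) (finstr s)
    | Some (inr (inl s)) => imap (omap (Some \o (inr \o inl))) (finstr s)
    | Some (inr (inr s)) => imap (omap (Some \o (inr \o inr))) (finstr s)
    end).

(** The loop is left on an empty register; [p] and [q] say whether it goes on when the top bit is
    true, respectively false. With both true it runs until the register is empty; with [p] alone it
    follows the cons bits of a list. *)
Definition fWhile (r : reg) (p q : bool) (f : frag) : frag :=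
  @Frag (option (fstate f)) None (fun s =>
    match s with
    | None => ICase r None (if p then Some (Some (fentry f)) else None)
                (if q then Some (Some (fentry f)) else None)
    | Some s => imap (fun t => Some t) (finstr s)
    end).

Lemma exec_push r b e : exec (fPush r b) e 1 (Some (set e r (b :: get e r))).
Proof. by apply: runs_push => //; apply: runs_exit. Qed.

Lemma exec_pop r e : exec (fPop r) e 1 (Some (set e r (behead (get e r)))).
Proof. by apply: runs_pop => //; apply: runs_exit. Qed.

Lemma exec_fail e : exec fFail e 0 None.
Proof. exact: runs_fail. Qed.

Lemma exec_seq f g e n e' n' o : exec f e n (Some e') -> exec g e' n' o ->
  exec (fSeq f g) e (n + n') o.
Proof.
move=> Hf Hg; pose k := (fun t => if t is Some s then Some (inl s)
  else Some (inr (fentry g)) : option (fstate (fSeq f g))).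
have K s : exists2 s', k (Some s) = Some s' & finstr (f := fSeq f g) s' = imap k (finstr s).
  by exists (inl s).
refine (@runs_embed _ (fSeq f g) _ K _ _ _ _ _ _ Hf _).
have K' s : exists2 s', omap inr (Some s) = Some s' &
    finstr (f := fSeq f g) s' = imap (omap inr) (finstr s) by exists (inr s).
rewrite -[n']addn0; case: o Hg => [e2|] Hg.
- by refine (@runs_embed _ (fSeq f g) _ K' _ _ _ _ _ _ Hg _); apply: runs_exit.
- by rewrite addn0; apply: (@runs_embed_fail _ (fSeq f g) _ K' _ _ _ Hg).
Qed.

Lemma exec_sub (f g : frag) (h : fstate f -> fstate g) e n o :
  (forall s, finstr (h s) = imap (omap h) (finstr s)) ->
  exec f e n o -> runs (Some (h (fentry f))) e n o.
Proof.
move=> hE H; have Hk: forall s, exists2 s', omap h (Some s) = Some s' &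
    finstr s' = imap (omap h) (finstr s) by move=> s; exists (h s).
case: o H => [e'|] H; last exact: (runs_embed_fail Hk H).
by rewrite -[n]addn0; apply: (runs_embed Hk H); apply: runs_exit.
Qed.

Lemma exec_if r f0 f1 f2 e n o : exec (sel (get e r) f0 f1 f2) e n o ->
  exec (fIf r f0 f1 f2) e n.+1 o.
Proof.
move=> H; apply: runs_case => //=.
case: (get e r) H => [|[] s] /= H.
- by refine (@exec_sub f0 (fIf r f0 f1 f2) (Some \o inl) _ _ _ _ H).
- by refine (@exec_sub f1 (fIf r f0 f1 f2) (Some \o (inr \o inl)) _ _ _ _ H).
- by refine (@exec_sub f2 (fIf r f0 f1 f2) (Some \o (inr \o inr)) _ _ _ _ H).
Qed.

Lemma exec_while_stop r p q f e : sel (get e r) true (~~ p) (~~ q) ->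
  exec (fWhile r p q f) e 1 (Some e).
Proof.
move=> H; apply: runs_case => //=.
by case: (get e r) H => [|[] s] /= ; case: p q => [] [] //= _; exact: runs_exit.
Qed.

Lemma exec_while r p q f e n e' n' o : sel (get e r) false (p) (q) ->
  exec f e n (Some e') -> exec (fWhile r p q f) e' n' o ->
  exec (fWhile r p q f) e (n + n').+1 o.
Proof.
move=> H Hf Hw; apply: runs_case => //=.
pose k := fun t => Some t : option (fstate (fWhile r p q f)).
have K s : exists2 s', k (Some s) = Some s' & finstr (f := fWhile r p q f) s' = imap k (finstr s).
  by exists (Some s).
have := @runs_embed _ (fWhile r p q f) _ K _ _ _ _ _ _ Hf Hw.
by move: H {Hw} @k K; case: (get e r) => [|[] s] //=; case: p => //; case: q.
Qed.

(** A step pushes at most one bit, so running time bounds output size; this is what lets polynomial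
    time compose. *)
Lemma runs_size (f : frag) t e n o : runs (f := f) t e n o ->
  if o is Some e' then size (reg_r e') <= size (reg_r e) + n else true.
Proof.
elim=> {t e n o} //=.
- by move=> e; rewrite addn0.
- move=> s e r b t n [e'|] // _ _ IH; apply: leq_trans IH _.
  by case: e => x y u s' a b'; case: r => /=; rewrite ?addnS ?addSn //.
- move=> s e r t n [e'|] // _ _ IH; apply: leq_trans IH _.
  case: e => x y u s' a b'; case: r => /=; rewrite ?addnS ?leqnSn //.
  by rewrite size_behead -addnS leq_add ?leq_pred.
- move=> s e r t0 t1 t2 n [e'|] // _ _ IH; apply: leq_trans IH _.
  by rewrite addnS leqnSn.
Qed.

(** * Turing machines running stack machines *)

Definition tape_index (r : reg) : nat :=
  match r with RX => 0 | RY => 1 | RR => 2 | RS => 3 | RA => 4 | RB => 5 end.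

Definition reg_at (e : env) (i : nat) : seq bool :=
  nth [::] [:: reg_x e; reg_y e; reg_r e; reg_s e; reg_a e; reg_b e] i.

Lemma getn_rix e r : reg_at e (tape_index r) = get e r.
Proof. by case: e => *; case: r. Qed.

Lemma getn_set e r v i : reg_at (set e r v) i = if i == tape_index r then v else reg_at e i.
Proof.
by case: e => x y u s a b; case: r => /=; case: i => [|[|[|[|[|[|i]]]]]].
Qed.

Definition bit_of (c : option (bool + void)) : seq bool :=
  if c is Some (inl b) then [:: b] else [::].

(** A machine writes before it moves, so a push takes two steps: the head goes left, then writes.
    The Boolean of the state marks the second half. Leaving the fragment is the accepting halt;
    [IFail] halts in a state that does not accept. The four work tapes hold [RR], [RS], [RA] and
    [RB]. *)
Definition tm_of (f : frag) : tm :=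
  @TM (option (fstate f) * bool)%type void 4 (Some (fentry f), false)
    (fun s => s.1 == None)
    (fun s rd =>
       if s.1 is Some t then
         match finstr t with
         | IPush r b u =>
             if s.2 then Some ((u, false), [ffun i : 'I_6 =>
               if i == tape_index r :> nat then (Some (inl b), Stay)
               else (rd i, Stay)])
             else Some ((Some t, true), [ffun i : 'I_6 =>
               (rd i, if i == tape_index r :> nat then MoveLeft else Stay)])
         | IPop r u => Some ((u, false), [ffun i : 'I_6 =>
               if i == tape_index r :> nat then (None, MoveRight) else (rd i, Stay)])
         | ICase r u0 u1 u2 =>
             Some ((sel (bit_of (rd (inord (tape_index r)))) u0 u1 u2, false),
                   [ffun i : 'I_6 => (rd i, Stay)])
         | IFail => None
         end
       else None).

(** The head stands on the top of the stack. Cells are read with default [None] because moves leave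
    explicit blanks in the lists, so that a stack has many representations. *)
Definition stack_tape (M : tm) (t : tape M) (s : seq bool) : Prop :=
  (forall i, nth None (tleft t) i = None) /\
  (forall i, nth None (thead t :: tright t) i = nth None (map (Some \o inl) s) i).

Lemma stack_tape_init (M : tm) (w : seq bool) : stack_tape (tape_of M w) w.
Proof.
split; first by case: w => [|a w] i; rewrite nth_nil.
by case: w => [|a w] [|i] //=; rewrite nth_nil.
Qed.

Lemma stack_tape_word (M : tm) (t : tape M) s :
  stack_tape t s -> tape_word t = s.
Proof.
case=> _; rewrite /tape_word; elim: (_ :: _) s => [|c l IH] [|b s] H //=.
- by have := H 0.
- by have /= -> := H 0.
- by have /= -> := H 0; rewrite (IH s) // => i; exact: (H i.+1).
Qed.

Lemma stack_tape_id (M : tm) (t : tape M) s : stack_tape t s ->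
  stack_tape (tape_move Stay (tape_write (thead t) t)) s.
Proof. by case: t. Qed.

Lemma stack_tape_push (M : tm) (t : tape M) s b : stack_tape t s ->
  stack_tape (tape_move Stay (tape_write (Some (inl b))
    (tape_move MoveLeft (tape_write (thead t) t)))) (b :: s).
Proof.
case: t => [[|c l] h r] [/= H1 H2]; split=> [i|i] //=.
- by case: i => [|i] //=; apply: H2.
- exact: (H1 i.+1).
- by case: i => [|i] //=; apply: H2.
Qed.

Lemma stack_tape_pop (M : tm) (t : tape M) s : stack_tape t s ->
  stack_tape (tape_move MoveRight (tape_write None t)) (behead s).
Proof.
case: t => [l h r] [/= H1 H2]; split=> [i|i] /=.
- by case: r {H2} => [|c r]; case: i => [|i] //=; apply: H1.
- have <- : nth None r i = nth None (map (Some \o inl) (behead s)) i.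
    by have /= -> := H2 i.+1; case: s {H2}; rewrite ?nth_nil.
  by case: r {H1 H2} => [|c r]; case: i => [|i] //=; rewrite nth_nil.
Qed.

Lemma stack_tape_top (f : frag) (t : tape (tm_of f)) s T (x y z : T) :
  stack_tape t s -> sel (bit_of (thead t)) x y z = sel s x y z.
Proof.
by case=> _ /(_ 0) /= ->; case: s => [|[]].
Qed.

Section Simulation.
Variable f : frag.
Let M := tm_of f.

Definition stands_for (c : config M) (t : option (fstate f)) (e : env) : Prop :=
  c.1 = (t, false) /\ forall i, stack_tape (c.2 i) (reg_at e i).

Definition halted_as (c : config M) (o : option env) : Prop :=
  Defs.step c = None /\
  if o is Some e then stands_for c None e else ~~ accept c.1.

Lemma runs_tm t e n o (c : config M) : runs t e n o -> stands_for c t e ->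
  exists s c', [/\ s <= 2 * n,
    iter s (obind (@Defs.step M)) (Some c) = Some c' & halted_as c' o].
Proof.
move=> H; elim: H c => {t e n o}.
- move=> e c [c1 c2]; exists 0, c; split => //; split=> //.
  by rewrite /Defs.step c1.
- move=> s e r b t n o E _ IH c [c1 c2].
  pose c' : config M := ((Some s, true), [ffun i : 'I_6 => tape_move
    (if i == tape_index r :> nat then MoveLeft else Stay)
    (tape_write (thead (c.2 i)) (c.2 i))]).
  pose c'' : config M := ((t, false), [ffun i : 'I_6 => tape_move Stay (tape_write
    (if i == tape_index r :> nat then Some (inl b) else thead (c'.2 i)) (c'.2 i))]).
  have S1 : Defs.step c = Some c'.
    rewrite /Defs.step c1 /= E; congr (Some (_, _)).
    by apply/ffunP => i; rewrite !ffunE /= ?ffunE.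
  have S2 : Defs.step c' = Some c''.
    rewrite /Defs.step /= E; congr (Some (_, _)).
    by apply/ffunP => i; rewrite !ffunE; case: ifP => ir; rewrite /= ?ffunE /= ?ir //;
      rewrite ffunE.
  have [|m [d [Hm Hd Hh]]] := IH c''.
    split=> // i; rewrite !ffunE getn_set.
    case: ifP => [/eqP ir|ir]; last by rewrite ?ir; do 2 apply: stack_tape_id.
    by rewrite ?ir ?eqxx; apply: stack_tape_push; rewrite -getn_rix -ir.
  exists m.+2, d; split=> //; first by rewrite mulnS !ltnS.
  by rewrite 2!iterSr [obind _ (Some c)]S1 [obind _ (Some c')]S2.
- move=> s e r t n o E _ IH c [c1 c2].
  pose c' : config M := ((t, false), [ffun i : 'I_6 =>
    if i == tape_index r :> nat then tape_move MoveRight (tape_write None (c.2 i))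
    else tape_move Stay (tape_write (thead (c.2 i)) (c.2 i))]).
  have S1 : Defs.step c = Some c'.
    rewrite /Defs.step c1 /= E; congr (Some (_, _)).
    by apply/ffunP => i; rewrite !ffunE /=; case: ifP => _ //=; rewrite !ffunE.
  have [|m [d [Hm Hd Hh]]] := IH c'.
    split=> // i; rewrite !ffunE getn_set.
    case: ifP => [/eqP ir|_]; last exact: stack_tape_id.
    by apply: stack_tape_pop; rewrite -getn_rix -ir.
  exists m.+1, d; split=> //; first by rewrite mulnS ltnS ltnW.
  by rewrite iterSr [obind _ (Some c)]S1.
- move=> s e r t0 t1 t2 n o E _ IH c [c1 c2].
  pose c' : config M := ((sel (get e r) t0 t1 t2, false), [ffun i : 'I_6 =>
    tape_move Stay (tape_write (thead (c.2 i)) (c.2 i))]).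
  have S1 : Defs.step c = Some c'.
    rewrite /Defs.step c1 /= E; congr (Some (_, _)); last first.
      by apply/ffunP => i; rewrite !ffunE /= ?ffunE.
    congr (_, _); rewrite ffunE.
    have := c2 (inord (tape_index r)); rewrite inordK ?getn_rix; last by case: r {E IH c'}.
    exact: stack_tape_top.
  have [|m [d [Hm Hd Hh]]] := IH c'.
    by split=> // i; rewrite !ffunE; apply: stack_tape_id.
  exists m.+1, d; split=> //; first by rewrite mulnS ltnS ltnW.
  by rewrite iterSr [obind _ (Some c)]S1.
- move=> s e E c [c1 c2]; exists 0, c; split=> //; split.
    by rewrite /Defs.step c1 /= E.
  by rewrite c1.
Qed.

Lemma exec_tm x y n o : exec f (Env x y [::] [::] [::] [::]) n o ->
  exists c : config M, halts_within x y (2 * n) c /\ halted_as c o.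
Proof.
move=> /runs_tm H; have [|s [c [s_le Hc [c_end Ho]]]] := H (init M x y).
  split=> // i; rewrite ffunE.
  have -> : reg_at (Env x y [::] [::] [::] [::]) i = nth [::] [:: x; y] i.
    by case: i => [[|[|[|[|[|[|[]]]]]]]].
  exact: stack_tape_init.
by exists c; split=> //; exists s.
Qed.
End Simulation.

(** * Trees on a stack *)

Inductive data := Lf | Nd of data & data.

Fixpoint code (x : data) : seq bool :=
  if x is Nd a b then true :: code a ++ code b else [:: false].

(** The loop test hides the bit it saw from the body, so the body tests again; its empty branch is
    never reached. *)
Definition drain (r : reg) (h : bool -> frag) : frag :=
  fWhile r true true (fIf r fFail (fSeq (fPop r) (h true)) (fSeq (fPop r) (h false))).

(** [G p s] is the environment when [p] has been read, in reverse, and [s] is left. A round costs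
    the loop test, the second test, the pop and the [k] steps of the handler, the same for both
    bits. *)
Lemma exec_drain (r : reg) (h : bool -> frag) (G : seq bool -> seq bool -> env)
    (k : nat) :
  (forall p s, get (G p s) r = s) ->
  (forall p b s, exec (h b) (set (G p (b :: s)) r s) k (Some (G (b :: p) s))) ->
  forall s p, exec (drain r h) (G p s) (size s * k.+3).+1 (Some (G (catrev s p) [::])).
Proof.
move=> Hg Hh; elim=> [|b s IH] p /=.
  by apply: exec_while_stop; rewrite Hg.
rewrite mulSn (_ : (_ + _).+1 = (k.+2 + (size s * k.+3).+1).+1); last by lia.
refine (exec_while (p := true) (q := true) _ _ (IH _)); first by rewrite Hg; case: b.
apply: exec_if; rewrite Hg -[k.+1]add1n.
have P := exec_pop r (G p (b :: s)); rewrite Hg /= in P.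
by case: b P Hh => P Hh /=; apply: exec_seq P (Hh _ _ _).
Qed.

Definition stk X Y R : env := Env X Y R [::] [::] [::].

(** Scratch registers are empty before and after and the inputs are kept, so such fragments can be
    chained freely. *)
Definition moves (f : frag) (R : seq bool) (n : nat) (R' : seq bool) : Prop :=
  forall X Y, exists2 m, m <= n & exec f (stk X Y R) m (Some (stk X Y R')).

Lemma moves_le f R n n' R' : n <= n' -> moves f R n R' -> moves f R n' R'.
Proof.
by move=> nn' H X Y; have [m mn] := H X Y; exists m => //; apply: leq_trans nn'.
Qed.

Lemma moves_seq f g R n R1 n' R2 : moves f R n R1 -> moves g R1 n' R2 ->
  moves (fSeq f g) R (n + n') R2.
Proof.
move=> Hf Hg X Y; have [m mn Hm] := Hf X Y; have [m' mn' Hm'] := Hg X Y.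
by exists (m + m'); [apply: leq_add | apply: exec_seq Hm Hm'].
Qed.

Lemma moves_push b R : moves (fPush RR b) R 1 (b :: R).
Proof. by move=> X Y; exists 1 => //; apply: exec_push. Qed.

Lemma moves_pop b R : moves (fPop RR) (b :: R) 1 R.
Proof.
by move=> X Y; exists 1 => //; apply: (exec_pop RR (stk X Y (b :: R))).
Qed.

Lemma moves_if f0 f1 f2 b R n R' : moves (if b then f1 else f2) (b :: R) n R' ->
  moves (fIf RR f0 f1 f2) (b :: R) n.+1 R'.
Proof.
move=> H X Y; have [m mn Hm] := H X Y; exists m.+1 => //.
by apply: exec_if => /=; case: (b) Hm.
Qed.

(* [d] selects the register that receives the reversed code. *)
Definition move_item (d : bool) : frag :=
  let dst := if d then RA else RS in
  fSeq (fPush RB true) (fWhile RB true true (fIf RR fFail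
    (fSeq (fPop RR) (fSeq (fPush dst true) (fPush RB true)))
    (fSeq (fPop RR) (fSeq (fPush dst false) (fPop RB))))).

Definition env_to (d : bool) X Y R T O B :=
  if d then Env X Y R O T B else Env X Y R T O B.

(** [RB] counts in unary the subtrees still to be read: a node replaces one by two, a leaf removes
    one, and the code ends when the count is empty. *)
Lemma exec_move_item d X Y x R T O :
  exec (move_item d) (env_to d X Y (code x ++ R) T O [::]) (5 * size (code x) + 2)
    (Some (env_to d X Y R (catrev (code x) T) O [::])).
Proof.
rewrite /move_item; set W := fWhile _ _ _ _.
have loop B n o : exec W (env_to d X Y R (catrev (code x) T) O B) n o ->
    exec W (env_to d X Y (code x ++ R) T O (true :: B)) (5 * size (code x) + n) o.
  elim: x R T B n o => [|a IHa b IHb] R' T' B n o /= H.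
    rewrite /W -[5 * 1 + n]/((4 + n).+1).
    refine (exec_while (p := true) (q := true) _ _ H); first by case: (d).
    apply: exec_if; rewrite -[3]/(1 + (1 + 1)).
    case: (d); do 2 (apply: exec_seq; first by [apply: exec_pop|apply: exec_push]);
      exact: exec_pop.
  rewrite catrev_catl in H; rewrite -catA.
  have := IHa (code b ++ R') (true :: T') (true :: B) _ _ (IHb _ _ _ _ _ H).
  move=> H'; rewrite (_ : _ + n =
    (4 + (5 * size (code a) + (5 * size (code b) + n))).+1); last first.
    by rewrite /= size_cat; lia.
  refine (exec_while (p := true) (q := true) _ _ H'); first by case: (d).
  apply: exec_if; rewrite -[3]/(1 + (1 + 1)).
  case: (d); do 2 (apply: exec_seq; first by [apply: exec_pop|apply: exec_push]);
      exact: exec_push.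
rewrite (_ : _ + 2 = 1 + (5 * size (code x) + 1)); last by lia.
apply: (@exec_seq _ _ _ _ (env_to d X Y (code x ++ R) T O [:: true])).
  by case: (d); apply: exec_push.
by apply: loop; apply: exec_while_stop; case: (d).
Qed.

Definition pour (src dst : reg) : frag := drain src (fPush dst).

Definition fdrop : frag := fSeq (move_item true) (drain RA (fun _ => fPop RB)).

(** Each transfer between registers reverses a code. Draining the reversed code in [RA] restores the
    original on [RR] and leaves an upright copy in [RS], which reaches [RR] upright after a detour
    through [RA]. *)
Definition fdup : frag :=
  fSeq (move_item true)
  (fSeq (drain RA (fun b => fSeq (fPush RR b) (fPush RS b)))
  (fSeq (pour RS RA) (pour RA RR))).

Definition fswap : frag :=
  fSeq (move_item true) (fSeq (move_item false)
  (fSeq (pour RA RR) (pour RS RR))).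

Lemma exec_pour r dst (G : seq bool -> seq bool -> env) :
  (forall p s, get (G p s) r = s) ->
  (forall p b s, set (set (G p (b :: s)) r s) dst
     (b :: get (set (G p (b :: s)) r s) dst) = G (b :: p) s) ->
  forall s, exec (pour r dst) (G [::] s) (size s * 4).+1 (Some (G (rev s) [::])).
Proof.
move=> H1 H2 s; apply: (@exec_drain r _ G 1) => // p b s'.
by rewrite -H2; apply: exec_push.
Qed.

Lemma moves_dup x R : moves fdup (code x ++ R) (22 * size (code x) + 5)
  (code x ++ code x ++ R).
Proof.
move=> X Y; set s := code x.
have H1 := exec_move_item true X Y x R [::] [::].
have H2 : exec (drain RA (fun b => fSeq (fPush RR b) (fPush RS b)))
    (Env X Y R [::] (rev s) [::]) (size s * 5).+1 (Some (Env X Y (s ++ R) s [::] [::])).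
  rewrite -(size_rev s) -{3 4}[s]revK.
  apply: (@exec_drain RA _ (fun p s => Env X Y (p ++ R) p s [::]) 2 _ _ _ [::]).
    by [].
  by move=> p b s'; exact: (exec_seq (exec_push RR b _) (exec_push RS b _)).
have H3 := @exec_pour RS RA (fun p s' => Env X Y (s ++ R) s' p [::])
  (fun _ _ => erefl) (fun _ _ _ => erefl) s.
have H4 := @exec_pour RA RR (fun p s' => Env X Y (p ++ s ++ R) [::] s' [::])
  (fun _ _ => erefl) (fun _ _ _ => erefl) (rev s).
rewrite revK size_rev in H4.
eexists; last exact: (exec_seq H1 (exec_seq H2 (exec_seq H3 H4))).
by rewrite -/s; lia.
Qed.

Lemma moves_swap x y R : moves fswap (code x ++ code y ++ R)
  (9 * (size (code x) + size (code y)) + 6) (code y ++ code x ++ R).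
Proof.
move=> X Y.
have H1 := exec_move_item true X Y x (code y ++ R) [::] [::].
have H2 := exec_move_item false X Y y R [::] (rev (code x)).
have H3 := @exec_pour RA RR (fun p s' => Env X Y (p ++ R) (rev (code y)) s' [::])
  (fun _ _ => erefl) (fun _ _ _ => erefl) (rev (code x)).
have H4 := @exec_pour RS RR (fun p s' => Env X Y (p ++ code x ++ R) s' [::] [::])
  (fun _ _ => erefl) (fun _ _ _ => erefl) (rev (code y)).
rewrite !revK !size_rev in H3 H4.
eexists; last exact: (exec_seq H1 (exec_seq H2 (exec_seq H3 H4))).
by lia.
Qed.

Lemma moves_drop x R : moves fdrop (code x ++ R) (9 * size (code x) + 3) R.
Proof.
move=> X Y.
have H1 := exec_move_item true X Y x R [::] [::].
have H2 := @exec_drain RA (fun _ => fPop RB) (fun p s' => Env X Y R [::] s' [::]) 1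
  (fun _ _ => erefl) (fun _ _ _ => exec_pop RB _) (rev (code x)) [::].
rewrite size_rev in H2.
eexists; last exact: (exec_seq H1 H2).
by lia.
Qed.

Lemma moves_while f R n R1 n' R2 : moves f (true :: R) n R1 ->
  moves (fWhile RR true false f) R1 n' R2 ->
  moves (fWhile RR true false f) (true :: R) (n + n').+1 R2.
Proof.
move=> Hf Hg X Y; have [m mn Hm] := Hf X Y; have [m' mn' Hm'] := Hg X Y.
exists (m + m').+1; first by rewrite ltnS leq_add.
exact: (exec_while (p := true) (q := false) _ Hm Hm').
Qed.

Lemma moves_while_stop f R :
  moves (fWhile RR true false f) (false :: R) 1 (false :: R).
Proof. by move=> X Y; exists 1 => //; apply: exec_while_stop. Qed.

(** * Polynomial bounds *)

Definition ev (p : {poly nat}) (n : nat) : nat := p.[n]%R.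

Lemma evD p q n : ev (p + q)%R n = ev p n + ev q n.
Proof. by rewrite /ev hornerD. Qed.

Lemma evM p q n : ev (p * q)%R n = ev p n * ev q n.
Proof. by rewrite /ev hornerM. Qed.

(** The coefficients are natural numbers, so every polynomial is monotone and bounds can be
    substituted into each other. *)
Lemma ev_mono (p : {poly nat}) m n : m <= n -> ev p m <= ev p n.
Proof.
move=> mn; elim/poly_ind: p => [|p c IH]; first by rewrite /ev !horner0.
rewrite !evD !evM /ev !hornerX !hornerC.
by rewrite leq_add2r leq_mul.
Qed.

Definition pbound (g : nat -> nat) : Prop :=
  exists p : {poly nat}, forall n, g n <= ev p n.

Lemma pbound_const c : pbound (fun _ => c).
Proof. by exists (c%:P)%R => n; rewrite /ev hornerC. Qed.

Lemma pbound_id : pbound (fun n => n).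
Proof. by exists 'X%R => n; rewrite /ev hornerX. Qed.

Lemma pbound_add g h : pbound g -> pbound h -> pbound (fun n => g n + h n).
Proof. by move=> [p Hp] [q Hq]; exists (p + q)%R => n; rewrite evD leq_add. Qed.

Lemma pbound_succ g : pbound g -> pbound (fun n => (g n).+1).
Proof.
move=> [p Hp]; exists (p + 1%:P)%R => n.
by rewrite evD -addn1 leq_add // /ev hornerC.
Qed.

Lemma pbound_mul g h : pbound g -> pbound h -> pbound (fun n => g n * h n).
Proof. by move=> [p Hp] [q Hq]; exists (p * q)%R => n; rewrite evM leq_mul. Qed.

Lemma pbound_ev p g : pbound g -> pbound (fun n => ev p (g n)).
Proof.
move=> [q Hq]; exists (p \Po q)%R => n; rewrite {2}/ev horner_comp.
exact: ev_mono.
Qed.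

Ltac pbound := repeat first
  [ apply: pbound_ev | apply: pbound_succ | apply: pbound_add
  | apply: pbound_mul | apply: pbound_id | apply: pbound_const ].

(** * Polynomial-time functions *)

Class Enc (T : Type) := enc : T -> data.

#[export] Instance Enc_data : Enc data := id.
#[export] Instance Enc_unit : Enc unit := fun _ => Lf.
#[export] Instance Enc_bool : Enc bool := fun b => if b then Nd Lf Lf else Lf.
#[export] Instance Enc_prod A B {eA : Enc A} {eB : Enc B} : Enc (A * B)%type :=
  fun x => Nd (enc x.1) (enc x.2).
#[export] Instance Enc_seq A {eA : Enc A} : Enc (seq A) :=
  foldr (fun x d => Nd (enc x) d) Lf.
(** The natural numbers handled by programs are positions, counters and gadget values, all
    polynomially bounded, hence unary; large integers get binary digits in [Enc_int]. *)
#[export] Instance Enc_nat : Enc nat := fun n => iter n (Nd Lf) Lf.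

Definition sz (T : Type) {eT : Enc T} (x : T) : nat := size (code (enc x)).

Lemma sz_gt0 A {eA : Enc A} (x : A) : 0 < sz x.
Proof. by rewrite /sz; case: (enc x). Qed.

Section Size.
Context (A B : Type) {eA : Enc A} {eB : Enc B}.

Lemma sz_pair (x : A) (y : B) : sz (x, y) = (sz x + sz y).+1.
Proof. by rewrite /sz /= size_cat. Qed.

Lemma sz_cons (x : A) (s : seq A) : sz (x :: s) = (sz x + sz s).+1.
Proof. by rewrite /sz /= size_cat. Qed.

Lemma code_pair (x : A) (y : B) r :
  true :: code (enc x) ++ code (enc y) ++ r = code (enc (x, y)) ++ r.
Proof. by rewrite /= -catA. Qed.

Lemma sz_bool (b : bool) : sz b <= 3.
Proof. by case: b. Qed.

Lemma sz_nat (n : nat) : sz n = n.*2.+1.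
Proof. by rewrite /sz; elim: n => //= n ->. Qed.

Lemma size_sz (s : seq A) : size s <= sz s.
Proof.
elim: s => [|x s IH] //=; rewrite sz_cons ltnS.
by apply: leq_trans IH _; apply: leq_addl.
Qed.

Lemma sz_cat (s t : seq A) : (sz (s ++ t)).+1 = sz s + sz t.
Proof. by elim: s => [|x s IH] //=; rewrite !sz_cons; lia. Qed.

Lemma sz_catrev (s t : seq A) : (sz (catrev s t)).+1 = sz s + sz t.
Proof. by elim: s t => [|x s IH] //= t; have := IH (x :: t); rewrite !sz_cons; lia. Qed.

Lemma sz_rev (s : seq A) : sz (rev s) = sz s.
Proof. by apply/eqP; rewrite -eqSS sz_catrev addn1. Qed.

Lemma sz_take k (s : seq A) : sz (take k s) <= sz s.
Proof.
have := sz_cat (take k s) (drop k s); rewrite cat_take_drop.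
have : 0 < sz (drop k s) by exact: sz_gt0.
lia.
Qed.

Lemma sz_le (s : seq A) n : (forall x, List.In x s -> sz x <= n) ->
  sz s <= (size s * n.+1).+1.
Proof.
elim: s => [|x s IH] //= H; rewrite sz_cons.
have := H x (or_introl erefl); have := IH (fun y yin => H y (or_intror yin)); lia.
Qed.
End Size.

Lemma sz_bits (x : seq bool) : sz x <= 4 * size x + 1.
Proof. by elim: x => //= b x IH; rewrite sz_cons; have := sz_bool b; lia. Qed.

(** Quantifying over the stack [r] below the argument is the frame condition on which pairing and
    iteration rely. *)
Definition PT A B {eA : Enc A} {eB : Enc B} (f : A -> B) : Prop :=
  exists fr (q : {poly nat}), forall a r,
    moves fr (code (enc a) ++ r) (ev q (sz a)) (code (enc (f a)) ++ r).

Lemma PT_intro A B {eA : Enc A} {eB : Enc B} (f : A -> B) fr g : pbound g ->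
  (forall a r, moves fr (code (enc a) ++ r) (g (sz a)) (code (enc (f a)) ++ r)) ->
  PT f.
Proof.
move=> [q Hq] H; exists fr, q => a r; exact: moves_le (H a r).
Qed.

Lemma PT_size A B {eA : Enc A} {eB : Enc B} (f : A -> B) : PT f ->
  exists q, forall a, sz (f a) <= ev q (sz a).
Proof.
move=> [fr [q H]]; exists ('X + q)%R => a.
have [m mq /runs_size] := H a [::] [::] [::]; rewrite /= !cats0 => H1.
by rewrite evD {1}/ev hornerX; apply: leq_trans H1 _; rewrite leq_add2l.
Qed.

(* Only the encodings matter, so values may be reinterpreted at another type. *)
Lemma PT_cast A A' B B' {eA : Enc A} {eA' : Enc A'} {eB : Enc B} {eB' : Enc B'}
    (h : A' -> A) (f : A -> B) (g : A' -> B') :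
  (forall a, enc (h a) = enc a) -> (forall a, enc (g a) = enc (f (h a))) ->
  PT f -> PT g.
Proof.
move=> Hh Hg [fr [q H]]; exists fr, q => a r.
by have := H (h a) r; rewrite -Hg Hh /sz Hh.
Qed.

Lemma PT_ext A B {eA : Enc A} {eB : Enc B} (f g : A -> B) : f =1 g -> PT f -> PT g.
Proof. by move=> E; apply: (PT_cast (h := id)) => // a; rewrite E. Qed.

Lemma PT_id A {eA : Enc A} : PT (fun a : A => a).
Proof.
apply: (@PT_intro _ _ _ _ _ (fSeq (fPush RR true) (fPop RR)) (fun _ => 2)) => [|a r].
  by pbound.
exact: moves_seq (moves_push _ _) (moves_pop _ _).
Qed.

Section Closure.
Context (E : Type) {eE : Enc E}.

Lemma PT_comp B C {eB : Enc B} {eC : Enc C} (g : B -> C) (f : E -> B) :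
  PT g -> PT f -> PT (fun e => g (f e)).
Proof.
move=> [gr [p Hg]] Hf; have [s Hs] := PT_size Hf; have {Hf} [fr [q Hf]] := Hf.
apply: (@PT_intro _ _ _ _ _ (fSeq fr gr) (fun n => ev q n + ev p (ev s n))).
  by pbound.
move=> a r; apply: moves_seq (Hf a r) _; apply: moves_le (Hg _ _).
exact: ev_mono.
Qed.

Fixpoint fPushs (w : seq bool) : frag :=
  if w is b :: w' then fSeq (fPushs w') (fPush RR b) else fSeq (fPush RR true) (fPop RR).

Lemma moves_pushs w R : moves (fPushs w) R (size w + 2) (w ++ R).
Proof.
elim: w => [|b w IH] /=; first exact: moves_seq (moves_push true R) (moves_pop _ _).
by rewrite addSn -addn1; apply: moves_seq IH (moves_push _ _).
Qed.

Lemma PT_pair B C {eB : Enc B} {eC : Enc C} (f : E -> B) (g : E -> C) :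
  PT f -> PT g -> PT (fun e => (f e, g e)).
Proof.
move=> Hf Hg; have [s Hs] := PT_size Hf; have [t Ht] := PT_size Hg.
move: Hf Hg => [fr [q Hf]] [gr [p Hg]].
apply: (@PT_intro _ _ _ _ _
  (fSeq fdup (fSeq fr (fSeq fswap (fSeq gr (fSeq fswap (fPush RR true))))))
  (fun n => (22 * n + 5) + (ev q n + ((9 * (ev s n + n) + 6) +
    (ev p n + ((9 * (ev t n + ev s n) + 6) + 1)))))).
  by pbound.
move=> a r; apply: moves_seq (moves_dup _ _) _.
apply: moves_seq (Hf _ _) _; apply: moves_seq.
  by apply: moves_le (moves_swap _ _ _); rewrite leq_add2r leq_mul2l leq_add2r Hs.
apply: moves_seq (Hg _ _) _; apply: moves_seq.
  by apply: moves_le (moves_swap _ _ _); rewrite leq_add2r leq_mul2l leq_add ?Hs ?Ht.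
by rewrite /= -catA; apply: moves_push.
Qed.

Lemma PT_fst B C {eB : Enc B} {eC : Enc C} (f : E -> B * C) :
  PT f -> PT (fun e => (f e).1).
Proof.
apply: PT_comp; apply: (@PT_intro _ _ _ _ _ (fSeq (fPop RR) (fSeq fswap fdrop))
  (fun n => 1 + ((9 * n + 6) + (9 * n + 3)))); first by pbound.
move=> [a b] r; rewrite sz_pair /= -catA; apply: moves_seq (moves_pop _ _) _.
apply: moves_seq.
  by apply: moves_le (moves_swap _ _ _); rewrite /sz; lia.
by apply: moves_le (moves_drop _ _); rewrite /sz; lia.
Qed.

Lemma PT_snd B C {eB : Enc B} {eC : Enc C} (f : E -> B * C) :
  PT f -> PT (fun e => (f e).2).
Proof.
apply: PT_comp; apply: (@PT_intro _ _ _ _ _ (fSeq (fPop RR) fdrop)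
  (fun n => 1 + (9 * n + 3))); first by pbound.
move=> [a b] r; rewrite sz_pair /= -catA; apply: moves_seq (moves_pop _ _) _.
by apply: moves_le (moves_drop _ _); rewrite /sz; lia.
Qed.

Lemma PT_const B {eB : Enc B} (c : B) : PT (fun _ : E => c).
Proof.
apply: (@PT_intro _ _ _ _ _ (fSeq fdrop (fPushs (code (enc c))))
  (fun n => (9 * n + 3) + (sz c + 2))); first by pbound.
move=> a r; apply: moves_seq (moves_drop _ _) _; exact: moves_pushs.
Qed.

(* The test is run on a copy; [true] is coded by three bits. *)
Lemma PT_if B {eB : Enc B} (b : E -> bool) (f g : E -> B) :
  PT b -> PT f -> PT g -> PT (fun e => if b e then f e else g e).
Proof.
move=> [br [qb Hb]] [fr [qf Hf]] [gr [qg Hg]].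
apply: (@PT_intro _ _ _ _ _ (fSeq fdup (fSeq br (fIf RR fFail
    (fSeq (fPop RR) (fSeq (fPop RR) (fSeq (fPop RR) fr))) (fSeq (fPop RR) gr))))
  (fun n => (22 * n + 5) + (ev qb n + (1 + (1 + (1 + ev qf n + ev qg n))).+1))).
  by pbound.
move=> a r; apply: moves_seq (moves_dup _ _) _; apply: moves_seq (Hb _ _) _.
case: (b a) => /=; apply: moves_if.
  do 2 apply: moves_seq (moves_pop _ _) _.
  apply: (@moves_le _ _ (1 + ev qf (sz a))); first by rewrite leq_addr.
  by apply: moves_seq (moves_pop _ _) _; apply: Hf.
apply: (@moves_le _ _ (1 + ev qg (sz a))); first by lia.
by apply: moves_seq (moves_pop _ _) _; apply: Hg.
Qed.

(** A nonempty list has the code of the pair of its head and its tail, so destructuring is free: a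
    test of the top bit, a swap and a pushed pair bit produce [(e, (x, s))]. *)
Lemma PT_case X B {eX : Enc X} {eB : Enc B} (l : E -> seq X) (f : E -> B)
    (g : E -> X -> seq X -> B) :
  PT l -> PT f -> PT (fun p : E * (X * seq X) => g p.1 p.2.1 p.2.2) ->
  PT (fun e => if l e is x :: s then g e x s else f e).
Proof.
move=> Hl; have [t Ht] := PT_size Hl; move: Hl => [lr [ql Hl]].
move=> [fr [qf Hf]] [gr [qg Hg]].
apply: (@PT_intro _ _ _ _ _ (fSeq fdup (fSeq lr (fIf RR fFail
    (fSeq fswap (fSeq (fPush RR true) gr)) (fSeq (fPop RR) fr))))
  (fun n => (22 * n + 5) + (ev ql n + ((9 * (ev t n + n) + 6) +
    (1 + ev qg (n + ev t n).+1) + (1 + ev qf n)).+1))).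
  by pbound.
move=> a r; apply: moves_seq (moves_dup _ _) _; apply: moves_seq (Hl _ _) _.
have := Ht a; case: (l a) => [|x s] st.
  apply: moves_if; apply: (@moves_le _ _ (1 + ev qf (sz a))).
    by rewrite leq_addl.
  by apply: moves_seq (moves_pop _ _) _; apply: Hf.
apply: (@moves_if _ _ _ true).
apply: (@moves_le _ _ ((9 * (ev t (sz a) + sz a) + 6) +
    (1 + ev qg (sz a + ev t (sz a)).+1))); first by rewrite leq_addr.
apply: moves_seq.
  apply: (moves_le _ (moves_swap (enc (x :: s)) (enc a) r)).
  by rewrite leq_add2r leq_mul2l leq_add2r.
apply: moves_seq (moves_push _ _) _.
have := Hg (a, (x, s)) r; rewrite /= -catA => H; apply: moves_le H.
by apply: ev_mono; rewrite sz_pair ltnS leq_add2l.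
Qed.

Lemma PT_cons X {eX : Enc X} (f : E -> X) (g : E -> seq X) :
  PT f -> PT g -> PT (fun e => f e :: g e).
Proof. by move=> Hf Hg; apply: (PT_cast (h := id)) (PT_pair Hf Hg). Qed.
End Closure.

(** * Bounded iteration along a list *)

Section Fold.
Context (E A X : Type) {eE : Enc E} {eA : Enc A} {eX : Enc X}.

(** Iterating a polynomial-time step may blow up its result exponentially. The bound [B] on all
    intermediate accumulators, as in Cobham's limited recursion, keeps every round polynomial. *)
Lemma PT_foldl (f : E -> A -> X -> A) (i : E -> A) (l : E -> seq X) (B : nat -> nat) :
  PT (fun p : E * A * X => f p.1.1 p.1.2 p.2) -> PT i -> PT l -> pbound B ->
  (forall e k, sz (foldl (f e) (i e) (take k (l e))) <= B (sz e)) ->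
  PT (fun e => foldl (f e) (i e) (l e)).
Proof.
move=> Hf Hi Hl [b Bb] HB; have [t Ht] := PT_size Hl.
pose body (s : seq X * (A * E)) : seq X * (A * E) :=
  if s.1 is x :: l' then (l', (f s.2.2 s.2.1 x, s.2.2)) else s.
have [br [qb Hb]] : PT body.
  apply: PT_case; [exact: PT_fst PT_id | exact: PT_id |].
  pose T := ((seq X * (A * E)) * (X * seq X))%type.
  have I : PT (fun p : T => p) by apply: PT_id.
  apply: PT_pair; first exact: PT_snd (PT_snd I).
  apply: PT_pair; last exact: PT_snd (PT_snd (PT_fst I)).
  apply: (PT_comp Hf (f := fun p : T => (p.1.2.2, p.1.2.1, p.2.1))).
  apply: PT_pair; last exact: PT_fst (PT_snd I).
  apply: PT_pair; first exact: PT_snd (PT_snd (PT_fst I)).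
  exact: PT_fst (PT_snd (PT_fst I)).
have [ir [qi Hstart]] : PT (fun e => (l e, (i e, e))).
  by apply: PT_pair => //; apply: PT_pair => //; apply: PT_id.
have [fr [qf Hfst]] : PT (fun s : A * E => s.1) by apply: PT_fst PT_id.
pose S n := ev t n + (ev b n + n).+2.
pose body_time n := ev qb (S n) + 1.
pose W' := fWhile RR true false (fSeq (fPush RR true) (fSeq br (fPop RR))).
apply: (@PT_intro _ _ _ _ _ (fSeq ir (fSeq (fPop RR) (fSeq W' (fSeq (fPop RR) fr))))
  (fun n => ev qi n + (1 + ((ev t n * (body_time n).+2 + 1) + (1 + ev qf (ev b n + n).+1))))).
  by rewrite /body_time /S; pbound.
move=> e r; apply: moves_seq (Hstart e r) _; rewrite /= -catA.
apply: moves_seq (moves_pop _ _) _.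
(* Between rounds the remaining list lies on top of the pair of accumulator and environment,
   unpaired, so that the bit tested by the loop is the cons bit of the list. Pushing [true] pairs
   the two for [body]; the bit is popped afterwards. *)
have loop k l' a : k + size l' = size (l e) -> drop k (l e) = l' ->
    a = foldl (f e) (i e) (take k (l e)) ->
    moves W' (code (enc l') ++ code (enc (a, e)) ++ r)
      (size l' * (body_time (sz e)).+2 + 1)
      (false :: code (enc (foldl (f e) a l', e)) ++ r).
  elim: l' k a => [|x l' IH] k a Hk Hd Ha; first exact: moves_while_stop.
  have ksz : k < size (l e) by rewrite -Hk /= -addSnnS leq_addr.
  have Hd' : drop k.+1 (l e) = l' by rewrite -addn1 addnC -drop_drop Hd /= drop0.
  have nthx : take k.+1 (l e) = rcons (take k (l e)) x.
    by have := nth_drop k x (l e) 0; rewrite (take_nth x) // Hd addn0 /= => <-.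
  have := IH k.+1 (f e a x); rewrite nthx foldl_rcons -Ha => {}IH.
  set c := (body_time (sz e)).+2 in IH *.
  have -> : size (x :: l') * c + 1 =
      ((body_time (sz e)).+1 + (size l' * c + 1)).+1 by rewrite /= mulSn /c; lia.
  apply: moves_while (IH _ Hd' erefl); last by rewrite -Hk /= addSnnS.
  rewrite -add1n; apply: moves_seq (moves_push _ _) _.
  rewrite /body_time; apply: moves_seq; last exact: (moves_pop true).
  have H' : moves br (true :: code (enc (x :: l')) ++ code (enc (a, e)) ++ r)
      (ev qb (sz (x :: l', (a, e))))
      (true :: code (enc l') ++ code (enc (f e a x, e)) ++ r).
    rewrite (code_pair (x :: l') (a, e)) (code_pair l' (f e a x, e)).
    exact: (Hb (x :: l', (a, e)) r).
  apply: moves_le H'; apply: ev_mono; rewrite /S !sz_pair.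
  have : sz (x :: l') <= ev t (sz e).
    apply: leq_trans (Ht e); rewrite -Hd.
    have : (sz (take k (l e) ++ drop k (l e))).+1 =
      sz (take k (l e)) + sz (drop k (l e)) by exact: sz_cat.
    rewrite cat_take_drop; have : 0 < sz (take k (l e)) by exact: sz_gt0.
    by lia.
  have : sz a <= ev b (sz e) by rewrite Ha; apply: leq_trans (HB e k) (Bb _).
  by lia.
have {}loop := loop 0 (l e) (i e) erefl (drop0 _) (esym (f_equal _ (take0 _))).
apply: moves_seq.
  apply: moves_le loop; rewrite leq_add2r leq_mul2r; apply/orP; right.
  by apply: leq_trans (size_sz _) (Ht e).
apply: moves_seq (moves_pop _ _) _.
apply: moves_le (Hfst (_, e) r); apply: ev_mono; rewrite sz_pair ltnS leq_add2r.
by have := HB e (size (l e)); rewrite take_size => H; apply: leq_trans H (Bb _).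
Qed.
End Fold.

Ltac pt_proj := repeat match goal with
  | |- PT (fun e => e) => exact PT_id
  | |- PT fst => exact (PT_fst PT_id)
  | |- PT snd => exact (PT_snd PT_id)
  | |- PT (fun e => fst (@?f e)) => apply (PT_fst (f := f))
  | |- PT (fun e => snd (@?f e)) => apply (PT_snd (f := f))
  end.

(** * Booleans and lists *)

Lemma PT_negb E {eE : Enc E} (b : E -> bool) : PT b -> PT (fun e => ~~ b e).
Proof.
move=> Hb; apply: PT_ext (PT_if Hb (PT_const false) (PT_const true)) => e.
by case: (b e).
Qed.

Lemma PT_andb E {eE : Enc E} (b c : E -> bool) : PT b -> PT c -> PT (fun e => b e && c e).
Proof. by move=> Hb Hc; apply: PT_if Hb Hc (PT_const false). Qed.

Lemma PT_implb E {eE : Enc E} (b c : E -> bool) : PT b -> PT c -> PT (fun e => b e ==> c e).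
Proof. by move=> Hb Hc; apply: PT_if Hb Hc (PT_const true). Qed.

Lemma PT_eqb E {eE : Enc E} (b c : E -> bool) : PT b -> PT c -> PT (fun e => b e == c e).
Proof.
move=> Hb Hc; apply: PT_ext (PT_if Hb Hc (PT_negb Hc)) => e.
by case: (b e) (c e) => [] [].
Qed.

Lemma PT_foldl_bool E {eE : Enc E} X {eX : Enc X} (f : E -> bool -> X -> bool) (i : E -> bool)
    (l : E -> seq X) :
  PT (fun p : E * bool * X => f p.1.1 p.1.2 p.2) -> PT i -> PT l ->
  PT (fun e => foldl (f e) (i e) (l e)).
Proof.
move=> Hf Hi Hl; apply: (@PT_foldl _ _ _ _ _ _ _ _ _ (fun _ => 3)) => //.
  by pbound.
by move=> e k; apply: sz_bool.
Qed.

Lemma PT_all E {eE : Enc E} X {eX : Enc X} (f : E -> X -> bool) (l : E -> seq X) :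
  PT (fun p : E * X => f p.1 p.2) -> PT l -> PT (fun e => all (f e) (l e)).
Proof.
move=> Hf Hl.
have H : PT (fun e => foldl (fun b x => b && f e x) true (l e)).
  apply: (@PT_foldl_bool _ _ X _ (fun e b x => b && f e x)) => //; last first.
    exact: PT_const.
  have I : PT (fun p : E * bool * X => p) by apply: PT_id.
  apply: PT_andb; first by apply: PT_snd (PT_fst I).
  exact: PT_comp Hf (PT_pair (PT_fst (PT_fst I)) (PT_snd I)).
apply: PT_ext H => e; rewrite -[RHS]andTb.
by elim: (l e) true => [|x s IH] b /=; rewrite ?andbT // IH andbA.
Qed.

Lemma PT_has E {eE : Enc E} X {eX : Enc X} (f : E -> X -> bool) (l : E -> seq X) :
  PT (fun p : E * X => f p.1 p.2) -> PT l -> PT (fun e => has (f e) (l e)).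
Proof.
move=> Hf Hl; have H := PT_negb (PT_all (f := fun e x => ~~ f e x) (PT_negb Hf) Hl).
by apply: PT_ext H => e; rewrite -has_predC; apply: eq_has => x /=; apply: negbK.
Qed.

(** This is the left fold of [cons], to which reversal and concatenation reduce. *)
Lemma PT_catrev E {eE : Enc E} X {eX : Enc X} (s t : E -> seq X) : PT s -> PT t ->
  PT (fun e => catrev (s e) (t e)).
Proof.
move=> Hs Ht; have E1 u v : catrev u v = foldl (fun a x => x :: a) v u :> seq X.
  by elim: u v => //= x u IH v; rewrite IH.
have [p Hp] := PT_size Hs; have [q Hq] := PT_size Ht.
apply: (@PT_ext _ _ _ _ (fun e => foldl (fun a x => x :: a) (t e) (s e))).
  by move=> e; rewrite E1.
apply: (@PT_foldl _ _ _ _ _ _ (fun _ a x => x :: a) t s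
          (fun n => ev p n + ev q n)) => //.
- have I : PT (fun p : E * seq X * X => p) by apply: PT_id.
  exact: PT_cons (PT_snd I) (PT_snd (PT_fst I)).
- by pbound.
- move=> e k; rewrite -E1.
  have : (sz (catrev (take k (s e)) (t e))).+1 = sz (take k (s e)) + sz (t e).
    exact: sz_catrev.
  have : sz (take k (s e)) <= sz (s e) by apply: sz_take.
  by have := Hp e; have := Hq e; lia.
Qed.

Lemma PT_rev E {eE : Enc E} X {eX : Enc X} (s : E -> seq X) : PT s -> PT (fun e => rev (s e)).
Proof. by move=> Hs; apply: PT_catrev Hs (PT_const [::]). Qed.

Lemma PT_cat E {eE : Enc E} X {eX : Enc X} (s t : E -> seq X) : PT s -> PT t ->
  PT (fun e => s e ++ t e).
Proof.
move=> Hs Ht; apply: PT_ext (PT_catrev (PT_rev Hs) Ht) => e.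
by rewrite catrevE revK.
Qed.

Lemma PT_foldr_bool E {eE : Enc E} X {eX : Enc X} (f : E -> X -> bool -> bool) (i : E -> bool)
    (l : E -> seq X) :
  PT (fun p : E * bool * X => f p.1.1 p.2 p.1.2) -> PT i -> PT l ->
  PT (fun e => foldr (f e) (i e) (l e)).
Proof.
move=> Hf Hi Hl.
have := @PT_foldl_bool _ _ X _ (fun e b x => f e x b) i _ Hf Hi (PT_rev Hl).
by apply: PT_ext => e; rewrite foldl_rev.
Qed.

Lemma sz_In X {eX : Enc X} (s : seq X) x : List.In x s -> sz x <= sz s.
Proof.
elim: s => [|y s IH] //= [->|/IH]; rewrite sz_cons; lia.
Qed.

Lemma PT_map E {eE : Enc E} X Y {eX : Enc X} {eY : Enc Y} (f : E -> X -> Y) (l : E -> seq X) :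
  PT (fun p : E * X => f p.1 p.2) -> PT l -> PT (fun e => map (f e) (l e)).
Proof.
move=> Hf Hl; have [p Hp] := PT_size Hf; have [q Hq] := PT_size Hl.
have E1 g (u : seq X) (v : seq Y) :
    foldl (fun a x => g x :: a) v u = catrev (map g u) v.
  by elim: u v => //= x u IH v; rewrite IH.
have H : PT (fun e => foldl (fun a x => f e x :: a) [::] (l e)).
  (* There are at most [ev q n] results, each bounded by [ev p] at the size of the environment
     paired with an element. *)
  pose B n := (ev q n * (ev p (n + ev q n).+1).+1).+1.
  apply: (@PT_foldl _ _ _ _ _ _ (fun e a x => f e x :: a) (fun _ => [::]) l B).
  - have I : PT (fun p : E * seq Y * X => p) by apply: PT_id.
    apply: PT_cons; last exact: PT_snd (PT_fst I).
    exact: PT_comp Hf (PT_pair (PT_fst (PT_fst I)) (PT_snd I)).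
  - exact: PT_const.
  - by [].
  - by rewrite /B; pbound.
  move=> e k; rewrite E1 -/(rev _) sz_rev /B.
  have Hx x : List.In x (take k (l e)) -> sz (f e x) <= ev p (sz e + ev q (sz e)).+1.
    move=> xin; apply: leq_trans (Hp (e, x)) _; apply: ev_mono.
    rewrite sz_pair ltnS leq_add2l; apply: leq_trans (Hq e).
    apply: leq_trans (sz_In xin) _; exact: sz_take.
  apply: (@leq_trans (size (take k (l e)) * (ev p (sz e + ev q (sz e)).+1).+1).+1).
    rewrite -(size_map (f e)); apply: sz_le => y.
    have : forall y, List.In y (map (f e) (take k (l e))) ->
        exists2 x, List.In x (take k (l e)) & y = f e x.
      elim: (take k (l e)) => [|x s IH] //= z [<-|/IH[x' xin ->]].
        by exists x => //; left.
      by exists x' => //; right.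
    by move=> H /H [x xin ->]; apply: Hx.
  rewrite ltnS leq_mul2r; apply/orP; right; apply: leq_trans (Hq e).
  apply: leq_trans (size_sz _) _; exact: sz_take.
by apply: PT_ext (PT_rev H) => e; rewrite E1 -/(rev _) revK.
Qed.

Lemma PT_flatten E {eE : Enc E} X {eX : Enc X} (s : E -> seq (seq X)) : PT s ->
  PT (fun e => flatten (s e)).
Proof.
move=> Hs; have [p Hp] := PT_size Hs.
have E1 (u : seq (seq X)) v : foldl (fun a x => catrev x a) v u = catrev (flatten u) v.
  by elim: u v => //= x u IH v; rewrite IH catrev_catl.
have H : PT (fun e => foldl (fun a x => catrev x a) [::] (s e)).
  apply: (@PT_foldl _ _ _ _ _ _ (fun _ a x => catrev x a) (fun _ => [::]) s (ev p)) => //.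
  - have I : PT (fun p : E * seq X * seq X => p) by apply: PT_id.
    exact: PT_catrev (PT_snd I) (PT_snd (PT_fst I)).
  - exact: PT_const.
  - by pbound.
  move=> e k; rewrite E1 -/(rev _) sz_rev; apply: leq_trans (Hp e).
  apply: leq_trans (sz_take k _); elim: (take k (s e)) => [|x u IH] //=.
  have : (sz (x ++ flatten u)).+1 = sz x + sz (flatten u) by exact: sz_cat.
  by rewrite sz_cons; lia.
by apply: PT_ext (PT_rev H) => e; rewrite E1 -/(rev _) revK.
Qed.

Lemma PT_filter E {eE : Enc E} X {eX : Enc X} (f : E -> X -> bool) (l : E -> seq X) :
  PT (fun p : E * X => f p.1 p.2) -> PT l -> PT (fun e => filter (f e) (l e)).
Proof.
move=> Hf Hl.
have H : PT (fun e => flatten [seq if f e x then [:: x] else [::] | x <- l e]).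
  apply: PT_flatten; apply: (@PT_map _ _ _ _ _ _ (fun e x => if f e x then [:: x] else [::])) => //.
  apply: PT_if => //; last exact: PT_const.
  by apply: PT_cons; [pt_proj | apply: PT_const].
by apply: PT_ext H => e; elim: (l e) => //= x s ->; case: (f e x).
Qed.

(** * Unary arithmetic and indexing *)

Lemma enc_nat_units n : enc n = enc (nseq n tt).
Proof. by rewrite /enc /=; elim: n => //= n ->. Qed.

Lemma PT_units E {eE : Enc E} (n : E -> nat) : PT n -> PT (fun e => nseq (n e) tt).
Proof. by apply: (PT_cast (h := id)) => // e; rewrite enc_nat_units. Qed.

(** A number and a list of as many units have the same code, so arithmetic is inherited from
    lists. *)
Lemma PT_nat E {eE : Enc E} (n : E -> nat) : PT (fun e => nseq (n e) tt) -> PT n.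
Proof. by apply: (PT_cast (h := id)) => // e; rewrite enc_nat_units. Qed.

Lemma PT_size_seq E {eE : Enc E} X {eX : Enc X} (s : E -> seq X) :
  PT s -> PT (fun e => size (s e)).
Proof.
move=> Hs; apply: PT_nat.
apply: PT_ext (PT_map (f := fun _ _ => tt) (PT_const tt) Hs) => e.
by elim: (s e) => //= x u ->.
Qed.

Lemma PT_addn E {eE : Enc E} (m n : E -> nat) : PT m -> PT n -> PT (fun e => m e + n e).
Proof.
move=> Hm Hn; apply: PT_ext (PT_size_seq (PT_cat (PT_units Hm) (PT_units Hn))) => e.
by rewrite size_cat !size_nseq.
Qed.

Lemma PT_succ E {eE : Enc E} (n : E -> nat) : PT n -> PT (fun e => (n e).+1).
Proof. by move=> Hn; apply: PT_ext (PT_addn Hn (PT_const 1)) => e; rewrite addn1. Qed.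

Lemma PT_nseq E {eE : Enc E} X {eX : Enc X} (n : E -> nat) (x : E -> X) :
  PT n -> PT x -> PT (fun e => nseq (n e) (x e)).
Proof.
move=> Hn Hx.
have H := PT_map (f := fun e (_ : unit) => x e) (PT_comp Hx (PT_fst PT_id)) (PT_units Hn).
by apply: PT_ext H => e; rewrite map_nseq.
Qed.

Lemma PT_muln E {eE : Enc E} (m n : E -> nat) : PT m -> PT n -> PT (fun e => m e * n e).
Proof.
move=> Hm Hn; apply: PT_ext (PT_size_seq (PT_flatten (PT_nseq Hm (PT_units Hn)))) => e.
by elim: (m e) => //= k IH; rewrite size_cat size_nseq IH mulSn.
Qed.

Lemma PT_drop E {eE : Enc E} X {eX : Enc X} (n : E -> nat) (s : E -> seq X) :
  PT n -> PT s -> PT (fun e => drop (n e) (s e)).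
Proof.
move=> Hn Hs; have [p Hp] := PT_size Hs.
have E1 k (u : seq X) : foldl (fun a (_ : unit) => behead a) u (nseq k tt) = drop k u.
  elim: k u => [|k IH] u /=; first by rewrite drop0.
  by rewrite IH; case: u => //=; rewrite drop_nil.
have H : PT (fun e => foldl (fun a (_ : unit) => behead a) (s e) (nseq (n e) tt)).
  apply: (@PT_foldl _ _ _ _ _ _ (fun _ a _ => behead a) s _ (ev p)) => //.
  - apply: (@PT_ext _ _ _ _ (fun p => if p.1.2 is x :: u then u else [::])).
      by move=> [[e [|x u]] t].
    apply: (PT_case (g := fun _ _ u => u)).
    + by pt_proj.
    + exact: PT_const.
    + by pt_proj.
  - exact: PT_units.
  - by pbound.
  move=> e k; apply: leq_trans (Hp e).
  have -> : take k (nseq (n e) tt) = nseq (minn k (n e)) tt.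
    by elim: k (n e) => [|k IH] [|m] //=; rewrite IH minnSS.
  rewrite E1; set j := minn _ _.
  have : (sz (take j (s e) ++ drop j (s e))).+1 = sz (take j (s e)) + sz (drop j (s e)).
    exact: sz_cat.
  rewrite cat_take_drop; have : 0 < sz (take j (s e)) by exact: sz_gt0.
  by lia.
by apply: PT_ext H => e.
Qed.

Lemma PT_nth E {eE : Enc E} X {eX : Enc X} (d : E -> X) (s : E -> seq X) (n : E -> nat) :
  PT d -> PT s -> PT n -> PT (fun e => nth (d e) (s e) (n e)).
Proof.
move=> Hd Hs Hn.
have H : PT (fun e => if drop (n e) (s e) is x :: _ then x else d e).
  apply: (PT_case (g := fun _ x _ => x)) => //; first exact: PT_drop.
  by pt_proj.
apply: PT_ext H => e; have := nth_drop (n e) (d e) (s e) 0.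
by rewrite addn0 => <-; case: (drop _ _).
Qed.

Lemma PT_subn E {eE : Enc E} (m n : E -> nat) : PT m -> PT n -> PT (fun e => m e - n e).
Proof.
move=> Hm Hn; apply: PT_ext (PT_size_seq (PT_drop Hn (PT_units Hm))) => e.
by rewrite size_drop size_nseq.
Qed.

Lemma PT_nilp E {eE : Enc E} X {eX : Enc X} (s : E -> seq X) :
  PT s -> PT (fun e => nilp (s e)).
Proof.
move=> Hs.
have H : PT (fun e => if s e is _ :: _ then false else true).
  exact: (PT_case (g := fun _ _ _ => false)) Hs (PT_const true) (PT_const false).
by apply: PT_ext H => e; case: (s e).
Qed.

Lemma PT_leq E {eE : Enc E} (m n : E -> nat) : PT m -> PT n -> PT (fun e => m e <= n e).
Proof.
move=> Hm Hn; apply: PT_ext (PT_nilp (PT_units (PT_subn Hm Hn))) => e.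
by rewrite /nilp size_nseq.
Qed.

Lemma PT_eqn E {eE : Enc E} (m n : E -> nat) : PT m -> PT n -> PT (fun e => m e == n e).
Proof.
move=> Hm Hn; apply: PT_ext (PT_andb (PT_leq Hm Hn) (PT_leq Hn Hm)) => e.
by rewrite eqn_leq.
Qed.

Lemma PT_zip E {eE : Enc E} X Y {eX : Enc X} {eY : Enc Y} (s : E -> seq X) (t : E -> seq Y) :
  PT s -> PT t -> PT (fun e => zip (s e) (t e)).
Proof.
move=> Hs Ht; have [p Hp] := PT_size Hs; have [q Hq] := PT_size Ht.
pose st (a : seq Y * seq (X * Y)) x :=
  if a.1 is y :: v then (v, (x, y) :: a.2) else a.
have E1 u v w : foldl st (v, w) u = (drop (size u) v, catrev (zip u v) w).
  elim: u v w => [|x u IH] v w; first by rewrite /= drop0; case: v.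
  by case: v => [|y v] /=; rewrite IH //=; case: u {IH}.
have H : PT (fun e => foldl st (t e, [::]) (s e)).
  apply: (@PT_foldl _ _ _ _ _ _ (fun _ => st) (fun e => (t e, [::])) s
    (fun n => (2 * (ev p n + ev q n)).+2)) => //.
  - have I : PT (fun p : E * (seq Y * seq (X * Y)) * X => p) by apply: PT_id.
    apply: (PT_case (g := fun a y v => (v, (a.2, y) :: a.1.2.2))).
    + by pt_proj.
    + by pt_proj.
    have {}I : PT (fun p : E * (seq Y * seq (X * Y)) * X * (Y * seq Y) => p) by apply: PT_id.
    apply: PT_pair; first exact: PT_snd (PT_snd I).
    apply: PT_cons; last exact: PT_snd (PT_snd (PT_fst (PT_fst I))).
    exact: PT_pair (PT_snd (PT_fst I)) (PT_fst (PT_snd I)).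
  - by apply: PT_pair Ht _; apply: PT_const.
  - by pbound.
  move=> e k; rewrite E1 sz_pair.
  have Hz (u : seq X) (v : seq Y) : sz (zip u v) <= sz u + sz v.
    elim: u v => [|x u IH] [|y v] //=; rewrite !sz_cons sz_pair.
    by have := IH v; lia.
  have Hd j (v : seq Y) : sz (drop j v) <= sz v.
    have : (sz (take j v ++ drop j v)).+1 = sz (take j v) + sz (drop j v) by exact: sz_cat.
    by rewrite cat_take_drop; have : 0 < sz (take j v) by [exact: sz_gt0]; lia.
  have -> : sz (catrev (zip (take k (s e)) (t e)) [::]) = sz (zip (take k (s e)) (t e)).
    exact: sz_rev.
  have := Hz (take k (s e)) (t e); have := Hd (size (take k (s e))) (t e).
  have : sz (take k (s e)) <= sz (s e) by exact: sz_take.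
  by have := Hp e; have := Hq e; lia.
by apply: PT_ext (PT_rev (PT_snd H)) => e; rewrite E1 /= -/(rev _) revK.
Qed.

Lemma PT_take E {eE : Enc E} X {eX : Enc X} (n : E -> nat) (s : E -> seq X) :
  PT n -> PT s -> PT (fun e => take (n e) (s e)).
Proof.
move=> Hn Hs.
have H : PT (fun e => [seq p.1 | p <- zip (s e) (nseq (n e) tt)]).
  apply: (PT_map (f := fun _ (p : X * unit) => p.1)).
    by pt_proj.
  by apply: PT_zip Hs _; apply: PT_units.
by apply: PT_ext H => e; elim: (n e) (s e) => [|k IH] [|x u] //=; rewrite IH.
Qed.

Lemma PT_iota E {eE : Enc E} (m n : E -> nat) : PT m -> PT n ->
  PT (fun e => iota (m e) (n e)).
Proof.
move=> Hm Hn; have [p Hp] := PT_size Hm; have [q Hq] := PT_size Hn.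
pose st (a : nat * seq nat) (_ : unit) := (a.1.+1, a.1 :: a.2).
have E1 k a w : foldl st (a, w) (nseq k tt) = (a + k, catrev (iota a k) w).
  by elim: k a w => [|k IH] a w; rewrite ?addn0 //= IH addSnnS.
have H : PT (fun e => foldl st (m e, [::]) (nseq (n e) tt)).
  apply: (@PT_foldl _ _ _ _ _ _ (fun _ => st) (fun e => (m e, [::])) _
    (fun n => (2 * (ev p n + ev q n)).+2 + (ev q n * (2 * (ev p n + ev q n)).+3).+2)) => //.
  - have I : PT (fun p : E * (nat * seq nat) * unit => p) by apply: PT_id.
    have I1 := PT_fst (PT_snd (PT_fst I)).
    exact: PT_pair (PT_succ I1) (PT_cons I1 (PT_snd (PT_snd (PT_fst I)))).
  - by apply: PT_pair Hm _; apply: PT_const.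
  - exact: PT_units.
  - by pbound.
  move=> e k; have := Hp e; have := Hq e; rewrite !sz_nat => Hq' Hp'.
  have -> : take k (nseq (n e) tt) = nseq (minn k (n e)) tt.
    by elim: k (n e) => [|k IH] [|j] //=; rewrite IH minnSS.
  rewrite E1 -/(rev _) sz_pair sz_nat sz_rev; set j := minn _ _.
  have jn : j <= n e by apply: geq_minr.
  set c := (2 * _).+2; apply: (@leq_trans (c + (j * c.+1).+1).+1); last first.
    have : j * c.+1 <= ev q (sz e) * c.+1 by rewrite leq_mul2r; apply/orP; right; lia.
    by lia.
  rewrite ltnS leq_add //; first by rewrite /c; lia.
  rewrite -{2}(size_iota (m e) j); apply: sz_le => x.
  have In_mem (u : seq nat) : List.In x u -> x \in u.
    by elim: u => //= y u IH [->|/IH]; rewrite in_cons ?eqxx // => ->; rewrite orbT.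
  by move=> /In_mem; rewrite mem_iota sz_nat /c; lia.
by apply: PT_ext (PT_rev (PT_snd H)) => e; rewrite E1 /= -/(rev _) revK.
Qed.

Lemma PT_eqseq E {eE : Enc E} (X : eqType) {eX : Enc X} (s t : E -> seq X) :
  PT (fun p : X * X => p.1 == p.2) -> PT s -> PT t -> PT (fun e => s e == t e).
Proof.
move=> HX Hs Ht.
have H : PT (fun e => (size (s e) == size (t e)) &&
                      all (fun p => p.1 == p.2) (zip (s e) (t e))).
  apply: PT_andb; first by apply: PT_eqn; apply: PT_size_seq.
  apply: (PT_all (f := fun _ (p : X * X) => p.1 == p.2)); last exact: PT_zip.
  by apply: PT_comp HX _; pt_proj.
apply: PT_ext H => e; elim: (s e) (t e) => [|x u IH] [|y v] //=.
by rewrite eqSS eqseq_cons -IH andbCA.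
Qed.

Lemma PT_count E {eE : Enc E} X {eX : Enc X} (f : E -> X -> bool) (l : E -> seq X) :
  PT (fun p : E * X => f p.1 p.2) -> PT l -> PT (fun e => count (f e) (l e)).
Proof.
move=> Hf Hl; apply: PT_ext (PT_size_seq (PT_filter Hf Hl)) => e.
by rewrite size_filter.
Qed.

(** The index ranges over a fixed list and needs no code: there is one program for each [c]. Tiles
    and colours, which depend on the machine alone, are enumerated in this way. *)
Lemma PT_flatten_const E {eE : Enc E} C X {eX : Enc X} (F : E -> C -> seq X) (cs : seq C) :
  (forall c, PT (fun e => F e c)) -> PT (fun e => flatten [seq F e c | c <- cs]).
Proof.
move=> HF; elim: cs => [|c cs IH] /=; first exact: PT_const.
exact: PT_cat.
Qed.

Lemma PT_horner E {eE : Enc E} (p : {poly nat}) (n : E -> nat) :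
  PT n -> PT (fun e => ev p (n e)).
Proof.
move=> Hn; elim/poly_ind: p => [|p c IH].
  by apply: PT_ext (PT_const 0) => e; rewrite /ev horner0.
apply: PT_ext (PT_addn (PT_muln IH Hn) (PT_const c)) => e.
by rewrite evD evM /ev hornerX hornerC.
Qed.

Ltac pt_eq := fail.
Ltac pt_more := fail.

Ltac pt_step := match goal with
  | H : PT ?f |- PT ?f => exact H
  | |- PT (fun _ => ?c) => exact (PT_const c)
  | H : PT ?f |- PT (fun e => ?f (@?g e)) => apply (PT_comp H (f := g))
  | |- PT (fun e => negb (@?a e)) => apply (PT_negb (b := a))
  | |- PT (fun e => andb (@?a e) (@?b e)) => apply (PT_andb (b := a) (c := b))
  | |- PT (fun e => implb (@?a e) (@?b e)) => apply (PT_implb (b := a) (c := b))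
  | |- PT (fun e => pair (@?f e) (@?g e)) => apply (PT_pair (f := f) (g := g))
  | |- PT (fun e => cons (@?f e) (@?g e)) => apply (PT_cons (f := f) (g := g))
  | |- PT (fun e => cat (@?f e) (@?g e)) => apply (PT_cat (s := f) (t := g))
  | |- PT (fun e => S (@?n e)) => apply (PT_succ (n := n))
  | |- PT (fun e => addn (@?m e) (@?n e)) => apply (PT_addn (m := m) (n := n))
  | |- PT (fun e => muln (@?m e) (@?n e)) => apply (PT_muln (m := m) (n := n))
  | |- PT (fun e => subn (@?m e) (@?n e)) => apply (PT_subn (m := m) (n := n))
  | |- PT (fun e => leq (@?m e) (@?n e)) => apply (PT_leq (m := m) (n := n))
  | |- PT (fun e => size (@?s e)) => apply (PT_size_seq (s := s))
  | |- PT (fun e => nth (@?d e) (@?s e) (@?n e)) => apply (PT_nth (d := d) (s := s) (n := n))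
  | |- PT (fun e => take (@?n e) (@?s e)) => apply (PT_take (n := n) (s := s))
  | |- PT (fun e => drop (@?n e) (@?s e)) => apply (PT_drop (n := n) (s := s))
  | |- PT (fun e => iota (@?m e) (@?n e)) => apply (PT_iota (m := m) (n := n))
  | |- PT (fun e => nseq (@?n e) (@?x e)) => apply (PT_nseq (n := n) (x := x))
  | |- PT (fun e => zip (@?s e) (@?t e)) => apply (PT_zip (s := s) (t := t))
  | |- PT (fun e => rev (@?s e)) => apply (PT_rev (s := s))
  | |- PT (fun e => nilp (@?s e)) => apply (PT_nilp (s := s))
  | |- PT (fun e => flatten (@?s e)) => apply (PT_flatten (s := s))
  | |- PT (fun e => map (@?f e) (@?l e)) => apply (PT_map (f := f) (l := l))
  | |- PT (fun e => filter (@?f e) (@?l e)) => apply (PT_filter (f := f) (l := l))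
  | |- PT (fun e => all (@?f e) (@?l e)) => apply (PT_all (f := f) (l := l))
  | |- PT (fun e => has (@?f e) (@?l e)) => apply (PT_has (f := f) (l := l))
  | |- PT (fun e => count (@?f e) (@?l e)) => apply (PT_count (f := f) (l := l))
  | |- PT (fun e => eq_op (@?a e) (@?b e)) =>
      first [ apply (PT_eqn (m := a) (n := b)) | apply (PT_eqb (b := a) (c := b)) | pt_eq ]
  | |- PT (fun e => if _ then _ else _) => apply PT_if
  end.

Ltac pt := cbv beta; repeat (first [progress pt_proj | pt_step | pt_more]; cbv beta).

(** * From polynomial-time functions to Turing machines *)

Lemma exec_pushs w X Y R S A B :
  exec (fPushs w) (Env X Y R S A B) (size w + 2) (Some (Env X Y (w ++ R) S A B)).
Proof.
elim: w => [|b w IH] /=.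
  exact: (exec_seq (exec_push RR true _) (exec_pop RR _)).
rewrite addSn -addn1; exact: (exec_seq IH (exec_push RR b _)).
Qed.

(* Both branches take six steps. *)
Definition fload (src : reg) : frag :=
  fSeq (pour src RA) (fSeq (fPush RR false) (drain RA (fun b =>
    if b then fPushs [:: true; true; false; false]
    else fSeq (fPushs [::]) (fPushs [:: true; false])))).

Lemma code_cons A {eA : Enc A} (x : A) s r :
  code (enc (x :: s)) ++ r = true :: code (enc x) ++ code (enc s) ++ r.
Proof. by rewrite /= -catA. Qed.

(** A bit of the input word becomes a list item on the stack: a cons bit followed by
    [true false false] or by [false]. The reversed word in [RA] builds the list from its end. *)
Lemma exec_load_tail X Y R x :
  exec (fSeq (fPush RR false) (drain RA (fun b =>
    if b then fPushs [:: true; true; false; false]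
    else fSeq (fPushs [::]) (fPushs [:: true; false]))))
  (Env X Y R [::] (rev x) [::]) (1 + (size x * 9).+1)
  (Some (Env X Y (code (enc x) ++ R) [::] [::] [::])).
Proof.
apply: exec_seq (exec_push RR false _) _.
have H := @exec_drain RA (fun b =>
    if b then fPushs [:: true; true; false; false]
    else fSeq (fPushs [::]) (fPushs [:: true; false]))
  (fun p s => Env X Y (code (enc p) ++ R) [::] s [::]) 6 (fun _ _ => erefl) _
  (rev x) [::].
rewrite -/(rev (rev x)) revK size_rev in H; apply: H => p b s.
rewrite code_cons; case: b; first exact: exec_pushs.
exact: (exec_seq (exec_pushs [::] _ _ _ _ _ _) (exec_pushs _ _ _ _ _ _ _)).
Qed.

Lemma exec_load_x x Y R : exec (fload RX) (stk x Y R) (size x * 13 + 3)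
  (Some (stk [::] Y (code (enc x) ++ R))).
Proof.
rewrite (_ : _ + 3 = (size x * 4).+1 + (1 + (size x * 9).+1)); last by lia.
apply: exec_seq _ (exec_load_tail _ _ _ _).
exact: (@exec_pour RX RA (fun p s => Env s Y R [::] p [::])
  (fun _ _ => erefl) (fun _ _ _ => erefl) x).
Qed.

Lemma exec_load_y X y R : exec (fload RY) (stk X y R) (size y * 13 + 3)
  (Some (stk X [::] (code (enc y) ++ R))).
Proof.
rewrite (_ : _ + 3 = (size y * 4).+1 + (1 + (size y * 9).+1)); last by lia.
apply: exec_seq _ (exec_load_tail _ _ _ _).
exact: (@exec_pour RY RA (fun p s => Env X s R [::] p [::])
  (fun _ _ => erefl) (fun _ _ _ => erefl) y).
Qed.

(** The word goes to [RY] because the output of a machine is read on tape 1. *)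
Definition fout : frag :=
  fSeq (fWhile RR true false (fSeq (fPop RR) (fIf RR fFail
    (fSeq (fPop RR) (fSeq (fPop RR) (fSeq (fPop RR) (fPush RA true))))
    (fSeq (fPop RR) (fPush RA false)))))
  (pour RA RY).

Lemma exec_out_loop X Y s A : exists2 n, n <= size s * 8 + 1 &
  exec (fWhile RR true false (fSeq (fPop RR) (fIf RR fFail
    (fSeq (fPop RR) (fSeq (fPop RR) (fSeq (fPop RR) (fPush RA true))))
    (fSeq (fPop RR) (fPush RA false))))) (Env X Y (code (enc s)) [::] A [::]) n
      (Some (Env X Y [:: false] [::] (catrev s A) [::])).
Proof.
elim: s A => [|b s IH] A; first by exists 1 => //; apply: exec_while_stop.
have [n n_le H] := IH (b :: A).
pose k := if b then 6 else 4.
exists (k + n).+1; first by rewrite /k /= mulSn; case: b {H k}; lia.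
apply: (exec_while (p := true) (q := false) _ _ H) => //.
rewrite -[code _]cats0 code_cons cats0 /k {k}; case: b {H} => /=.
- rewrite -[6]/(1 + 5); apply: (exec_seq (exec_pop RR _)); apply: exec_if => /=.
  rewrite -[4]/(1 + (1 + (1 + 1))).
  do 3 apply: (exec_seq (exec_pop RR _)); exact: exec_push.
- rewrite -[4]/(1 + 3); apply: (exec_seq (exec_pop RR _)); apply: exec_if => /=.
  rewrite -[2]/(1 + 1).
  apply: (exec_seq (exec_pop RR _)); exact: exec_push.
Qed.

Lemma exec_out X s : exists2 n, n <= size s * 12 + 2 &
  exec fout (stk X [::] (code (enc s))) n
    (Some (Env X s [:: false] [::] [::] [::])).
Proof.
have [n n_le H] := exec_out_loop X [::] s [::].
exists (n + (size s * 4).+1); first by lia.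
apply: exec_seq H _; rewrite -/(rev s) -{1}(size_rev s) -{3}(revK s).
exact: (@exec_pour RA RY (fun p t => Env X p [:: false] [::] t [::])
  (fun _ _ => erefl) (fun _ _ _ => erefl) (rev s)).
Qed.

Lemma halts_within_le (M : tm) x y t t' (c : config M) : t <= t' ->
  halts_within x y t c -> halts_within x y t' c.
Proof. by move=> tt' [s [st H1 H2]]; exists s; split=> //; apply: leq_trans tt'. Qed.

Lemma halts_within_uniq (M : tm) x y t t' (c c' : config M) :
  halts_within x y t c -> halts_within x y t' c' -> c = c'.
Proof.
move=> [s [_ H1 H2]] [s' [_ H1' H2']].
wlog ss' : s s' c c' H1 H2 H1' H2' / s <= s'.
  by move=> H; case/orP: (leq_total s s') => [/H|/H K]; [apply|apply/esym; apply: K].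
move: H1'; rewrite -(subnK ss') iterD H1; case: (s' - s) => [[]|k] //.
rewrite iterSr /= H2; have -> : iter k (obind (@Defs.step M)) None = None by elim: k => //= k ->.
by [].
Qed.

Lemma PT_poly_time (f : seq bool -> seq bool) : PT f -> poly_time_computable f.
Proof.
move=> Hf; have [s Hs] := PT_size Hf; have [fr [q Hfr]] := Hf.
(* A word of length [n] has a code of size at most [4 * n + 1], and an instruction takes at most two
   machine steps. *)
pose g n := 2 * ((n * 13 + 3) + (ev q (4 * n + 1) + (ev s (4 * n + 1) * 12 + 2))).
have [p Hp] : pbound g by rewrite /g; pbound.
exists (tm_of (fSeq (fload RX) (fSeq fr fout))), p => x.
have [m m_le Hm] := Hfr x [::] [::] [::].
have [k k_le Hk] := exec_out [::] (f x).
have /exec_tm [c [Hc [_ /= [_ Hc']]]] :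
    exec (fSeq (fload RX) (fSeq fr fout)) (stk x [::] [::])
      ((size x * 13 + 3) + (m + k)) (Some (Env [::] (f x) [:: false] [::] [::] [::])).
  apply: exec_seq (exec_load_x _ _ _) _; apply: exec_seq Hm _.
  by rewrite cats0.
exists c; split.
  apply: halts_within_le Hc; apply: leq_trans (Hp _); rewrite /g leq_mul2l leq_add2l /=.
  apply: leq_add; first by apply: leq_trans m_le _; apply: ev_mono; exact: sz_bits.
  apply: leq_trans k_le _; rewrite leq_add2r leq_mul2r; apply/orP; right.
  by apply: leq_trans (size_sz _) _; apply: leq_trans (Hs x) _; apply: ev_mono; exact: sz_bits.
by apply: stack_tape_word; have := Hc' (inord 1); rewrite inordK.
Qed.

(** * Certificates *)

(** Every tree codes the list of subtrees along its right spine, so reading it as a list is total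
    and costs nothing. *)
Fixpoint spine (d : data) : seq data := if d is Nd a b then a :: spine b else [::].

Lemma enc_spine d : enc (spine d) = d.
Proof. by rewrite /enc /=; elim: d => //= a _ b ->. Qed.

Lemma spine_enc A {eA : Enc A} (s : seq A) : spine (enc s) = map enc s.
Proof. by rewrite /enc /=; elim: s => //= x s ->. Qed.

Lemma PT_spine E {eE : Enc E} (f : E -> data) : PT f -> PT (fun e => spine (f e)).
Proof. by apply: (PT_cast (h := id)) => // e; rewrite enc_spine. Qed.

Lemma PT_enc E {eE : Enc E} T {eT : Enc T} (f : E -> T) : PT f -> PT (fun e => enc (f e)).
Proof. exact: (PT_cast (h := id)). Qed.

(** A verifier meets arbitrary strings, so decoding is total and every string yields some
    certificate to be checked. Only the round trip that starts from a value is required. *)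
Class Dec (T : Type) {eT : Enc T} := MkDec {
  dec : data -> T;
  decK : cancel enc dec;
  PT_dec : PT dec }.
Arguments Dec T {eT}.

Lemma PT_Dec T {eT : Enc T} {dT : Dec T} E {eE : Enc E} (f : E -> data) :
  PT f -> PT (fun e => dec (f e) : T).
Proof. exact: PT_comp PT_dec. Qed.

#[export] Instance Dec_bool : Dec bool.
Proof.
apply: (@MkDec _ _ (fun d => ~~ nilp (spine d))); first by case.
by apply: PT_negb; apply: PT_nilp; apply: PT_spine PT_id.
Qed.

#[export] Instance Dec_nat : Dec nat.
Proof.
apply: (@MkDec _ _ (fun d => size (spine d))); first by rewrite /enc /=; elim=> //= n ->.
by apply: PT_size_seq; apply: PT_spine PT_id.
Qed.

#[export] Instance Dec_seq A {eA : Enc A} {dA : Dec A} : Dec (seq A).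
Proof.
apply: (@MkDec _ _ (fun d => map dec (spine d))).
  by move=> s; rewrite spine_enc; elim: s => //= x s ->; rewrite decK.
apply: (PT_map (f := fun _ d => dec d)); last exact: PT_spine PT_id.
by apply: PT_Dec; pt_proj.
Qed.

#[export] Instance Dec_prod A B {eA : Enc A} {dA : Dec A} {eB : Enc B} {dB : Dec B} :
  Dec (A * B).
Proof.
apply: (@MkDec _ _ (fun d => if spine d is a :: s then (dec a, dec (enc s))
                       else (dec Lf, dec Lf))).
  by move=> [x y] /=; rewrite enc_spine !decK.
apply: (PT_case (g := fun _ a s => (dec a, dec (enc s)))).
- exact: PT_spine PT_id.
- by apply: PT_pair; apply: PT_const.
- apply: PT_pair; apply: PT_Dec; first pt_proj.
  by apply: PT_enc; pt_proj.
Qed.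

(** Read from right to left, a preorder code is in postfix form: [false] pushes a leaf and [true]
    joins the two topmost trees. On malformed words, a join that lacks its two trees is skipped. *)
Definition parse_step (s : seq data) (b : bool) : seq data :=
  if b then
    if s is x :: s' then if s' is y :: s'' then Nd x y :: s'' else s else s
  else Lf :: s.

Definition parse (w : seq bool) : data := head Lf (foldl parse_step [::] (rev w)).

Lemma parseK : cancel code parse.
Proof.
have H d s : foldr (fun b a => parse_step a b) s (code d) = d :: s.
  by elim: d s => //= a IHa b IHb s; rewrite foldr_cat IHb IHa.
by move=> d; rewrite /parse foldl_rev H.
Qed.

Lemma PT_Nd E {eE : Enc E} (f g : E -> data) : PT f -> PT g ->
  PT (fun e => Nd (f e) (g e)).
Proof. by move=> Hf Hg; apply: (PT_cast (h := id)) (PT_pair Hf Hg). Qed.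

Lemma PT_parse E {eE : Enc E} (f : E -> seq bool) : PT f -> PT (fun e => parse (f e)).
Proof.
move=> Hf; have [p Hp] := PT_size Hf.
have H : PT (fun e => foldl parse_step [::] (rev (f e))).
  apply: (@PT_foldl _ _ _ _ _ _ (fun _ => parse_step) (fun _ => [::]) _
    (fun n => (2 * ev p n).+1)).
  - have I : PT (fun q : E * seq data * bool => q) by apply: PT_id.
    apply: PT_if; first by pt_proj.
      apply: (PT_case (g := fun q x s' =>
        if s' is y :: s'' then Nd x y :: s'' else q.1.2)); try pt_proj.
      apply: (PT_case (g := fun q y s'' => Nd q.2.1 y :: s'')); try pt_proj.
      by apply: PT_cons; [apply: PT_Nd|]; pt_proj.
    by apply: PT_cons; [apply: PT_const|pt_proj].
  - exact: PT_const.
  - exact: PT_rev.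
  - by pbound.
  move=> e k; apply: (@leq_trans (2 * size (take k (rev (f e)))).+1); last first.
    rewrite ltnS leq_mul2l /=; apply: leq_trans (Hp e); apply: leq_trans (size_sz _).
    rewrite -(size_rev (f e)) -{2}(cat_take_drop k (rev (f e))) size_cat.
    exact: leq_addr.
  have st_le s b : sz (parse_step s b) <= (sz s).+2.
    case: b; last by rewrite sz_cons.
    case: s => [|x [|y s]] /=; try by lia.
    have E1 : sz (Nd x y) = (sz x + sz y).+1 by rewrite /sz /= size_cat.
    by rewrite !sz_cons E1; lia.
  elim/last_ind: (take k _) => [|s b IH] //.
  by rewrite foldl_rcons size_rcons; have := st_le (foldl parse_step [::] s) b; lia.
have H2 : PT (fun e => if foldl parse_step [::] (rev (f e)) is x :: _ then x else Lf).
  apply: (PT_case (g := fun _ x _ => x)) => //; first exact: PT_const.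
  by pt_proj.
by apply: PT_ext H2 => e; rewrite /parse; case: (foldl _ _ _).
Qed.

(** Soundness is demanded of every certificate, since any string decodes to one; the size bound
    concerns completeness only. *)
Lemma PT_in_NP (L : language) T {eT : Enc T} {dT : Dec T}
    (V : seq bool * T -> bool) (p : nat -> nat) : PT V -> pbound p ->
  (forall x c, V (x, c) -> L x) ->
  (forall x, L x -> exists2 c, sz c <= p (size x) & V (x, c)) -> in_NP L.
Proof.
move=> HV [p' Hp] sound complete.
have [fr [q Hfr]] : PT (fun e : seq bool * seq bool => V (e.1, dec (parse e.2))).
  apply: (PT_comp HV (f := fun e : seq bool * seq bool => (e.1, dec (parse e.2)))).
  by apply: PT_pair; [|apply: PT_Dec; apply: PT_parse]; pt_proj.
(* The second input is loaded first, so that the pushed bit pairs the two in order. Leaving the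
   fragment accepts, whatever remains on the stack; the verdict [false] runs into [fFail]. *)
pose F := fSeq (fload RY) (fSeq (fload RX) (fSeq (fPush RR true) (fSeq fr
  (fIf RR fFail (fPop RR) fFail)))).
have F_run x y : exists2 n, n <= 27 * (size x + size y) +
      ev q (4 * (size x + size y) + 3) + 10 &
    exists2 o, exec F (stk x y [::]) n o & (o : bool) = V (x, dec (parse y)).
  have [m m_le Hm] := Hfr (x, y) [::] [::] [::].
  pose k := if V (x, @dec T eT dT (parse y)) then 2 else 1.
  exists ((size y * 13 + 3) + ((size x * 13 + 3) + (1 + (m + k)))).
    have : m <= ev q (4 * (size x + size y) + 3).
      apply: leq_trans m_le (ev_mono _ _); rewrite sz_pair.
      by have := sz_bits x; have := sz_bits y; lia.
    by rewrite /k; case: (V _); lia.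
  have H o : exec (fIf RR fFail (fPop RR) fFail)
      (stk [::] [::] (code (enc (V (x, dec (parse y)))) ++ [::])) k o ->
      exec F (stk x y [::]) (size y * 13 + 3 + (size x * 13 + 3 + (1 + (m + k)))) o.
    move=> H; apply: exec_seq (exec_load_y _ _ _) _.
    apply: exec_seq (exec_load_x _ _ _) _.
    apply: exec_seq (exec_push _ _ _) _.
    apply: exec_seq _ H; move: Hm; congr (exec _ _ _ _).
    by rewrite /= /stk /= -catA.
  move: H; rewrite /k; case: (V _) => H; eexists; try apply: H.
  - by apply: exec_if; apply: exec_pop.
  - by [].
  - by apply: exec_if; apply: exec_fail.
  - by [].
exists (tm_of F).
have [q' Hq'] : pbound (fun n => 2 * (27 * n + ev q (4 * n + 3) + 10)) by pbound.
have tm_run x y : exists2 c : config (tm_of F),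
    halts_within x y (ev q' (size x + size y)) c & accept c.1 = V (x, dec (parse y)).
  have [n n_le [o /exec_tm [c [Hc [_ Ho]]] oV]] := F_run x y.
  exists c; last by rewrite -oV; case: o Ho {oV} => [e [-> _]|/negbTE].
  by apply: halts_within_le Hc; apply: leq_trans (Hq' _); rewrite leq_mul2l n_le.
exists p', q'; split=> [x y|x].
  by have [c Hc _] := tm_run x y; exists c.
split.
  move=> /complete [c c_le Vc]; exists (code (enc c)).
  split; first by apply: leq_trans c_le (Hp _).
  have [d Hd] := tm_run x (code (enc c)); rewrite parseK decK Vc => Ha.
  by exists (ev q' (size x + size (code (enc c)))), d.
move=> [y [_ [t [c [Hc Ha]]]]].
have [d Hd da] := tm_run x y; apply: (sound x (dec (parse y))).
by rewrite -da -(halts_within_uniq Hc Hd).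
Qed.

(** * Binary numbers *)

Lemma nat_digits0 : nat_digits 0 = [::].
Proof. by rewrite /nat_digits up_log1. Qed.

Lemma nat_digits_rec n : 0 < n -> nat_digits n = odd n :: nat_digits n./2.
Proof.
move=> n_gt0; rewrite /nat_digits.
have -> : up_log 2 n.+1 = (up_log 2 (n./2).+1).+1.
  case: n n_gt0 => [|[|n]] // _.
  by rewrite !up_log_trunc_log //= trunc_log2S.
rewrite /= expn0 divn1; congr (_ :: _).
rewrite -[in LHS](addn0 1) iotaDl -map_comp; apply: eq_map => i /=.
by rewrite add1n expnS divnMA divn2.
Qed.

Definition bits_val (s : seq bool) : nat := foldr (fun (b : bool) (v : nat) => b + v.*2) 0 s.

Lemma nat_digitsK : cancel nat_digits bits_val.
Proof.
elim/ltn_ind=> -[|n] IH; first by rewrite nat_digits0.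
by rewrite nat_digits_rec //= IH ?odd_double_half //; lia.
Qed.

Definition strip (s : seq bool) : seq bool :=
  foldr (fun b w => if nilp w && ~~ b then [::] else b :: w) [::] s.

(** Removing leading zeros yields the canonical digits without passing through the value, whose
    unary code would be exponentially long. *)
Lemma nat_digits_val s : nat_digits (bits_val s) = strip s.
Proof.
elim: s => [|b s /= <-]; first exact: nat_digits0.
case: (posnP (bits_val s)) => [->|v_gt0].
  by rewrite nat_digits0 addn0; case: b => //=; rewrite nat_digits_rec //= nat_digits0.
rewrite nat_digits_rec; last by lia.
rewrite oddD odd_double addbF oddb half_bit_double.
by rewrite (nat_digits_rec v_gt0).
Qed.

Lemma PT_odd E {eE : Enc E} (n : E -> nat) : PT n -> PT (fun e => odd (n e)).
Proof.
move=> Hn.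
have H : PT (fun e => foldl (fun b (_ : unit) => ~~ b) false (nseq (n e) tt)).
  apply: (@PT_foldl_bool _ _ unit _ (fun _ b _ => ~~ b) (fun _ => false)).
  - by apply: PT_negb; pt_proj.
  - exact: PT_const.
  - exact: PT_units.
apply: PT_ext H => e; rewrite -[RHS]addFb.
by elim: (n e) false => [|k IH] b /=; rewrite ?addbF // IH addNb addbN.
Qed.

Lemma PT_half E {eE : Enc E} (n : E -> nat) : PT n -> PT (fun e => (n e)./2).
Proof.
move=> Hn.
(* Half of [n], rounded down, is the number of odd numbers below [n]. *)
have H : PT (fun e => count odd (iota 0 (n e))).
  apply: (PT_count (f := fun _ => odd)); first by apply: PT_odd; pt_proj.
  by apply: PT_iota Hn; apply: PT_const.
apply: PT_ext H => e; elim: (n e) => // k IH.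
by rewrite -{1}addn1 iotaD count_cat IH /= addn0 uphalf_half addnC.
Qed.

(** The number is given in unary, so [n] rounds of halving are affordable; they suffice, and are
    idle once zero is reached. *)
Lemma PT_nat_digits E {eE : Enc E} (n : E -> nat) : PT n ->
  PT (fun e => nat_digits (n e)).
Proof.
move=> Hn; have [p Hp] := PT_size Hn.
pose st (a : seq bool * nat) (_ : unit) :=
  if 0 < a.2 then (odd a.2 :: a.1, a.2./2) else a.
have stE o m : st (o, m) tt = if 0 < m then (odd m :: o, m./2) else (o, m) by [].
have bound k o m : size (foldl st (o, m) (nseq k tt)).1 <= size o + k /\
                   (foldl st (o, m) (nseq k tt)).2 <= m.
  elim: k o m => [|k IH] o m; first by rewrite addn0.
  have hm : m./2 <= m by rewrite -divn2; lia.
  rewrite /= !stE; case: ifP => _; first by have [/= H1 H2] := IH (odd m :: o) m./2; lia.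
  by have [/= H1 H2] := IH o m; lia.
have digits k o m : m <= k ->
    (foldl st (o, m) (nseq k tt)).1 = catrev (nat_digits m) o.
  elim: k o m => [|k IH] o m; first by rewrite leqn0 => /eqP->; rewrite nat_digits0.
  rewrite /= !stE; case: (posnP m) => [->|m_gt0] mk; first by rewrite IH.
  have hm : m./2 <= k by rewrite -divn2; lia.
  by rewrite IH // [in RHS]nat_digits_rec.
have H : PT (fun e => foldl st ([::], n e) (nseq (n e) tt)).
  apply: (@PT_foldl _ _ _ _ _ _ (fun _ => st) (fun e => ([::], n e)) _
    (fun n => 6 * ev p n + 10)).
  - have I : PT (fun p : E * (seq bool * nat) * unit => p) by apply: PT_id.
    apply: PT_if; last by pt_proj.
      by apply: PT_leq; [apply: PT_const|pt_proj].
    apply: PT_pair; last by apply: PT_half; pt_proj.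
    by apply: PT_cons; [apply: PT_odd|]; pt_proj.
  - by apply: PT_pair Hn; apply: PT_const.
  - exact: PT_units.
  - by pbound.
  move=> e k; have := Hp e; rewrite sz_nat.
  have -> : take k (nseq (n e) tt) = nseq (minn k (n e)) tt.
    by elim: k (n e) => [|k IH] [|j] //=; rewrite IH minnSS.
  have := bound (minn k (n e)) [::] (n e); case: (foldl _ _ _) => o m /= [].
  by rewrite sz_pair sz_nat; have := sz_bits o; have := geq_minr k (n e); lia.
by apply: PT_ext (PT_rev (PT_fst H)) => e; rewrite digits // -/(rev _) revK.
Qed.

(** Digits come least significant first, so the last position at which the padded words differ
    decides. *)
Definition bits_le (s t : seq bool) : bool :=
  foldl (fun acc p => if p.1 == p.2 then acc else p.2) true
    (zip (s ++ nseq (size t - size s) false) (t ++ nseq (size s - size t) false)).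

Lemma bits_leE s t : bits_le s t = (bits_val s <= bits_val t).
Proof.
have pad u k : bits_val (u ++ nseq k false) = bits_val u.
  elim: u => [|b u IH] /=; last by rewrite IH.
  by elim: k => //= k ->.
rewrite -(pad s (size t - size s)) -(pad t (size s - size t)) /bits_le.
move: (s ++ _) (t ++ _) (size_cat s (nseq (size t - size s) false))
  (size_cat t (nseq (size s - size t) false)); rewrite !size_nseq => u v su sv.
have {su sv} : size u = size v by lia.
(* The accumulator is the verdict on the lower digits; added on the right, it turns the strict
   comparison into the weak one. *)
have H u' v' acc : size u' = size v' ->
  foldl (fun acc p => if p.1 == p.2 then acc else p.2) acc (zip u' v') =
  (bits_val u' < bits_val v' + acc).
  elim: u' v' acc => [|a u' IH] [|b v'] acc //=; first by case: acc.
  by case=> suv; rewrite IH //; case: a b acc => [] [] []; rewrite /=; lia.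
by move=> /H ->; rewrite addn1 ltnS.
Qed.

Lemma PT_bits_le E {eE : Enc E} (f g : E -> seq bool) : PT f -> PT g ->
  PT (fun e => bits_le (f e) (g e)).
Proof.
move=> Hf Hg.
apply: (PT_foldl_bool (f := fun _ acc (p : bool * bool) =>
  if p.1 == p.2 then acc else p.2) (i := fun _ => true)).
- by apply: PT_if; [apply: PT_eqb| |]; pt_proj.
- exact: PT_const.
- by apply: PT_zip; apply: PT_cat => //; apply: PT_nseq;
    [apply: PT_subn; apply: PT_size_seq|apply: PT_const|
     apply: PT_subn; apply: PT_size_seq|apply: PT_const].
Qed.

Lemma PT_eq_bits E {eE : Enc E} (f g : E -> seq bool) : PT f -> PT g ->
  PT (fun e => f e == g e).
Proof. by apply: PT_eqseq; apply: PT_eqb; pt_proj. Qed.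

Lemma PT_strip E {eE : Enc E} (f : E -> seq bool) : PT f -> PT (fun e => strip (f e)).
Proof.
move=> Hf; have [p Hp] := PT_size Hf.
have H : PT (fun e => foldl (fun w b => if nilp w && ~~ b then [::] else b :: w)
    [::] (rev (f e))).
  apply: (@PT_foldl _ _ _ _ _ _ (fun _ w b => if nilp w && ~~ b then [::] else b :: w)
    (fun _ => [::]) _ (ev p)).
  - apply: PT_if; [|exact: PT_const|by apply: PT_cons; pt_proj].
    by apply: PT_andb; [apply: PT_nilp|apply: PT_negb]; pt_proj.
  - exact: PT_const.
  - exact: PT_rev.
  - by pbound.
  move=> e k; apply: leq_trans (Hp e); rewrite -(sz_rev (f e)).
  apply: leq_trans (sz_take k _); rewrite -{1}(revK (take k _)) foldl_rev.
  rewrite -[X in _ <= X]sz_rev; elim: (rev (take _ _)) => // b s.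
  by rewrite [foldr _ _ (_ :: _)]/=; case: ifP => _; rewrite !sz_cons //; lia.
by apply: PT_ext H => e; rewrite foldl_rev.
Qed.

(** * Integers *)

(** The values in the domains of an instance can be exponential in its length, hence binary
    digits. *)
#[export] Instance Enc_int : Enc int := fun z => enc ((z < 0)%R, nat_digits `|z|%N).

Definition int_of (p : bool * seq bool) : int :=
  (if p.1 then - (bits_val p.2)%:Z else (bits_val p.2)%:Z)%R.

Lemma int_ofK z : int_of ((z < 0)%R, nat_digits `|z|%N) = z.
Proof.
rewrite /int_of /= nat_digitsK; case: ltP => [z0|z0]; last exact: gez0_abs.
by rewrite ltz0_abs // opprK.
Qed.

(** Leading zeros and a negative sign on zero are normalised, which is all that decoding has to
    compute. *)
Lemma enc_int_of p : enc (int_of p) = enc (p.1 && ~~ nilp (strip p.2), strip p.2).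
Proof.
case: p => s w; rewrite /int_of /= -nat_digits_val /nilp.
have E n : (0 == size (nat_digits n)) = (n == 0).
  case: (posnP n) => [->|n_gt0]; first by rewrite nat_digits0.
  by rewrite nat_digits_rec // [size _]/= eq_sym; case: n n_gt0.
rewrite eq_sym E; have EI z : enc z = enc ((z < 0)%R, nat_digits `|z|%N) by [].
by rewrite EI; case: s; congr (enc (_, nat_digits _)); lia.
Qed.

#[export] Instance Dec_int : Dec int.
Proof.
apply: (@MkDec _ _ (fun d => int_of (dec d))).
  by move=> z; rewrite [enc z]/enc /Enc_int decK int_ofK.
pose g (p : bool * seq bool) := (p.1 && ~~ nilp (strip p.2), strip p.2).
have Hg : PT (fun d : data => g (dec d)).
  apply: (PT_comp (g := g)); last exact: PT_Dec PT_id.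
  apply: PT_pair; last by apply: PT_strip; pt_proj.
  apply: PT_andb; first by pt_proj.
  by apply: PT_negb; apply: PT_nilp; apply: PT_strip; pt_proj.
by apply: (PT_cast (h := id)) Hg => // d; apply: enc_int_of.
Qed.

Lemma PT_sign E {eE : Enc E} (z : E -> int) : PT z -> PT (fun e => (z e < 0)%R).
Proof.
move=> Hz; have H : PT (fun e => ((z e < 0)%R, nat_digits `|z e|%N)).
  exact: (PT_cast (h := id)) Hz.
exact: PT_fst H.
Qed.

Lemma PT_digits E {eE : Enc E} (z : E -> int) : PT z -> PT (fun e => nat_digits `|z e|%N).
Proof.
move=> Hz; have H : PT (fun e => ((z e < 0)%R, nat_digits `|z e|%N)).
  exact: (PT_cast (h := id)) Hz.
exact: PT_snd H.
Qed.

Lemma PT_Posz E {eE : Enc E} (n : E -> nat) : PT n -> PT (fun e => Posz (n e)).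
Proof.
by move=> /PT_nat_digits H; apply: (PT_cast (h := id)) (PT_pair (PT_const false) H).
Qed.

Lemma PT_eqz E {eE : Enc E} (x y : E -> int) : PT x -> PT y -> PT (fun e => x e == y e).
Proof.
move=> Hx Hy.
have H := PT_andb (PT_eqb (PT_sign Hx) (PT_sign Hy)) (PT_eq_bits (PT_digits Hx) (PT_digits Hy)).
apply: PT_ext H => e; apply/andP/eqP => [[/eqP H1 /eqP H2]|->] //.
by rewrite -(int_ofK (x e)) H1 H2 int_ofK.
Qed.

Lemma PT_lez E {eE : Enc E} (x y : E -> int) : PT x -> PT y ->
  PT (fun e => (x e <= y e)%R).
Proof.
move=> Hx Hy.
have H := PT_if (PT_sign Hx)
  (PT_if (PT_sign Hy) (PT_bits_le (PT_digits Hy) (PT_digits Hx)) (PT_const true))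
  (PT_if (PT_sign Hy) (PT_const false) (PT_bits_le (PT_digits Hx) (PT_digits Hy))).
apply: PT_ext H => e; rewrite !bits_leE !nat_digitsK.
by case: ifP => ?; case: ifP => ?; apply/idP/idP; lia.
Qed.

(** * Bit-string encodings *)

Lemma PT_enc_seq E {eE : Enc E} X {eX : Enc X} (f : E -> X -> seq bool) (l : E -> seq X) :
  PT (fun p : E * X => f p.1 p.2) -> PT l -> PT (fun e => enc_seq (f e) (l e)).
Proof.
move=> Hf Hl.
have H : PT (fun e => flatten [seq true :: f e x | x <- l e] ++ [:: false]).
  apply: PT_cat; last exact: PT_const.
  apply: PT_flatten; apply: (PT_map (f := fun e x => true :: f e x)) => //.
  by apply: PT_cons => //; apply: PT_const.
apply: PT_ext H => e; rewrite /enc_seq; elim: (l e) => //= x s <-.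
by rewrite catA.
Qed.

Lemma PT_enc_nat_digits E {eE : Enc E} (f : E -> seq bool) : PT f ->
  PT (fun e => enc_seq (fun b => [:: b]) (f e)).
Proof.
apply: (PT_enc_seq (f := fun _ b => [:: b])).
by apply: PT_cons; [pt_proj|apply: PT_const].
Qed.

Lemma PT_enc_nat E {eE : Enc E} (n : E -> nat) : PT n -> PT (fun e => enc_nat (n e)).
Proof. by move=> Hn; apply: PT_enc_nat_digits; apply: PT_nat_digits. Qed.

Lemma PT_enc_int E {eE : Enc E} (z : E -> int) : PT z -> PT (fun e => enc_int (z e)).
Proof.
move=> Hz; apply: PT_cons; first exact: PT_sign.
by apply: PT_enc_nat_digits; apply: PT_digits.
Qed.

Lemma PT_enc_dom E {eE : Enc E} (s : E -> seq int) : PT s -> PT (fun e => enc_dom (s e)).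
Proof. by apply: (PT_enc_seq (f := fun _ => enc_int)); apply: PT_enc_int; pt_proj. Qed.

Definition enc_dom_list : seq (seq int) -> seq bool := enc_seq enc_dom.

Lemma PT_enc_dom_list E {eE : Enc E} (s : E -> seq (seq int)) : PT s ->
  PT (fun e => enc_dom_list (s e)).
Proof. by apply: (PT_enc_seq (f := fun _ => enc_dom)); apply: PT_enc_dom; pt_proj. Qed.

Definition enc_dom_table : seq (seq (seq int)) -> seq bool := enc_seq enc_dom_list.

Lemma PT_enc_dom_table E {eE : Enc E} (s : E -> seq (seq (seq int))) : PT s ->
  PT (fun e => enc_dom_table (s e)).
Proof.
by apply: (PT_enc_seq (f := fun _ => enc_dom_list)); apply: PT_enc_dom_list; pt_proj.
Qed.

(** * Prefix-free codes and their lengths *)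

Definition prefix_free T (e : T -> seq bool) : Prop :=
  forall x y u v, e x ++ u = e y ++ v -> x = y /\ u = v.

(** Prefix-free codes can be cancelled from the left of an equation. In the hardness proofs, an
    instance whose code is the constructed word thus has the constructed domains. *)
Lemma prefix_free_seq T (e : T -> seq bool) : prefix_free e -> prefix_free (enc_seq e).
Proof.
move=> He; elim=> [|x s IH] [|y t] u v //=; first by case.
by case; rewrite -!catA => /He [-> /IH [-> ->]].
Qed.

Lemma prefix_free_nat : prefix_free enc_nat.
Proof.
move=> m n u v /(@prefix_free_seq bool _ _) [|H ->].
  by move=> a b u' v' [-> ->].
by split=> //; rewrite -(nat_digitsK m) H nat_digitsK.
Qed.

Lemma prefix_free_int : prefix_free enc_int.
Proof.
move=> x y u v [H /prefix_free_nat [H' ->]]; split=> //.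
by rewrite -(int_ofK x) H H' int_ofK.
Qed.

Lemma prefix_free_dom_list : prefix_free enc_dom_list.
Proof. by do 2 apply: prefix_free_seq; apply: prefix_free_int. Qed.

Lemma prefix_free_dom_table : prefix_free enc_dom_table.
Proof. by apply: prefix_free_seq; apply: prefix_free_dom_list. Qed.

(** A certificate contains the instance as a tree; this keeps the tree linear in the input word. *)
Lemma sz_enc_seq X {eX : Enc X} (e : X -> seq bool) (c : nat) s : 0 < c ->
  (forall x, sz x <= c * size (e x)) -> sz s <= c * size (enc_seq e s).
Proof.
move=> c_gt0 H; elim: s => [|x s IH]; first by rewrite muln1.
by rewrite sz_cons /= size_cat; have := H x; rewrite /= in IH; nia.
Qed.

Lemma sz_enc_int (z : int) : sz z <= 5 * size (enc_int z).
Proof.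
have -> : sz z = sz ((z < 0)%R, nat_digits `|z|%N) by [].
rewrite sz_pair; have := sz_bool (z < 0)%R; have := sz_bits (nat_digits `|z|%N).
have : size (nat_digits `|z|%N) <= size (enc_nat `|z|%N).
  by rewrite /enc_nat; elim: (nat_digits _) => //= b s IH; lia.
by rewrite /=; lia.
Qed.

Lemma sz_dom_list s : sz s <= 5 * size (enc_dom_list s).
Proof. by do 2 apply: sz_enc_seq => // ?; apply: sz_enc_int. Qed.

Lemma sz_dom_table s : sz s <= 5 * size (enc_dom_table s).
Proof. by apply: sz_enc_seq => // ?; apply: sz_dom_list. Qed.

Ltac pt_eq ::= match goal with
  | |- PT (fun e => eq_op (@?a e) (@?b e)) =>
      first [ apply (PT_eqz (x := a) (y := b)) | apply (PT_eqseq (s := a) (t := b)) ]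
  end.

Ltac pt_int := match goal with
  | |- PT (fun e => Posz (@?n e)) => apply (PT_Posz (n := n))
  | |- PT (fun e => Order.le (@?x e) (@?y e)) => apply (PT_lez (x := x) (y := y))
  | |- PT (fun e => enc_nat (@?n e)) => apply (PT_enc_nat (n := n))
  | |- PT (fun e => enc_dom_list (@?s e)) => apply (PT_enc_dom_list (s := s))
  | |- PT (fun e => enc_dom_table (@?s e)) => apply (PT_enc_dom_table (s := s))
  end.

Ltac pt_more ::= pt_int.

(** * Exactly-one systems as sorting constraints *)

Definition chosen (u : seq int) (Us : seq (seq int)) : bool := all2 (fun x D => x \in D) u Us.

Definition sort_solvable (Us Vs : seq (seq int)) : Prop :=
  exists u v, [/\ chosen u Us, chosen v Vs, perm_eq u v & sorted <=%R v].

Section Gadget.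
Variables (X K B : eqType) (slots : seq X) (keys : seq K).
Variables (ia ib : X -> nat) (key : X -> K) (blk : X -> B).

(** In one chain the two-valued domains overlap in such a way that a high value followed by a low
    one is the only choice against sortedness; the domains of different chains lie apart and do not
    interact. *)
Definition precedes (x y : X) : bool :=
  if blk x == blk y then [&& ia x < ia y, ia y < ib x & ib x < ib y] else ib x < ia y.

Definition group (g : K) : seq X := [seq x <- slots | key x == g].

(** For an empty group the first domain is empty, which makes the system unsolvable, as it should
    be. *)
Definition group_doms (S : seq X) : seq (seq int) :=
  [seq (ib x).+1%:Z%R | x <- S] :: nseq (size S).-1 [seq (ia x).+1%:Z%R | x <- S].

(** The value 0 is for the pair of variables whose bound is queried; the shift by one keeps all
    other values above it. *)
Definition U_doms : seq (seq int) :=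
  [:: 0%R] :: flatten [seq group_doms (group g) | g <- keys].

Definition V_doms : seq (seq int) :=
  [:: 0%R] :: [seq [:: (ia x).+1%:Z%R; (ib x).+1%:Z%R] | x <- slots].

Hypothesis ordered : pairwise precedes slots.
Hypothesis ia_ib : {in slots, forall x, ia x < ib x}.
Hypothesis uniq_keys : uniq keys.
Hypothesis key_in : {in slots, forall x, key x \in keys}.

Lemma chosen_cat u1 u2 U1 U2 : chosen u1 U1 -> chosen u2 U2 ->
  chosen (u1 ++ u2) (U1 ++ U2).
Proof.
rewrite /chosen; elim: u1 U1 => [|x u1 IH] [|D U1] //= /andP[-> H1] H2 /=.
exact: IH.
Qed.

Lemma chosen_size u U : chosen u U -> size u = size U.
Proof. by rewrite /chosen all2E => /andP[/eqP]. Qed.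

(* Counting the values of [u] that lie in [A] is possible on the domains when each
   of them is either inside or outside [A]. *)
Lemma chosen_count u U (A : pred int) : chosen u U ->
  (forall D, D \in U -> all A D || ~~ has A D) -> count A u = count (has A) U.
Proof.
elim: u U => [|x u IH] [|D U] //= /andP[xD uU] H.
rewrite (IH _ uU); last by move=> D' D'U; apply: H; rewrite inE D'U orbT.
congr (_ + _); have /orP[/allP DA|DA] := H D (mem_head _ _).
  by rewrite DA //; congr (nat_of_bool _); apply/esym/hasP; exists x => //; apply: DA.
rewrite (negbTE DA); apply/eqP; rewrite eqb0; apply: contra DA => Ax.
by apply/hasP; exists x.
Qed.

Lemma perm_groups (s : seq X) (ks : seq K) : uniq ks -> {in s, forall x, key x \in ks} ->
  perm_eq (flatten [seq [seq x <- s | key x == g] | g <- ks]) s.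
Proof.
elim: ks s => [|g ks IH] s /=.
  by case: s => // x s _ H; have := H x; rewrite inE eqxx => /(_ isT).
move=> /andP[g_ks ks_uniq] s_ks.
pose s' := [seq x <- s | key x != g].
have E : flatten [seq [seq x <- s | key x == h] | h <- ks] =
         flatten [seq [seq x <- s' | key x == h] | h <- ks].
  congr flatten; apply/eq_in_map => h hks; rewrite -filter_predI; apply: eq_filter => x /=.
  by case: eqP => //= ->; apply/esym; apply: contraNneq g_ks => <-.
rewrite E; apply: perm_trans (perm_cat (perm_refl _) (IH s' _ _)) _ => //.
  move=> x; rewrite mem_filter => /andP[xg /s_ks].
  by rewrite inE (negbTE xg).
by rewrite perm_filterC.
Qed.

Lemma gadget_sound (beta : X -> bool) :
  {in slots &, forall x y, blk x = blk y -> beta x = beta y} ->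
  {in keys, forall g, count beta (group g) = 1} ->
  exists u v, [/\ chosen u U_doms, chosen v V_doms, perm_eq u v, sorted <=%R v & uniq v].
Proof.
move=> beta_blk beta1.
pose val x : int := (if beta x then (ib x).+1%:Z else (ia x).+1%:Z)%R.
pose gu (S : seq X) : seq int := [seq val x | x <- S & beta x] ++ [seq val x | x <- S & ~~ beta x].
pose u : seq int := 0%R :: flatten [seq gu (group g) | g <- keys].
pose v : seq int := 0%R :: [seq val x | x <- slots].
(* Strictness yields [uniq v], which later determines the permutation and makes stability
   vacuous. *)
have v_sorted : sorted <%R v.
  rewrite sorted_pairwise; last exact: lt_trans.
  rewrite /v /= all_map; apply/andP; split.
    by apply/allP => x _ /=; rewrite /val; case: (beta x).
  rewrite pairwise_map; move: ordered beta_blk ia_ib; elim: slots => //= x s IH.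
  case/andP=> xs ss bb ii; apply/andP; split; last first.
    apply: IH => // [y z ys zs|y ys]; first by apply: bb; rewrite inE ?ys ?zs orbT.
    by apply: ii; rewrite inE ys orbT.
  apply/allP => y ys; have := allP xs y ys; rewrite /precedes /val /=.
  have xin : x \in x :: s by rewrite inE eqxx.
  have yin : y \in x :: s by rewrite inE ys orbT.
  have ix := ii x xin; have iy := ii y yin.
  case: eqP => [/(bb x y xin yin) <- /and3P[h1 h2 h3]|_ h].
    by case: (beta x); rewrite ltz_nat.
  by case: (beta x) (beta y) => [] []; rewrite ltz_nat ltnS //;
    do ?[exact: ltn_trans h iy | exact: ltn_trans ix h | apply: ltn_trans ix _].
exists u, v; split.
- apply: (@chosen_cat [:: 0%R] _ [:: [:: 0%R]]) => //.
  elim: keys beta1 => // g ks IH beta1.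
  apply: (@chosen_cat (gu (group g)) _ (group_doms (group g))); last first.
    by apply: IH => h hks; apply: beta1; rewrite inE hks orbT.
  have := beta1 g (mem_head _ _); rewrite /gu; set S := group g => b1.
  have sizeN : count (predC beta) S = (size S).-1 by rewrite -(count_predC beta S) b1.
  have b1' : size [seq x <- S | beta x] = 1 by rewrite size_filter.
  have mS x : x \in [seq x <- S | beta x] -> x \in S by rewrite mem_filter => /andP[].
  have bS x : x \in [seq x <- S | beta x] -> beta x by rewrite mem_filter => /andP[].
  case: (filter _ _) b1' mS bS => [|x []] //= _ mS bS.
  rewrite /chosen /= /val bS ?mem_head // map_f ?mS ?mem_head //=.
  have -> : (size S).-1 = size [seq x <- S | ~~ beta x] by rewrite -sizeN size_filter.
  have NS : {subset [seq x <- S | ~~ beta x] <= S}.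
    by move=> y; rewrite mem_filter => /andP[].
  have Nb : all (fun x => ~~ beta x) [seq x <- S | ~~ beta x] by apply: filter_all.
  elim: (filter (fun x => ~~ beta x) S) NS Nb => //= y T IHT NS /andP[Ny NT].
  rewrite (negbTE Ny) map_f ?NS ?mem_head //=; apply: IHT => // z zT.
  by apply: NS; rewrite inE zT orbT.
- apply: (@chosen_cat [:: 0%R] _ [:: [:: 0%R]]) => //.
  elim: slots => //= x s IH; rewrite /chosen /= -/(chosen _ _) IH andbT.
  by rewrite /val; case: (beta x); rewrite !inE eqxx ?orbT.
- rewrite /u /v perm_cons.
  apply: (@perm_trans _ (flatten [seq map val (group g) | g <- keys])).
    elim: keys => //= g ks IH; apply: perm_cat IH; rewrite /gu -map_cat.
    by apply: perm_map; rewrite perm_filterC.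
  have -> : [seq [seq val i | i <- group g] | g <- keys] = map (map val) (map group keys).
    by rewrite -map_comp.
  by rewrite -map_flatten; apply: perm_map; apply: perm_groups.
- by apply: sub_sorted v_sorted => x y; apply: ltW.
- exact: lt_sorted_uniq.
Qed.

(** Count the occurrences of low values of one group: the domains of [u] force the size of the group
    minus one, and [v] has equally many, so exactly one slot of the group is high. *)
Lemma gadget_complete : sort_solvable U_doms V_doms ->
  exists beta : X -> bool,
  {in slots &, forall x y, blk x = blk y -> ia x <= ia y -> beta x -> beta y} /\
  {in keys, forall g, count beta (group g) = 1}.
Proof.
move=> [u0 [v0 []]]; rewrite /U_doms /V_doms.
case: u0 => [|a u] // /andP[/=]; rewrite inE => /eqP -> uU.
case: v0 => [|b v] // /andP[/=]; rewrite inE => /eqP -> vV.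
rewrite perm_cons => uv /path_sorted v_sorted.
have ia_lt : pairwise (fun x y => ia x < ia y) slots.
  move: ordered ia_ib; elim: slots => //= x s IH /andP[xs ss] ii.
  apply/andP; split; last by apply: IH ss _ => y ys; apply: ii; rewrite inE ys orbT.
  apply/allP => y ys; have := allP xs y ys; rewrite /precedes /=.
  have ix := ii x (mem_head _ _); case: ifP => _; first by case/and3P.
  exact: ltn_trans.
have slots_uniq : uniq slots.
  apply: (map_uniq (f := ia)); apply: (sorted_uniq ltn_trans ltnn).
  by rewrite sorted_pairwise ?pairwise_map //; apply: ltn_trans.
pose val x := nth 0%R v (index x slots).
have vE : v = map val slots.
  have sv : size v = size slots by have := chosen_size vV; rewrite size_map.
  apply: (@eq_from_nth _ 0%R); first by rewrite size_map.
  move=> i iv; have x0 : X by case: (slots) sv iv => [->|x s _ _].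
  by rewrite (nth_map x0) -?sv // /val index_uniq -?sv.
pose beta x := val x == (ib x).+1%:Z%R.
have valE : {in slots, forall x, val x = (if beta x then (ib x).+1 else (ia x).+1)%:Z%R}.
  move: vV; rewrite vE /chosen; elim: (slots) => //= x s IH /andP[Hx Hs] y.
  rewrite inE => /predU1P[->|]; last exact: IH.
  move: Hx; rewrite !inE /beta; case: (val x =P (ib x).+1%:Z%R) => [-> //|_].
  by rewrite orbF => /eqP.
have lt_val x y : x \in slots -> y \in slots -> ia x < ia y -> (val x <= val y)%R /\ precedes x y.
  move=> xs ys xy; move: v_sorted ordered ia_lt; rewrite vE.
  rewrite sorted_pairwise ?pairwise_map; last exact: le_trans.
  elim: (slots) xs ys => //= z s IH; rewrite !inE.
  case/predU1P=> [xz|xs] /predU1P[yz|ys] /andP[zv sv] /andP[zp sp] /andP[zl sl].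
  - by rewrite xz yz ltnn in xy.
  - by have h1 := allP zv y ys; have h2 := allP zp y ys; rewrite xz.
  - by have := allP zl x xs; rewrite -yz ltnNge (ltnW xy).
  - exact: IH.
have ia_inj x y : x \in slots -> y \in slots -> ia x = ia y -> x = y.
  elim: (slots) ia_lt => //= z s IH /andP[zs ss]; rewrite !inE.
  case/predU1P=> [->|xs] /predU1P[->|ys] // xy; last exact: IH.
    by have := allP zs y ys; rewrite xy ltnn.
  by have := allP zs x xs; rewrite xy ltnn.
exists beta; split=> [x y xs ys xy|g gk].
  rewrite leq_eqVlt => /predU1P[exy|]; last first.
    move=> /(lt_val x y xs ys)[]; rewrite /precedes xy eqxx => le_xy /and3P[_ h _] bx.
    apply: contraLR (h) => nby; rewrite -leqNgt -ltnS -lez_nat.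
    by move: le_xy; rewrite !valE // bx (negbTE nby).
  by rewrite (ia_inj x y).
(* Low and high values never collide, even between different chains; otherwise a high value could be
   counted as a low one. *)
have ia_neq_ib x y : x \in slots -> y \in slots -> ia x != ib y.
  move=> xs ys; case: (ltngtP (ia x) (ia y)) => [xy|yx|/(ia_inj x y xs ys) ->].
  - by rewrite ltn_eqF // (ltn_trans xy) ?ia_ib.
  - have [_] := lt_val y x ys xs yx; rewrite /precedes; case: ifP => _.
      by case/and3P=> _ h _; rewrite ltn_eqF.
    by move=> h; rewrite gtn_eqF.
  - by rewrite ltn_eqF ?ia_ib.
pose A : pred int := mem [seq (ia x).+1%:Z%R | x <- group g].
have ia_A x : x \in slots -> A (ia x).+1%:Z%R = (key x == g).
  move=> xs; apply/mapP/eqP => [[y]|xg]; last by exists x; rewrite // mem_filter xg eqxx.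
  rewrite mem_filter => /andP[/eqP <- ys] [xy].
  by rewrite (ia_inj _ _ xs ys xy).
have ib_A x : x \in slots -> A (ib x).+1%:Z%R = false.
  move=> xs; apply/mapP => -[y]; rewrite mem_filter => /andP[_ ys] [yx].
  by have := ia_neq_ib y x ys xs; rewrite yx eqxx.
have v_count : count A v = count (predC beta) (group g).
  rewrite vE count_map count_filter; apply: eq_in_count => x xs /=.
  by rewrite valE //; case: (beta x); rewrite ?ib_A ?ia_A.
have gs h x : x \in group h -> x \in slots by rewrite mem_filter => /andP[].
have doms_A h : [/\ all A [seq (ia x).+1%:Z%R | x <- group h] = (h == g) || nilp (group h),
    has A [seq (ia x).+1%:Z%R | x <- group h] = (h == g) && ~~ nilp (group h)
  & ~~ has A [seq (ib x).+1%:Z%R | x <- group h]].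
  have E x : x \in group h -> A (ia x).+1%:Z%R = (h == g).
    by move=> xh; rewrite ia_A ?(gs h) //; move: xh; rewrite mem_filter => /andP[/eqP ->].
  split.
  - rewrite all_map (@eq_in_all _ _ (fun=> h == g)); last by move=> x xh /=; apply: E.
    by case: (group h) => [|x s]; rewrite /= ?orbT ?orbF //; elim: s => /= [|y s ->];
      rewrite ?andbT ?andbb.
  - rewrite has_map (@eq_in_has _ _ (fun=> h == g)); last by move=> x xh /=; apply: E.
    by case: (group h) => [|x s]; rewrite /= ?andbF ?andbT //; elim: s => /= [|y s ->];
      rewrite ?orbF ?orbb.
  - by rewrite has_map; apply/hasPn => x xh /=; rewrite ib_A // (gs h).
have u_count : count A u = (size (group g)).-1.
  rewrite (chosen_count uU) => [|D /flattenP[Ds /mapP[h hk ->]]]; last first.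
    have [E1 E2 E3] := doms_A h; rewrite inE => /predU1P[->|]; first by rewrite E3 orbT.
    by rewrite mem_nseq => /andP[_ /eqP ->]; rewrite E1 E2; case: eqP => //=; case: nilp.
  have E h : count (has A) (group_doms (group h)) = if h == g then (size (group g)).-1 else 0.
    have [E1 E2 E3] := doms_A h; rewrite /group_doms /= (negbTE E3) add0n count_nseq E2.
    case: eqP => [->|_] //=; rewrite /nilp.
    by case: (size (group g)) => //= k; rewrite mul1n.
  rewrite count_flatten -map_comp (eq_map E); move: uniq_keys gk.
  elim: keys => //= h ks IH /andP[hks ks_uniq]; rewrite inE (eq_sym g).
  case: eqP hks => [-> gks _|_ _] /=; last by move=> gk; rewrite add0n IH.
  rewrite -[RHS]addn0; congr (_ + _).
  elim: ks gks {IH ks_uniq} => //= k ks IH; rewrite inE negb_or => /andP[gk /IH ->].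
  by rewrite eq_sym (negbTE gk).
(* With the truncated predecessor an empty group would pass the count; its empty domain excludes
   it. *)
have S_gt0 : 0 < size (group g).
  case E : (group g) => [|//]; move: uU gk; rewrite /chosen.
  have := allP (_ : all (fun D => D != [::]) (flatten [seq group_doms (group g) | g <- keys])).
  move=> H uU gk; suff : [::] != [::] :> seq int by [].
  apply: H.
    move: uU; elim: (flatten _) (u) => //= D U IH [|x w] //= /andP[xD /IH ->].
    by rewrite andbT; case: (D) xD.
  apply/flattenP; exists (group_doms (group g)); first exact: map_f.
  by rewrite E mem_head.
have : count A u = count A v by apply: permP.
by rewrite u_count v_count -(count_predC beta (group g)) in S_gt0 *; lia.
Qed.
End Gadget.

(** * Tilings as exactly-one systems *)

Definition rk (T : finType) (x : T) : nat := index x (enum T).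

Lemma rk_lt (T : finType) (x : T) : rk x < #|T|.
Proof. by rewrite cardE index_mem mem_enum. Qed.

Lemma pairwise_rk (T : finType) : pairwise (fun x y : T => rk x < rk y) (enum T).
Proof.
rewrite -(pairwise_map (@rk T) ltn) -sorted_pairwise; last exact: ltn_trans.
have -> : map (@rk T) (enum T) = iota 0 #|T|; last exact: iota_ltn_sorted.
have sz : size (map (@rk T) (enum T)) = #|T| by rewrite size_map -cardE.
apply: (@eq_from_nth _ 0) => [|i]; rewrite ?size_iota // sz => iT.
have x0 : T by rewrite cardE in iT; case: (enum T) iT.
by rewrite (nth_map x0) -?cardE // nth_iota // /rk index_uniq ?enum_uniq -?cardE.
Qed.

Lemma pairwise_flatten_map (I A : eqType) (r : rel A) (F : I -> seq A) (s : seq I) :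
  pairwise (fun i j => allrel r (F i) (F j)) s -> (forall i, pairwise r (F i)) ->
  pairwise r (flatten [seq F i | i <- s]).
Proof.
move=> Hs HF; elim: s Hs => //= i s IH /andP[is_ /IH ss].
rewrite pairwise_cat ss HF !andbT; apply/allrelP => a b aF /flattenP[u /mapP[j js ->] bF].
by have /allrelP := allP is_ j js; apply.
Qed.

Lemma sumn_map_add I (f g : I -> nat) s :
  sumn [seq f i + g i | i <- s] = sumn [seq f i | i <- s] + sumn [seq g i | i <- s].
Proof. by elim: s => //= i s ->; lia. Qed.

Lemma sumn_pick (I : eqType) (s : seq I) (j : I) (f : I -> nat) : uniq s ->
  (forall i, i != j -> f i = 0) -> sumn [seq f i | i <- s] = if j \in s then f j else 0.
Proof.
move=> + H; elim: s => //= i s IH /andP[is_ /IH ->]; rewrite inE.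
case: (eqVneq j i) => [->|ji] /=; first by rewrite (negbTE is_) addn0.
by rewrite H // eq_sym.
Qed.

Lemma sumn_pick_iota n j (f : nat -> nat) : j < n ->
  (forall i, i != j -> f i = 0) -> sumn [seq f i | i <- iota 0 n] = f j.
Proof. by move=> jn H; rewrite (sumn_pick (iota_uniq 0 n) H) mem_iota add0n jn. Qed.

Lemma sumn_pick_enum (T : finType) (j : T) (f : T -> nat) :
  (forall i, i != j -> f i = 0) -> sumn [seq f i | i <- enum T] = f j.
Proof. by move=> H; rewrite (sumn_pick (enum_uniq T) H) mem_enum. Qed.

Lemma count_sub_eq (T : Type) (a b : pred T) s : (forall x, a x -> b x) ->
  count a s = count b s -> has (predD b a) s = false.
Proof.
move=> ab; elim: s => //= x s IH E; have le := sub_count ab s.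
have le1 : a x <= b x by case: (a x) (ab x) => // ->.
have {}IH : has (predD b a) s = false by apply: IH; lia.
by rewrite IH orbF; have : a x = b x :> nat by [lia]; case: (a x) (b x) => [] [].
Qed.

Section Tiling.
Variables (Tile C : finType) (col_out col_in : bool -> Tile -> C).
Variables (N W : nat) (allowed : nat -> pred Tile) (t0 : Tile).
Hypothesis W_gt0 : 0 < W.

Definition shift (dir : bool) : nat := if dir then W else 1.

Definition is_tiling (tau : nat -> Tile) : Prop :=
  (forall p, p < N -> allowed p (tau p)) /\
  (forall dir p, p + shift dir < N ->
     col_out dir (tau p) = col_in dir (tau (p + shift dir))).

(* The key of a slot names its exactly-one group: [inl] for the first and the last
   slots of a position, [inr (dir, c)] for the edge leaving it in direction [dir]
   with colour [c]. *)
Definition slot_key : eqType := (nat * (bool + bool * C))%type.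
Definition slot : eqType := ((nat * Tile) * nat * slot_key)%type.

(** [None] stands for the edge that leaves [p], [Some c] for the one that enters it and whose key
    names the other end, [p - shift]; the guards drop edges across the ends of the sequence. Ranks
    start at one because zero is the first slot of the chain. *)
Definition edge_slots p t (dc : bool * option C) : seq (nat * slot_key) :=
  match dc.2 with
  | None => if p + shift dc.1 < N
            then [:: ((rk dc).+1, (p, inr (dc.1, col_out dc.1 t)))] else [::]
  | Some c => if (shift dc.1 <= p) && (c != col_in dc.1 t)
              then [:: ((rk dc).+1, (p - shift dc.1, inr (dc.1, c)))] else [::]
  end.

Definition edge_count : nat := #|{: bool * option C}|.

Definition slots_of p t : seq (nat * slot_key) :=
  (0, (p, inl false)) ::
  flatten [seq edge_slots p t dc | dc <- enum {: bool * option C}] ++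
  [:: (edge_count.+1, (p, inl true))].

Definition tile_slots p t : seq slot := [seq ((p, t), a.1, a.2) | a <- slots_of p t].

Definition pos_slots p : seq slot :=
  flatten [seq if allowed p t then tile_slots p t else [::] | t <- enum Tile].

Definition slots : seq slot := flatten [seq pos_slots p | p <- iota 0 N].

Definition pos_keys p : seq slot_key :=
  (p, inl false) :: (p, inl true) ::
  flatten [seq if p + shift dc.1 < N then [:: (p, inr dc)] else [::]
          | dc <- enum {: bool * C}].

Definition keys : seq slot_key := flatten [seq pos_keys p | p <- iota 0 N].

Definition block (x : slot) : nat * Tile := x.1.1.

(** Ranks stay below [edge_count.+2], so each chain gets an interval of twice this length, with the
    low values in its first half and the high ones in the second. *)
Definition low (x : slot) : nat :=
  (x.1.1.1 * #|Tile| + rk x.1.1.2) * (2 * edge_count.+2) + x.1.2.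

Definition high (x : slot) : nat := low x + edge_count.+2.

Definition skey (x : slot) : slot_key := x.2.

Lemma edge_slotsP p t dc a : a \in edge_slots p t dc -> a.1 = (rk dc).+1.
Proof.
rewrite /edge_slots; case: dc.2 => [c|]; case: ifP => //= _;
  by rewrite inE => /eqP ->.
Qed.

Lemma slots_of_lt p t a : a \in slots_of p t -> a.1 < edge_count.+2.
Proof.
rewrite inE mem_cat => /predU1P[->//|/orP[/flattenP[s /mapP[dc _ ->]]|]].
  by move=> /edge_slotsP ->; have := rk_lt dc; rewrite !ltnS => /ltnW.
by rewrite inE => /eqP ->.
Qed.

Lemma pairwise_slots_of p t : pairwise (fun a b => a.1 < b.1) (slots_of p t).
Proof.
rewrite /slots_of pairwise_cons pairwise_cat /= !andbT.
have E : {in flatten [seq edge_slots p t dc | dc <- enum {: bool * option C}],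
    forall a, 0 < a.1 <= edge_count}.
  by move=> a /flattenP[s /mapP[dc _ ->]] /edge_slotsP ->; have := rk_lt dc.
apply/and3P; split.
- apply/allP => a; rewrite mem_cat => /orP[/E /andP[]//|].
  by rewrite inE => /eqP ->.
- by apply/allrelP => a b /E /andP[_ a_le]; rewrite inE => /eqP ->.
- apply: pairwise_flatten_map => [|dc].
    apply: sub_pairwise (pairwise_rk _) => dc dc' lt_dc.
    by apply/allrelP => a b /edge_slotsP -> /edge_slotsP ->.
  rewrite /edge_slots; case: dc.2 => [c|]; by case: ifP.
Qed.

Lemma low_lt x y : x.1.2 < edge_count.+2 ->
  x.1.1.1 * #|Tile| + rk x.1.1.2 < y.1.1.1 * #|Tile| + rk y.1.1.2 -> high x < low y.
Proof.
rewrite /high /low; set a := _ + rk _; set b := _ + rk _; set m := edge_count.+2.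
move=> xm ab; apply: (@leq_trans (a.+1 * (2 * m))); last first.
  by apply: leq_trans (leq_addr _ _); rewrite leq_mul2r ab orbT.
have -> : a.+1 * (2 * m) = a * (2 * m) + (m + m).
  by rewrite [a.+1 * _]mulSn addnC mul2n addnn.
by rewrite -addnA ltn_add2l ltn_add2r.
Qed.

Lemma mem_pos_slots p x : x \in pos_slots p ->
  [/\ x.1.1.1 = p, allowed p x.1.1.2 & (x.1.2, x.2) \in slots_of p x.1.1.2].
Proof.
case/flattenP=> s /mapP[t _ ->]; case: ifP => // pt /mapP[a a_in ->] /=.
by split=> //; case: a a_in.
Qed.

Lemma ordered_slots : pairwise (precedes low high block) slots.
Proof.
apply: pairwise_flatten_map => [|p].
  have: pairwise ltn (iota 0 N) by rewrite -sorted_pairwise ?iota_ltn_sorted //; apply: ltn_trans.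
  apply: sub_pairwise => p q pq; apply/allrelP => x y.
  move=> /mem_pos_slots[xp _ /slots_of_lt /= xm] /mem_pos_slots[yq _ _].
  rewrite /precedes /block; case: eqP => [E|_].
    by move: pq; rewrite -xp -yq E /= ltnn.
  apply: low_lt => //; rewrite xp yq; have hx := rk_lt x.1.1.2.
  apply: (@leq_trans (p.+1 * #|Tile|)); first by rewrite mulSn addnC ltn_add2r.
  by apply: leq_trans (leq_addr _ _); rewrite leq_mul2r [p < q]pq orbT.
apply: pairwise_flatten_map => [|t].
  apply: sub_pairwise (pairwise_rk _) => t t' tt'; apply/allrelP => x y.
  case: ifP => // _ /mapP[a /slots_of_lt am ->]; case: ifP => // _ /mapP[b _ ->].
  rewrite /precedes /block /=; case: eqP => [[E]|_]; first by rewrite E ltnn in tt'.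
  by apply: low_lt; rewrite //= ltn_add2l.
case: ifP => // _; rewrite pairwise_map.
apply: (@sub_in_pairwise _ (mem (slots_of p t)) (fun a b => a.1 < b.1));
  [|exact/allP|exact: pairwise_slots_of].
move=> a b /slots_of_lt am /slots_of_lt bm ab /=.
rewrite /precedes /block /= eqxx /high /low /=.
move: (_ * (2 * _)) => k; apply/and3P; split; move: am bm ab; rewrite /=; lia.
Qed.

Lemma low_high : {in slots, forall x, low x < high x}.
Proof. by move=> x _; rewrite /high addnS ltnS leq_addr. Qed.

Lemma slots_keyP p q k : (q, k) \in pos_keys p ->
  p = q /\ (if k is inr dc then p + shift dc.1 < N else true).
Proof.
rewrite !inE => /or3P[/eqP[-> ->]|/eqP[-> ->]|] //.
case/flattenP=> s /mapP[dc _ ->]; case: ifP => // h.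
by rewrite inE => /eqP[-> ->].
Qed.

Lemma keysP q k : ((q, k) \in keys) =
  (q < N) && (if k is inr dc then q + shift dc.1 < N else true).
Proof.
apply/flattenP/andP => [[s /mapP[p + ->]]|[qN H]].
  by rewrite mem_iota add0n => pN /slots_keyP[<- H]; split=> //; case: k H.
exists (pos_keys q); first by apply: map_f; rewrite mem_iota add0n.
rewrite !inE; case: k H => [[]|dc] H; rewrite ?eqxx ?orbT //.
apply/or3P; constructor 3; apply/flattenP; exists [:: (q, inr dc)]; last by rewrite inE.
by apply/mapP; exists dc; rewrite ?mem_enum ?H.
Qed.

Lemma uniq_flatten_map (I A : eqType) (F : I -> seq A) (h : A -> I) (s : seq I) :
  uniq s -> (forall i, uniq (F i)) -> (forall i a, a \in F i -> h a = i) ->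
  uniq (flatten [seq F i | i <- s]).
Proof.
move=> + HF Hh; elim: s => //= i s IH /andP[is_ /IH us].
rewrite cat_uniq us HF andbT /=; apply/hasPn => a /flattenP[u /mapP[j js ->] aF].
by apply: contra is_ => /Hh <-; rewrite (Hh j).
Qed.

Lemma uniq_keys : uniq keys.
Proof.
apply: (uniq_flatten_map (h := fst)) => [|p|p [q k] /slots_keyP[]//].
  exact: iota_uniq.
rewrite /pos_keys /= !inE /= negb_or; apply/and3P; split.
- apply/andP; split; first by apply/eqP => -[].
  by apply/flattenP => -[s /mapP[dc _ ->]]; case: ifP => // _; rewrite inE => /eqP[].
- by apply/flattenP => -[s /mapP[dc _ ->]]; case: ifP => // _; rewrite inE => /eqP[].
pose h (a : slot_key) : option (bool * C) := if a.2 is inr dc then Some dc else None.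
have -> : [seq if p + shift dc.1 < N then [:: (p, inr dc)] else [::] | dc <- enum {: bool * C}] =
  [seq (fun o => if o is Some dc then if p + shift dc.1 < N then [:: (p, inr dc) : slot_key]
     else [::] else [::]) o | o <- map Some (enum {: bool * C})].
  by elim: (enum _) => //= dc dcs ->.
apply: (uniq_flatten_map (h := h)) => [|[dc|]|[dc|] a] //.
- by rewrite map_inj_uniq ?enum_uniq // => x y [].
- by case: ifP.
- by case: ifP => // _; rewrite inE => /eqP ->.
Qed.

Lemma mem_slots x : x \in slots ->
  [/\ x.1.1.1 < N, allowed x.1.1.1 x.1.1.2 & (x.1.2, x.2) \in slots_of x.1.1.1 x.1.1.2].
Proof.
case/flattenP=> s /mapP[p + ->]; rewrite mem_iota add0n => pN /mem_pos_slots[-> ? ?].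
by split.
Qed.

Lemma mem_slots_of p t j q k : (j, (q, k)) \in slots_of p t ->
  match k with
  | inl b => q = p
  | inr (dir, c) => (p = q /\ p + shift dir < N) \/ p = q + shift dir
  end.
Proof.
rewrite inE mem_cat => /or3P[/eqP[_ -> ->]|/flattenP[s /mapP[dc _ ->]]|] //.
  rewrite /edge_slots; case: dc.2 => [c|]; case: ifP => //.
    by move=> /andP[h _]; rewrite inE => /eqP[_ -> ->]; right; rewrite subnK.
  by move=> h; rewrite inE => /eqP[_ -> ->]; left.
by rewrite inE => /eqP[_ -> ->].
Qed.

Lemma key_in_keys : {in slots, forall x, skey x \in keys}.
Proof.
move=> x /mem_slots[pN _]; rewrite /skey; case: x.2 => q k /mem_slots_of H.
rewrite keysP; case: k H => [b ->|[dir c] /= [[<- h]|h]]; rewrite ?pN //.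
by rewrite -h pN andbT (leq_ltn_trans (leq_addr (shift dir) q)) // -h.
Qed.

Definition key_count p t (g : slot_key) : nat :=
  match g.2 with
  | inl _ => p == g.1
  | inr (dir, c) => [&& p == g.1, p + shift dir < N & col_out dir t == c] +
      ((p == g.1 + shift dir) && (c != col_in dir t))
  end.

Lemma count_slots_of p t g : count (fun a => a.2 == g) (slots_of p t) = key_count p t g.
Proof.
rewrite /slots_of /= count_cat /= addn0 count_flatten -map_comp.
case: g => q k; rewrite /key_count /= !xpair_eqE; case: k => [b|[dir c]] /=.
  rewrite (eq_map (g := fun _ => 0)); last first.
    move=> dc /=; rewrite /edge_slots; case: dc.2 => [c|]; case: ifP => //= _;
      by rewrite xpair_eqE andbF.
  have -> : sumn [seq 0 | _ <- enum {: bool * option C}] = 0 by elim: (enum _).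
  by case: b; rewrite /= ?andbF ?andbT ?addn0 ?add0n.
rewrite !andbF !addn0 add0n.
pose f1 (dc : bool * option C) : nat := if dc == (dir, None) then
  nat_of_bool [&& p == q, p + shift dir < N & col_out dir t == c] else 0.
pose f2 (dc : bool * option C) : nat := if dc == (dir, Some c) then
  nat_of_bool ((p == q + shift dir) && (c != col_in dir t)) else 0.
have eqK x d c1 y d' c2 : ((x, inr (d, c1)) == (y, inr (d', c2)) :> slot_key) =
    [&& x == y, d == d' & c1 == c2] by [].
have count1 (b : bool) (a : nat * slot_key) g :
    count (fun a => a.2 == g) (if b then [:: a] else [::]) = b && (a.2 == g).
  by case: b => //=; rewrite addn0.
rewrite (eq_map (g := fun dc => f1 dc + f2 dc)); last first.
  move=> [dir' o]; rewrite /f1 /f2 /edge_slots /= !xpair_eqE.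
  case: o => [c'|]; rewrite count1 eqK ?andbF ?andbT ?addn0 ?add0n.
    have -> : (Some c' == Some c) = (c' == c) by [].
    case: (eqVneq dir' dir) => [->|nd] /=; last by rewrite !andbF.
    case: (eqVneq c' c) => [->|nc] /=; last by rewrite !andbF.
    case: leqP => /= hp; last by case: eqP => // e; move: hp; rewrite e ltnNge leq_addl.
    by rewrite andbT andbC -(eqn_add2r (shift dir)) subnK.
  case: (eqVneq dir' dir) => [->|nd] /=; last by rewrite !andbF.
  by rewrite andbCA.
rewrite sumn_map_add (@sumn_pick_enum _ (dir, None) f1); last first.
  by move=> i /negbTE; rewrite /f1 => ->.
rewrite (@sumn_pick_enum _ (dir, Some c) f2); last first.
  by move=> i /negbTE; rewrite /f2 => ->.
by rewrite /f1 /f2 !eqxx.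
Qed.

Lemma count_slots (P : nat -> Tile -> nat * slot_key -> bool) :
  count (fun x : slot => P x.1.1.1 x.1.1.2 (x.1.2, x.2)) slots =
  sumn [seq sumn [seq if allowed p t then count (P p t) (slots_of p t) else 0
                 | t <- enum Tile] | p <- iota 0 N].
Proof.
rewrite count_flatten -map_comp; congr sumn; apply: eq_map => p /=.
rewrite count_flatten -map_comp; congr sumn; apply: eq_map => t /=.
case: ifP => // _; rewrite count_map; apply: eq_count => a /=.
by case: a.
Qed.

Lemma count_tiling (tau : nat -> Tile) g :
  (forall p, p < N -> allowed p (tau p)) ->
  count (fun x : slot => x.1.1.2 == tau x.1.1.1) (group slots skey g) =
  sumn [seq key_count p (tau p) g | p <- iota 0 N].
Proof.
move=> tau_ok; rewrite count_filter.
etransitivity; first exact: (count_slots (fun p t (a : nat * slot_key) =>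
   (t == tau p) && (a.2 == g))).
congr sumn; apply/eq_in_map => p; rewrite mem_iota add0n => pN.
rewrite (@sumn_pick_enum _ (tau p)) ?tau_ok //.
  rewrite -count_slots_of; apply: eq_count => a /=; by rewrite eqxx.
move=> t /negbTE tn; rewrite -[RHS](count_pred0 (slots_of p t)).
case: ifP => _; last by rewrite count_pred0.
by apply: eq_count => a /=; rewrite tn.
Qed.

Lemma sum_key_count (tau : nat -> Tile) q k : (q, k) \in keys ->
  sumn [seq key_count p (tau p) (q, k) | p <- iota 0 N] =
  match k with
  | inl _ => 1
  | inr (dir, c) => (col_out dir (tau q) == c) + (c != col_in dir (tau (q + shift dir)))
  end.
Proof.
rewrite keysP; case: k => [b|[dir c]] /=.
  rewrite andbT => qN; rewrite (@sumn_pick_iota _ q) //; first by rewrite /key_count eqxx.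
  by move=> p /negbTE; rewrite /key_count /= => ->.
case/andP=> qN qdN; rewrite sumn_map_add; congr (_ + _).
  rewrite (@sumn_pick_iota _ q) //=; first by rewrite eqxx qdN.
  by move=> p /negbTE ->.
rewrite (@sumn_pick_iota _ (q + shift dir)) //=; first by rewrite eqxx.
by move=> p /negbTE ->.
Qed.

Lemma tiling_slots (tau : nat -> Tile) : is_tiling tau ->
  {in keys, forall g, count (fun x : slot => x.1.1.2 == tau x.1.1.1) (group slots skey g) = 1}.
Proof.
move=> [tau_ok tau_edge] [q k] gk; rewrite count_tiling // sum_key_count //.
case: k gk => // -[dir c]; rewrite keysP => /andP[_ /= qN].
by rewrite tau_edge // eq_sym; case: eqP.
Qed.

Lemma slots_tiling (beta : slot -> bool) :
  {in slots &, forall x y, block x = block y -> low x <= low y -> beta x -> beta y} ->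
  {in keys, forall g, count beta (group slots skey g) = 1} ->
  exists tau, is_tiling tau.
Proof.
move=> mono one.
pose st b p t : slot := ((p, t), if b then edge_count.+1 else 0, (p, inl b)).
have st_in b p t : p < N -> allowed p t -> st b p t \in slots.
  move=> pN pt; apply/flattenP; exists (pos_slots p).
    by apply: map_f; rewrite mem_iota add0n.
  apply/flattenP; exists (tile_slots p t).
    by apply/mapP; exists t; rewrite ?mem_enum ?pt.
  apply/mapP; exists (if b then edge_count.+1 else 0, (p, inl b)) => //.
  by rewrite inE mem_cat !inE; case: b; rewrite !eqxx ?orbT.
have st_one b p : p < N -> count (fun t => allowed p t && beta (st b p t)) (enum Tile) = 1.
  move=> pN; have gk : (p, inl b) \in keys by rewrite keysP pN.
  rewrite -(one _ gk).
  etransitivity; last first.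
    have H := count_slots (fun p' t (a : nat * slot_key) =>
      beta ((p', t), a.1, a.2) && (a.2 == (p, inl b))).
    by apply/esym; apply: (etrans _ H); rewrite count_filter; apply: eq_count => -[[[? ?] ?] ?].
  rewrite (@sumn_pick_iota _ p) //.
    rewrite -sumn_count; congr sumn; apply: eq_map => t; case: ifP => //= pt.
    transitivity (count (fun a : nat * slot_key => beta (st b p t) && (a.2 == (p, inl b)))
        (slots_of p t)).
      have := count_slots_of p t (p, inl b); rewrite /key_count eqxx => H.
      by case: (beta _) => /=; rewrite ?H // count_pred0.
    apply: eq_in_count => -[j k] /= jk; case: eqP => [e|_]; rewrite ?andbF // !andbT.
    congr beta; move: jk; rewrite e /st inE mem_cat => /or3P[/eqP[-> ->]|/flattenP[s]|] //.
      move=> /mapP[dc _ ->]; rewrite /edge_slots; case: dc.2 => [c|]; case: ifP => //= _;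
        by rewrite inE => /eqP[].
    by rewrite inE => /eqP[-> ->].
  move=> p' p'p; rewrite -[RHS](sumn_nseq 0 (size (enum Tile))).
  have E t : (if allowed p' t then count (fun a : nat * slot_key =>
      beta (p', t, a.1, a.2) && (a.2 == (p, inl b))) (slots_of p' t) else 0) = 0.
    case: ifP => // _; apply/eqP; rewrite -leqn0.
    apply: leq_trans (sub_count (a2 := fun a => a.2 == (p, inl b)) _ _) _.
      by move=> a /andP[].
    by rewrite count_slots_of /key_count /= (negbTE p'p).
  by rewrite (eq_map E); elim: (enum Tile).
pose S p t := allowed p t && beta (st false p t).
pose F p t := allowed p t && beta (st true p t).
have S_one p : p < N -> count (S p) (enum Tile) = 1 by exact: st_one.
have F_one p : p < N -> count (F p) (enum Tile) = 1 by exact: st_one.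
(* Propagation includes the true first slots in the true last ones; each of the two groups has
   exactly one, so the inclusion is an equality. *)
have SF p t : p < N -> S p t = F p t.
  move=> pN; have sub u : S p u -> F p u.
    move=> /andP[pu bu]; rewrite /F pu /=; apply: mono bu; rewrite ?st_in //.
    by rewrite /low /= addn0 leq_addr.
  apply/idP/idP => [/sub//|Ft]; apply: contraT => Snt.
  have := count_sub_eq sub (etrans (S_one p pN) (esym (F_one p pN))).
  by move=> <-; apply/hasP; exists t; rewrite ?mem_enum //=; rewrite Snt.
pose tau p := if [pick t | S p t] is Some t then t else t0.
have tauS p : p < N -> S p (tau p).
  move=> pN; rewrite /tau; case: pickP => // none.
  have := S_one p pN; rewrite (@eq_count _ _ pred0) ?count_pred0 //.
have S_uniq p t : p < N -> S p t -> t = tau p.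
  move=> pN St; have := S_one p pN; rewrite -size_filter.
  have : t \in [seq u <- enum Tile | S p u] by rewrite mem_filter St mem_enum.
  have : tau p \in [seq u <- enum Tile | S p u] by rewrite mem_filter tauS ?mem_enum.
  by rewrite -/(S p); case: (filter _ _) => [|u []] //=; rewrite !inE => /eqP -> /eqP ->.
have tau_ok p : p < N -> allowed p (tau p) by move=> /tauS /andP[].
(* A slot lies between the first and the last of its chain; these agree, so it agrees with them. *)
have betaE : {in slots, forall x, beta x = (x.1.1.2 == tau x.1.1.1)}.
  move=> x xs; have [pN pt jk] := mem_slots xs.
  set p := x.1.1.1 in pN pt jk *; set t := x.1.1.2 in pt jk *.
  have lo : low (st false p t) <= low x by rewrite /low /= addn0 leq_addr.
  have hi : low x <= low (st true p t).
    by rewrite /low /= leq_add2l -ltnS; apply: (slots_of_lt jk).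
  have bl b : block (st b p t) = block x by rewrite /block /st /p /t /=; case: (x.1.1).
  have b1 : beta (st false p t) -> beta x.
    by apply: mono (bl _) lo => //; apply: st_in.
  have b2 : beta x -> beta (st true p t).
    by apply: mono (esym (bl _)) hi => //; apply: st_in.
  apply/idP/eqP => [/b2 bt|tE].
    by apply: S_uniq; rewrite // SF // /F pt.
  by apply: b1; have := tauS p pN; rewrite -tE => /andP[].
exists tau; split=> // dir p pdN.
(* The group of the ingoing colour suffices: the facing tile has no slot in it, so its true slot is
   the outgoing one, which has this colour. *)
pose c := col_in dir (tau (p + shift dir)).
have gk : (p, inr (dir, c)) \in keys.
  by rewrite keysP /= pdN (leq_ltn_trans _ pdN) ?leq_addr.
have := one _ gk; rewrite (@eq_in_count _ _ (fun x : slot => x.1.1.2 == tau x.1.1.1)).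
  by rewrite count_tiling // sum_key_count // /c eqxx addn0; case: eqP.
by move=> x; rewrite mem_filter => /andP[_ /betaE].
Qed.

(** One direction delivers distinct values, the other starts from mere solvability, so that the same
    two implications serve all three constraints. *)
Theorem tiling_iff_sortable :
  (forall tau, is_tiling tau -> exists u v,
     [/\ chosen u (U_doms slots keys low high skey), chosen v (V_doms slots low high),
         perm_eq u v, sorted <=%R v & uniq v]) /\
  (sort_solvable (U_doms slots keys low high skey) (V_doms slots low high) ->
     exists tau, is_tiling tau).
Proof.
split=> [tau H|H].
  apply: (gadget_sound ordered_slots low_high uniq_keys key_in_keys
    (beta := fun x : slot => x.1.1.2 == tau x.1.1.1)).
    by move=> x y _ _; rewrite /block => ->.
  exact: tiling_slots.
have [beta [H1 H2]] := gadget_complete ordered_slots low_high uniq_keys H.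
exact: slots_tiling H1 H2.
Qed.
End Tiling.

(** * Computations as tilings *)

Section Tableau.
Variable M : tm.

Definition column : finType := {ffun 'I_(work_tapes M).+2 -> option (bool + aux M)}.

(* [None] marks the separator between consecutive rows, [Some (Some q)] the column
   under the heads, with the state, and [Some None] the other columns. *)
Definition vcell : finType := (option (option (state M)) * column)%type.

Definition view : finType := (state M * column)%type.

(** Cells far from the heads must know the transition taken in their row, so every tile carries the
    view, and horizontal colours keep it constant along the row. *)
Definition tile : finType := (view * (vcell * vcell * vcell))%type.

Definition colour : finType := (vcell * vcell * option view)%type.

Definition sep_cell : vcell := (None, [ffun _ => None]).

Definition view_of (v : vcell) : view := (if v.1 is Some (Some q) then q else start M, v.2).

(* Columns are numbered relatively to the heads, so that moving a head shifts the
   contents of its tape. *)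
Definition next_cell (k : view) (a b c : vcell) : vcell :=
  if b.1 is Some kb then
    if delta k.1 k.2 is Some (q, act) then
      let wr (z : vcell) j := if z.1 is Some (Some _) then (act j).1 else z.2 j in
      (Some (if kb is Some _ then Some q else None),
       [ffun j => match (act j).2 with
                  | MoveLeft => wr a j | Stay => wr b j | MoveRight => wr c j
                  end])
    else b
  else b.

Definition tview (u : tile) : view := u.1.
Definition tleft_cell (u : tile) : vcell := u.2.1.1.
Definition tmid (u : tile) : vcell := u.2.1.2.
Definition tright_cell (u : tile) : vcell := u.2.2.

(** At a separator the view is withheld, so that consecutive rows of the long sequence can have
    different ones. *)
Definition shared_view (b : vcell) (k : view) : option view :=
  if b.1 is Some _ then Some k else None.

(** Vertically a single cell is passed on; it is doubled to fit the colour type of the horizontal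
    edges. *)
Definition tile_out (dir : bool) (u : tile) : colour :=
  if dir then
    let v := next_cell (tview u) (tleft_cell u) (tmid u) (tright_cell u) in (v, v, None)
  else (tmid u, tright_cell u, shared_view (tright_cell u) (tview u)).

Definition tile_in (dir : bool) (u : tile) : colour :=
  if dir then (tmid u, tmid u, None)
  else (tleft_cell u, tmid u, shared_view (tmid u) (tview u)).

Definition top_is (c : option (bool + aux M)) (s : seq bool) : bool :=
  match c with
  | None => nilp s
  | Some (inl d) => if s is e :: _ then d == e else false
  | Some (inr _) => false
  end.

Definition bit_or_blank (c : option (bool + aux M)) : bool :=
  if c is Some (inr _) then false else true.

Variables (x : seq bool) (P T : nat).

(** Column 0 is the separator; then come [T] columns on each side of the heads, since nothing
    further away can reach them in [T] steps. *)
Definition centre : nat := T.+1.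
Definition width : nat := (2 * T).+2.
Definition height : nat := T.+1.

(** On tape 1 the [P] cells from the centre on are free to hold any certificate, except that a blank
    must be followed by a blank; a tile can check this because it also contains its right
    neighbour. *)
Definition start_ok (p : nat) (u : tile) : bool :=
  if p == 0 then tmid u == sep_cell else
  ((tmid u).1 == Some (if p == centre then Some (start M) else None)) &&
  [forall j : 'I_(work_tapes M).+2,
     if j == 0 :> nat then
       if centre <= p then top_is ((tmid u).2 j) (drop (p - centre) x)
       else (tmid u).2 j == None
     else if (j == 1 :> nat) && (centre <= p < centre + P) then
       bit_or_blank ((tmid u).2 j) &&
       (((tmid u).2 j == None) ==> ((tright_cell u).2 j == None))
     else (tmid u).2 j == None].

Definition view_ok (u : tile) : bool :=
  if (tmid u).1 is Some (Some q) then tview u == (q, (tmid u).2) else true.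

Definition final_ok (u : tile) : bool :=
  if (tmid u).1 is Some (Some q) then accept q else true.

Definition tile_ok (p : nat) (u : tile) : bool :=
  [&& view_ok u, (p < width) ==> start_ok p u
    & (width * T <= p) ==> final_ok u].

Definition word_cell (w : seq bool) (i : nat) : option (bool + aux M) :=
  nth None (map (Some \o inl) w) i.

Lemma top_isP c s : top_is c s = (c == word_cell s 0).
Proof. by case: c s => [[d|a]|] [|e s]. Qed.

Lemma word_cell_drop k w : word_cell (drop k w) 0 = word_cell w k.
Proof. by rewrite /word_cell map_drop nth_drop addn0. Qed.

(** * Rows of a run on a fixed certificate *)

Section Rows.
Variable y : seq bool.

Definition row0 (c : nat) : vcell :=
  if c == 0 then sep_cell else
  (Some (if c == centre then Some (start M) else None),
   [ffun j : 'I_(work_tapes M).+2 =>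
      if centre <= c then word_cell (nth [::] [:: x; y] j) (c - centre) else None]).

(** The right neighbour of the last column is the separator that opens the next row. *)
Definition next_row (r : nat -> vcell) (c : nat) : vcell :=
  next_cell (view_of (r centre)) (r c.-1) (r c) (if c.+1 < width then r c.+1 else sep_cell).

Definition row (t : nat) : nat -> vcell := iter t next_row row0.

Lemma row_kind t c : match (row t c).1 with
  | None => c = 0
  | Some None => c != 0 /\ c != centre
  | Some (Some _) => c = centre
  end.
Proof.
elim: t c => [|t IH] c.
  rewrite [row _]/= /row0; case: (eqVneq c 0) => [//|c0] /=.
  by case: (eqVneq c centre) => [//|cc]; split.
rewrite /= /next_row /next_cell; move: (IH c); case E : (row t c).1 => [[q|]|] //=.
- by move=> H; case: delta => [[q' act]|] /=; rewrite ?E.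
- by move=> H; case: delta => [[q' act]|] /=; rewrite ?E.
- by rewrite E.
Qed.

Lemma row_sep t : row t 0 = sep_cell.
Proof.
elim: t => //= t IH; by rewrite /next_row /next_cell -/(row t) IH.
Qed.

Lemma row_sepE t c : 0 < c -> (row t c).1 <> None.
Proof. by move=> c0 E; have := row_kind t c; rewrite E => c00; rewrite c00 in c0. Qed.

Definition tape_cell (tp : tape M) (c : nat) : cell M :=
  if c < centre then nth None (tleft tp) (centre - c).-1
  else nth None (thead tp :: tright tp) (c - centre).

Lemma tape_cell_write a tp c : tape_cell (tape_write a tp) c =
  if c == centre then a else tape_cell tp c.
Proof.
rewrite /tape_cell /=; case: (ltngtP c centre) => // [h|->]; last by rewrite subnn.
by rewrite -(subnSK h).
Qed.

Lemma tape_cell_right tp c : tape_cell (tape_move MoveRight tp) c = tape_cell tp c.+1.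
Proof.
rewrite /tape_cell; case: tp => l h r.
have E : tape_move MoveRight (Tape l h r) =
    Tape (h :: l) (head None r) (behead r) by case: r.
rewrite E /=; case: (ltngtP c.+1 centre) => [h1|h1|<-].
- rewrite ?(ltnW h1); have -> : (centre - c).-1 = (centre - c.+1).-1.+1 by lia.
  by [].
- rewrite ?ltnNge ?(_ : centre <= c) //=.
  have -> : c.+1 - centre = (c - centre).+1 by rewrite subSn.
  by case: r {E} => [|? ?]; case: (c - centre) => //= ?; rewrite nth_nil.
- by rewrite ?ltnSn subSnn subnn.
Qed.

Lemma tape_cell_left tp c : 0 < c -> tape_cell (tape_move MoveLeft tp) c = tape_cell tp c.-1.
Proof.
case: c => // c _ /=; rewrite /tape_cell; case: tp => l h r.
have E : tape_move MoveLeft (Tape l h r) =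
    Tape (behead l) (head None l) (h :: r) by case: l.
rewrite E /=; case: (ltngtP c.+1 centre) => [h1|h1|<-].
- rewrite ?(ltnW h1); have -> : (centre - c).-1 = (centre - c.+1).-1.+1 by lia.
  by case: l {E} => [|? ?] //=; rewrite !nth_nil.
- rewrite ?ltnNge ?(_ : centre <= c) //=.
  by have -> : c.+1 - centre = (c - centre).+1 by rewrite subSn.
- by rewrite ?ltnSn subSnn subnn; case: l {E}.
Qed.

Lemma tape_cell_step m a tp c : 0 < c ->
  tape_cell (tape_move m (tape_write a tp)) c =
  let w z := if z == centre then a else tape_cell tp z in
  match m with MoveLeft => w c.-1 | Stay => w c | MoveRight => w c.+1 end.
Proof.
move=> c0; case: m.
- by rewrite tape_cell_left // tape_cell_write.
- exact: tape_cell_write.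
- by rewrite tape_cell_right tape_cell_write.
Qed.

(** A halted configuration is repeated, as in [next_cell], so a machine that halts within [T] steps
    shows its final configuration in row [T]. *)
Definition run (t : nat) : config M :=
  iter t (fun c => odflt c (Defs.step c)) (init M x y).

(** Cells at the border lack true neighbours and may be wrong. The error spreads by one column per
    row, so row [t] is trusted only within distance [T - t] of the centre; in row [T] the centre
    itself, where acceptance is read, remains. *)
Lemma row_run t c : t <= T -> centre - (T - t) <= c <= centre + (T - t) ->
  row t c = (Some (if c == centre then Some (run t).1 else None),
             [ffun j => tape_cell ((run t).2 j) c]).
Proof.
elim: t c => [|t IH] c tT c_range.
  have c0 : c != 0 by apply/eqP; move: c_range; rewrite /centre; lia.
  rewrite /= /row0 (negbTE c0) /=; congr (_, _); apply/ffunP => j; rewrite !ffunE.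
  have [H1 H2] := stack_tape_init M (nth [::] [:: x; y] j).
  by rewrite /tape_cell ltnNge; case: (centre <= c); rewrite /= ?H1 // H2.
have c0 : 0 < c by move: c_range; rewrite /centre; lia.
have cW : c.+1 < width by move: c_range; rewrite /centre /width; lia.
have tT' : t <= T by lia.
have Ec := IH centre tT'; rewrite eqxx in Ec.
have {}Ec := Ec _; rewrite leq_subr leq_addr in Ec; have {}Ec := Ec isT.
have -> : run t.+1 = odflt (run t) (Defs.step (run t)) by [].
rewrite [row t.+1]iterS -/(row t) /next_row cW Ec /view_of /=.
rewrite (IH c.-1) ?(IH c) ?(IH c.+1) //; try by move: c_range; rewrite /centre; lia.
rewrite /next_cell /=.
have -> : ([ffun j => tape_cell ((run t).2 j) centre] : column) =
    [ffun i => thead ((run t).2 i)].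
  by apply/ffunP => i; rewrite !ffunE /tape_cell ltnn subnn.
rewrite /Defs.step; case: delta => [[q act]|] //.
congr (Some _, _); first by case: eqP.
apply/ffunP => j; rewrite ffunE [RHS]ffunE /odflt /oapp [in RHS]ffunE tape_cell_step //.
have W z : (if (if z == centre then Some (run t).1 else None) is Some _ then (act j).1
    else ([ffun j => tape_cell ((run t).2 j) z] : column) j) =
    (if z == centre then (act j).1 else tape_cell ((run t).2 j) z).
  by case: eqP => // _; rewrite ffunE.
by case: (act j).2; rewrite /= W.
Qed.

Lemma run_halts (c : config M) t : halts_within x y t c -> run t = c.
Proof.
move=> [s [st H1 H2]].
have Hs : forall k c', iter k (obind (@Defs.step M)) (Some (init M x y)) = Some c' -> run k = c'.
  elim=> [|k IH] c'; first by case.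
  rewrite iterS; case E : (iter k _ _) => [d|] //= Hd.
  by rewrite (IH _ E) Hd.
rewrite -(subnK st) /run iterD -/(run s) (Hs _ _ H1).
by elim: (t - s) => //= k ->; rewrite H2.
Qed.
End Rows.

Lemma width_gt0 : 0 < width. Proof. by []. Qed.

Lemma centre_lt : centre < width.
Proof. by rewrite /centre /width; lia. Qed.

Definition area : nat := width * height.

Lemma div_row t c : c < width -> (t * width + c) %/ width = t.
Proof. by move=> cW; rewrite divnMDl // divn_small ?addn0. Qed.

Lemma mod_row t c : c < width -> (t * width + c) %% width = c.
Proof. by move=> cW; rewrite modnMDl modn_small. Qed.

Hypothesis P_le : P <= T.+1.

(** * From an accepting run to a tiling *)

Section Accepting.
Variable y : seq bool.
Hypothesis y_le : size y <= P.

Definition cell_at (p : nat) : vcell := row y (p %/ width) (p %% width).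

Lemma cell_atE t c : c < width -> cell_at (t * width + c) = row y t c.
Proof. by move=> cW; rewrite /cell_at div_row ?mod_row. Qed.

Lemma cell_atS t c : c < width -> cell_at (t * width + c).+1 =
  if c.+1 < width then row y t c.+1 else sep_cell.
Proof.
move=> cW; rewrite -addnS; case: ltnP => h; first exact: cell_atE.
have -> : c.+1 = width by apply/eqP; rewrite eqn_leq cW.
by rewrite addnC -mulSn -[_ * _]addn0 cell_atE ?row_sep.
Qed.

Definition run_tiling (p : nat) : tile :=
  (view_of (row y (p %/ width) centre), (cell_at p.-1, cell_at p, cell_at p.+1)).

Lemma word_cell_out w i : size w <= i -> word_cell w i = None.
Proof. by move=> h; rewrite /word_cell nth_default // size_map. Qed.

Lemma run_tiling_ok p : p < area -> accept (run y T).1 -> tile_ok p (run_tiling p).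
Proof.
rewrite /area mulnC => pN acc; move: pN; rewrite (divn_eq p width); have := ltn_pmod p width_gt0.
move: (p %/ width) (p %% width) => t c cW pN.
have mid : tmid (run_tiling (t * width + c)) = row y t c by exact: cell_atE.
have rgt : tright_cell (run_tiling (t * width + c)) =
  if c.+1 < width then row y t c.+1 else sep_cell by exact: cell_atS.
have vw : tview (run_tiling (t * width + c)) = view_of (row y t centre).
  by rewrite /tview /= div_row.
move: (run_tiling _) mid rgt vw => u mid rgt vw.
apply/and3P; split.
- rewrite /view_ok mid vw; have := row_kind y t c.
  by case E : (row y t c).1 => [[q|]|] // <-; rewrite /view_of E.
- apply/implyP; case: t pN mid rgt {vw} => [|t] pN mid rgt; last first.
    by rewrite mulSn -addnA -[X in _ < X]addn0 ltn_add2l.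
  rewrite mul0n add0n => _; rewrite /start_ok mid /= /row0.
  case: (eqVneq c 0) => [//|c0]; rewrite eqxx /=.
  apply/forallP => j; rewrite !ffunE.
  case: (eqVneq (nat_of_ord j) 0) => [->|j0].
    by case: (centre <= c) => //=; rewrite top_isP word_cell_drop.
  have wj : nat_of_ord j != 1 -> nth [::] [:: x; y] j = [::].
    by case: (nat_of_ord j) j0 => [|[|k]] // _ _; rewrite /= nth_nil.
  case: (eqVneq (nat_of_ord j) 1) => [j1|/wj jy]; last first.
    by rewrite /= jy; case: ifP => // _; rewrite /word_cell nth_nil.
  rewrite j1 /=; case: (leqP centre c) => h //=.
  have bit i w : bit_or_blank (word_cell w i).
    by rewrite /word_cell; elim: w i => [|b w IH] [|i] //=; apply: IH.
  case: ltnP => h2 /=; last first.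
    by rewrite word_cell_out //; apply: leq_trans y_le _; lia.
  rewrite bit /=; apply/implyP => /eqP blank.
  rewrite rgt; case: ifP => _; last by rewrite ffunE.
  rewrite /= /row0 /= ffunE j1 /= (leq_trans h (leqnSn _)) subSn //.
  move: blank; rewrite /word_cell; elim: (y) (c - centre) => [|b w IH] [|i] //=.
  exact: IH.
- apply/implyP => pT; rewrite /final_ok mid; have := row_kind y t c.
  have tT : t <= T.
    by rewrite -ltnS -(ltn_pmul2r width_gt0); apply: leq_ltn_trans pN; rewrite mulnC leq_addr.
  have Tt : T <= t.
    rewrite -ltnS -(ltn_pmul2l width_gt0) mulnS; apply: leq_ltn_trans pT _.
    by rewrite mulnC addnC ltn_add2r.
  have -> : t = T by apply/eqP; rewrite eqn_leq tT.
  have := @row_run y T centre (leqnn T); rewrite subnn subn0 addn0 leqnn eqxx => E.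
  by case E' : (row y T c).1 => [[q|]|] // ce; move: E'; rewrite ce E // => -[<-].
Qed.

Lemma run_tiling_is_tiling : accept (run y T).1 ->
  is_tiling tile_out tile_in area width tile_ok run_tiling.
Proof.
move=> acc; split=> [p pN|dir p _]; first exact: run_tiling_ok.
rewrite (divn_eq p width); have := ltn_pmod p width_gt0.
move: (p %/ width) (p %% width) => t c cW.
have mid : tmid (run_tiling (t * width + c)) = row y t c by exact: cell_atE.
case: dir => /=; last first.
  rewrite /tile_out /tile_in /tmid /tright_cell /tleft_cell /tview /= addn1 /=.
  congr (_, _); rewrite /shared_view cell_atS //.
  case: ifP => // cW'; case: (row y t c.+1).1 => // _.
  by rewrite -addnS !div_row.
have E : next_cell (view_of (row y t centre)) (cell_at (t * width + c).-1) (row y t c)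
    (cell_at (t * width + c).+1) = row y t.+1 c.
  rewrite [row y t.+1]iterS -/(row y t) /next_row cell_atS //.
  case: c cW {mid} => [|c] cW; first by rewrite row_sep.
  by rewrite addnS cell_atE // ltnW.
rewrite /tile_out /tile_in mid /tleft_cell /tright_cell /tview /= div_row // E.
have -> : t * width + c + width = t.+1 * width + c by rewrite mulSn; lia.
by rewrite /tmid /= cell_atE.
Qed.
End Accepting.

(** * From a tiling to an accepting run *)

Lemma leading_bits_nth (s : seq (option (bool + aux M))) :
  all bit_or_blank s ->
  (forall i, i.+1 < size s -> nth None s i = None -> nth None s i.+1 = None) ->
  forall i, nth None s i = word_cell (leading_bits s) i.
Proof.
elim: s => [|c s IH] /=; first by move=> _ _ i; rewrite /word_cell !nth_nil.
case: c => [[b|a]|] //= s_bits H.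
  case=> [|i] //=; rewrite IH // => k ks; exact: (H k.+1).
(* The word ends at this blank, and the hypothesis propagates blanks to the end of the list. *)
case=> [|i] //=; rewrite /word_cell nth_nil.
case: (ltnP i (size s)) => i_s; last by rewrite nth_default.
by elim: i i_s => [|i IHi] i_s; [apply: (H 0) | apply: (H i.+1) => //; apply: IHi; apply: ltnW].
Qed.

Lemma size_leading_bits A (s : seq (option (bool + A))) : size (leading_bits s) <= size s.
Proof. by elim: s => [|[[b|a]|] s IH]. Qed.

(** The certificate is read off tape 1 in the first row. From there on the matching leaves no
    freedom for the middle cells, and the centre of row [T] must hold an accepting state. *)
Lemma tiling_run tau : is_tiling tile_out tile_in area width tile_ok tau ->
  exists2 y, size y <= P & accept (run y T).1.
Proof.
move=> [ok edge]; pose b p := tmid (tau p).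
have area_gt p : p < width -> p < area.
  by move=> pW; apply: leq_trans pW _; rewrite /area leq_pmulr.
have right p : p.+1 < area -> tright_cell (tau p) = b p.+1.
  by move=> pN; have := edge false p; rewrite /= addn1 => /(_ pN) [].
have left p : p.+1 < area -> tleft_cell (tau p.+1) = b p.
  by move=> pN; have := edge false p; rewrite /= addn1 => /(_ pN) [].
pose j1 : 'I_(work_tapes M).+2 := inord 1.
have j1E : j1 = 1 :> nat by rewrite /j1 inordK.
pose s := [seq (b (centre + i)).2 j1 | i <- iota 0 P].
pose y := leading_bits s.
have st p : p < width -> start_ok p (tau p).
  by move=> pW; have /and3P[_ /implyP h _] := ok p (area_gt p pW); apply: h.
have cert i : i < P -> bit_or_blank ((b (centre + i)).2 j1) &&
   (((b (centre + i)).2 j1 == None) ==> ((tright_cell (tau (centre + i))).2 j1 == None)).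
  move=> iP; have iW : centre + i < width by rewrite /centre /width; lia.
  have := st _ iW; rewrite /start_ok; case: eqP => [//|_] /andP[_ /forallP/(_ j1)].
  by rewrite j1E /= leq_addr ltn_add2l iP.
have s_size : size s = P by rewrite size_map size_iota.
have s_nth i : i < P -> nth None s i = (b (centre + i)).2 j1.
  by move=> iP; rewrite (nth_map 0) ?size_iota // nth_iota.
have y_cell : forall i, nth None s i = word_cell y i.
  apply: leading_bits_nth.
    apply/allP => c /mapP[i]; rewrite mem_iota add0n => iP ->.
    by have /andP[] := cert i iP.
  move=> i; rewrite s_size => iP; rewrite !s_nth //; last exact: ltnW.
  move=> blank; have /andP[_] := cert i (ltnW iP); rewrite blank eqxx /= right ?addnS.
    by move=> /eqP.
  by apply: area_gt; rewrite /centre /width; lia.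
have y_le : size y <= P by rewrite -s_size; apply: size_leading_bits.
have first_row c : c < width -> b c = row0 y c.
  move=> cW; have := st c cW; rewrite /start_ok /row0 -/(b c); case: (c =P 0) => [_ /eqP //|c0].
  move=> /andP[/eqP k /forallP cells]; rewrite [LHS]surjective_pairing k; congr (_, _).
  apply/ffunP => j; have := cells j; rewrite ffunE.
  case: (eqVneq (nat_of_ord j) 0) => [->|j0].
    by case: (centre <= c) => [|/eqP //]; rewrite top_isP word_cell_drop => /eqP.
  case: (eqVneq (nat_of_ord j) 1) => [e|j_1]; last first.
    have -> : nth [::] [:: x; y] j = [::].
      by case: (nat_of_ord j) j0 j_1 => [|[|k']] // _ _; rewrite /= nth_nil.
    by rewrite /= => /eqP; rewrite /word_cell nth_nil if_same.
  have ej : j = j1 by apply: val_inj; rewrite /= j1E.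
  rewrite e /= ej; case: (leqP centre c) => /= hc; last by move/eqP.
  case: (ltnP c (centre + P)) => hP /=; last by move/eqP => ->; rewrite word_cell_out //; lia.
  move=> _; rewrite -y_cell s_nth ?subnKC //; lia.
have rows t : t <= T -> forall c, c < width -> b (t * width + c) = row y t c.
  elim: t => [|t IH] tT c cW; first by rewrite mul0n first_row.
  have {}IH := IH (ltnW tT).
  have inN t' c' : t' <= T -> c' < width -> t' * width + c' < area.
    move=> h1 h2; apply: (@leq_trans (t'.+1 * width)).
      by rewrite mulSn addnC ltn_add2r.
    by rewrite mulnC leq_pmul2l.
  (* Within a row only the first cell is a separator, so the view passes from column to column;
     [view_ok] then fixes it at the centre. *)
  have views : forall c', c' < width -> tview (tau (t * width + c')) = tview (tau (t * width)).
    elim=> [|c' IHc] c'W; first by rewrite addn0.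
    rewrite -IHc ?(ltnW c'W) //.
    have hN : (t * width + c').+1 < area by rewrite -addnS inN // ltnW.
    have := edge false (t * width + c'); rewrite /= addn1 => /(_ hN).
    case=> _ _; rewrite (right _ hN) /shared_view -/(b _) -addnS (IH _ c'W).
    case E : (row y t c'.+1).1 => [k|] //; first by case=> ->.
    by case: (@row_sepE y t c'.+1).
  have vw : tview (tau (t * width)) = view_of (row y t centre).
    rewrite -(views _ centre_lt); have /and3P[+ _ _] := ok _ (inN t centre (ltnW tT) centre_lt).
    rewrite /view_ok -/(b _) IH ?centre_lt //; have := @row_kind y t centre.
    rewrite /view_of; case: (row y t centre).1 => [[q|]|] //= H; first by move/eqP.
      by case: H => _ /eqP.
  have down c' : c' < width -> next_cell (tview (tau (t * width + c')))
      (tleft_cell (tau (t * width + c'))) (b (t * width + c'))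
      (tright_cell (tau (t * width + c'))) = b (t.+1 * width + c').
    move=> c'W; have := edge true (t * width + c'); rewrite /=.
    have -> : t * width + c' + width = t.+1 * width + c' by rewrite mulSn; lia.
    by move=> /(_ (inN _ _ tT c'W)) [].
  have next0 : b (t.+1 * width) = sep_cell.
    by rewrite -[X in b X]addn0 -down // IH // row_sep.
  rewrite -down // views // vw IH // [row y t.+1]iterS -/(row y t) /next_row.
  have -> : tright_cell (tau (t * width + c)) = if c.+1 < width then row y t c.+1 else sep_cell.
    case: ltnP => h.
      have hN : (t * width + c).+1 < area by rewrite -addnS inN // ltnW.
      by rewrite right // -addnS IH.
    have ew : c.+1 = width by apply/eqP; rewrite eqn_leq cW.
    have en : (t * width + c).+1 = t.+1 * width by rewrite -addnS ew mulSn addnC.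
    have hN : (t * width + c).+1 < area by rewrite en -[X in X < _]addn0 inN.
    by rewrite right // en.
  case: c cW => [|c] cW; first by rewrite row_sep.
  have hN : (t * width + c).+1 < area by rewrite -addnS inN // ltnW.
  by rewrite addnS left // IH // ltnW.
have pN : T * width + centre < area.
  by rewrite /area mulnC /height mulnS addnC ltn_add2r centre_lt.
exists y => //; have /and3P[_ _ /implyP] := ok _ pN.
rewrite mulnC leq_addr => /(_ isT); rewrite /final_ok -/(b _) rows ?centre_lt //.
by rewrite row_run ?subnn ?subn0 ?addn0 ?leqnn // eqxx.
Qed.

Theorem tiling_iff_accepts :
  (forall y, size y <= P -> exists c : config M, halts_within x y T c) ->
  (exists tau, is_tiling tile_out tile_in area width tile_ok tau) <->
  (exists y, size y <= P /\ accepts M x y).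
Proof.
move=> halts; split=> [[tau /tiling_run[y y_le acc]]|[y [y_le [t [c [ct acc]]]]]].
  exists y; split=> //; have [c Hc] := halts y y_le.
  by exists T, c; split=> //; rewrite -(run_halts Hc).
have [d Hd] := halts y y_le; exists (run_tiling y); apply: run_tiling_is_tiling => //.
by rewrite (run_halts Hd) -(halts_within_uniq ct Hd).
Qed.

End Tableau.

(** * Instances as lists *)

Lemma image_nth (T : Type) (d : T) (s : seq T) n : size s = n ->
  [seq nth d s i | i : 'I_n] = s.
Proof.
move=> <-; rewrite /image_mem (map_comp (nth d s) val) val_enum_ord.
by rewrite -/(mkseq _ _) mkseq_nth.
Qed.

Lemma nth_image (T : Type) (d : T) n (F : 'I_n -> T) (i : 'I_n) :
  nth d [seq F j | j : 'I_n] i = F i.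
Proof. by rewrite (nth_map i) ?nth_ord_enum // size_enum_ord. Qed.

Lemma size_image_ord (T : Type) n (F : 'I_n -> T) : size [seq F i | i : 'I_n] = n.
Proof. by rewrite size_map size_enum_ord. Qed.

Lemma image_const (T : Type) (c : T) n : [seq c | _ : 'I_n] = nseq n c.
Proof. by rewrite /image_mem -[in RHS](size_enum_ord n); elim: (enum _) => //= i s ->. Qed.

Lemma enc_seq_map (S T : Type) (e : T -> seq bool) (f : S -> T) s :
  enc_seq e [seq f x | x <- s] = enc_seq (e \o f) s.
Proof. by rewrite /enc_seq; elim: s => //= x s ->. Qed.

Lemma enc_domsE n (D : 'I_n -> seq int) : enc_doms D = enc_dom_list [seq D i | i : 'I_n].
Proof. by []. Qed.

Lemma enc_tuple_domsE n h (D : 'I_n -> 'I_h -> seq int) :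
  enc_tuple_doms D = enc_dom_table [seq [seq D i k | k : 'I_h] | i : 'I_n].
Proof. by rewrite /enc_dom_table enc_seq_map /enc_tuple_doms enc_seq_map. Qed.

Lemma chosen_map (I : Type) (d : I -> int) (D : I -> seq int) (s : seq I) :
  (forall i, d i \in D i) -> chosen [seq d i | i <- s] [seq D i | i <- s].
Proof. by move=> H; rewrite /chosen; elim: s => //= i s ->; rewrite H. Qed.

Lemma chosen_nth u Us i : chosen u Us -> i < size Us -> nth 0%R u i \in nth [::] Us i.
Proof. by rewrite /chosen; elim: Us u i => [|D Us IH] [|x u] [|i] //= /andP[? /IH]; [|apply]. Qed.

Definition positions n : seq int := [seq Posz k | k <- iota 1 n].

Lemma mem_positions n k : k < n -> (Posz k.+1 \in positions n).
Proof. by move=> kn; apply: map_f; rewrite mem_iota add1n ltnS. Qed.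

Lemma positions_domain n : position_domain n (positions n).
Proof. by move=> v /mapP[k]; rewrite mem_iota => kn ->; lia. Qed.

(** * One exactly-one system as an instance of each of the three problems *)

Section Hardness.
Variables (Q : Prop) (Us Vs : seq (seq int)).
Let U := [:: 0%R] :: Us.
Let V := [:: 0%R] :: Vs.
Hypothesis sound : Q -> exists u v,
  [/\ chosen u U, chosen v V, perm_eq u v, sorted <=%R v & uniq v].
Hypothesis complete : sort_solvable U V -> Q.

(** The query is the minimum of the first variable of [V], whose domain contains only 0: it is
    supported as soon as the system has any solution. *)
Definition UV_code : seq bool :=
  enc_dom_list U ++ enc_dom_list V ++ (true :: enc_nat 0) ++ [:: false].

Definition UVP_code : seq bool :=
  enc_dom_list U ++ enc_dom_list V ++
  enc_dom_list (nseq (size V) (positions (size V))) ++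
  ([:: false; true] ++ enc_nat 0) ++ [:: false].

(** Tuples of length one, sorted on their only component, with unrestricted positions. *)
Definition key_code : seq bool :=
  enc_nat 1 ++ enc_dom_table [seq [:: D] | D <- U] ++ enc_dom_table [seq [:: D] | D <- V] ++
  enc_dom_list (nseq (size V) (positions (size V))) ++
  ([:: false; true] ++ enc_nat 0 ++ enc_nat 0) ++ [:: false].

(** Distinct values turn [index] into the permutation and leave no equal keys for stability to
    compare. *)
Lemma solution : Q -> exists u v,
  [/\ [/\ chosen u U, chosen v V, size U = (size Vs).+1, size u = (size Vs).+1 &
       size v = (size Vs).+1],
      v = sort <=%R u, nth 0%R v 0 = 0%R, uniq u & perm_eq u v].
Proof.
move=> /sound[u [v [uU vV uv v_sorted v_uniq]]]; exists u, v.
have sv : size v = (size Vs).+1 by rewrite (chosen_size vV).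
have su : size u = (size Vs).+1 by rewrite (perm_size uv).
split=> //; first by split; rewrite -?(chosen_size uU).
- apply/esym; rewrite -[RHS](sorted_sort le_trans v_sorted).
  by apply/perm_sortP => //; [apply: le_total|apply: le_trans|apply: le_anti].
- by have := chosen_nth vV (ltn0Sn _); rewrite inE => /eqP.
- by rewrite (perm_uniq uv).
Qed.

Lemma chosen_neq0 u Ds : chosen u Ds -> forall i, i < size Ds -> nth [::] Ds i <> [::].
Proof. by move=> uD i iD E; have := chosen_nth uD iD; rewrite E. Qed.

Lemma solvable_of n (u v : 'I_n -> int) (DU DV : 'I_n -> seq int) :
  [seq DU i | i : 'I_n] = U -> [seq DV i | i : 'I_n] = V ->
  (forall i, u i \in DU i) -> (forall i, v i \in DV i) ->
  perm_eq [seq u i | i : 'I_n] [seq v i | i : 'I_n] ->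
  sorted <=%R [seq v i | i : 'I_n] -> Q.
Proof.
move=> EU EV uU vV uv v_sorted; apply: complete.
exists [seq u i | i : 'I_n], [seq v i | i : 'I_n]; split=> //.
  by rewrite -EU; apply: chosen_map.
by rewrite -EV; apply: chosen_map.
Qed.

Lemma hard_UV : Q <-> sort_UV_bounds_D UV_code.
Proof.
split=> [/solution[u [v [[uU vV sU su sv] vE v0 _ _]]]|].
  pose n := (size Vs).+1.
  pose D (w : sort_var n) := match w with inl i => nth [::] U i | inr i => nth [::] V i end.
  pose d (w : sort_var n) := match w with inl i => nth 0%R u i | inr i => nth 0%R v i end.
  exists n, D, (inr ord0), Min; split.
  - by rewrite /enc_sort_UV !enc_domsE !image_nth.
  - by move=> [i|i]; [apply: (chosen_neq0 uU); rewrite sU | apply: (chosen_neq0 vV)].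
  exists d; split; last by rewrite /= v0; split=> // z; rewrite inE => /eqP ->.
  split; first by move=> [i|i]; [apply: chosen_nth; rewrite ?sU | apply: chosen_nth].
  by rewrite /sort_UV /d !image_nth.
case=> n [D [w [b [E _ [d [[dD dC] _]]]]]].
move: E; rewrite /UV_code /enc_sort_UV !enc_domsE.
move=> /prefix_free_dom_list[EU /prefix_free_dom_list[EV _]].
apply: (solvable_of (u := fun i => d (inl i)) (v := fun i => d (inr i)) (esym EU) (esym EV)) => //.
- by rewrite dC perm_sym perm_sort.
- by rewrite dC sort_sorted //; apply: le_total.
Qed.

Lemma hard_UVP : Q <-> sort_UVP_bounds_D UVP_code.
Proof.
split=> [/solution[u [v [[uU vV sU su sv] vE v0 u_uniq uv]]]|].
  pose n := (size Vs).+1.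
  pose D (w : sortP_var n) := match w with
    PU i => nth [::] U i | PV i => nth [::] V i | PP i => positions n end.
  pose d (w : sortP_var n) := match w with
    PU i => nth 0%R u i | PV i => nth 0%R v i
  | PP i => Posz (index (nth 0%R u i) v).+1 end.
  have idx (i : 'I_n) : index (nth 0%R u i) v < n.
    have : nth 0%R u i \in v by rewrite -(perm_mem uv) mem_nth ?su.
    by rewrite -index_mem sv.
  exists n, D, (PV ord0), Min; split.
  - by rewrite /enc_sort_UVP !enc_domsE !image_nth // image_const.
  - move=> [i|i|i]; [apply: (chosen_neq0 uU); rewrite ?sU // | exact: (chosen_neq0 vV) |].
    by [].
  - by move=> i; apply: positions_domain.
  exists d; split; last by rewrite /= v0; split=> // z; rewrite inE => /eqP ->.
  split.
    move=> [i|i|i]; [apply: chosen_nth; rewrite ?sU // | exact: chosen_nth |].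
    exact: mem_positions.
  split; first by rewrite /d !image_nth.
  - move=> i j [] /(congr1 (nth 0%R v)); rewrite !nth_index -?(perm_mem uv) ?mem_nth ?su //.
    by move=> /eqP; rewrite nth_uniq ?su // => /eqP /val_inj.
  - move=> i; exists (Ordinal (idx i)); split=> //=.
    by rewrite nth_index // -(perm_mem uv) mem_nth ?su.
case=> n [D [w [b [E _ _ [d [[dD [dC _ _]] _]]]]]].
move: E; rewrite /UVP_code /enc_sort_UVP !enc_domsE.
move=> /prefix_free_dom_list[EU /prefix_free_dom_list[EV _]].
apply: (solvable_of (u := fun i => d (PU i)) (v := fun i => d (PV i)) (esym EU) (esym EV)) => //.
- by rewrite dC perm_sym perm_sort.
- by rewrite dC sort_sorted //; apply: le_total.
Qed.

Lemma sort_key1 (f : 'I_1 -> int) : sort_key 1 f = [:: f ord0].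
Proof. by rewrite /sort_key /image_mem enum_ordSl /= take0. Qed.

Lemma perm_eq_inj n (v : 'I_n -> int) (f : 'I_n -> 'I_n) : injective f ->
  perm_eq [seq v (f i) | i : 'I_n] [seq v i | i : 'I_n].
Proof.
move=> f_inj; rewrite /image_mem (map_comp v f); apply: perm_map.
apply: uniq_perm; [rewrite map_inj_uniq //; exact: enum_uniq | exact: enum_uniq | move=> i].
by rewrite mem_enum inE; apply: injF_onto.
Qed.

Lemma hard_key : Q <-> keysorting_bounds_D key_code.
Proof.
split=> [/solution[u [v [[uU vV sU su sv] vE v0 u_uniq uv]]]|].
  pose n := (size Vs).+1.
  pose D (w : keysort_var n 1) := match w with
    KU i _ => nth [::] U i | KV i _ => nth [::] V i | KP i => positions n end.
  pose d (w : keysort_var n 1) := match w with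
    KU i _ => nth 0%R u i | KV i _ => nth 0%R v i
  | KP i => Posz (index (nth 0%R u i) v).+1 end.
  have idx (i : 'I_n) : index (nth 0%R u i) v < n.
    have : nth 0%R u i \in v by rewrite -(perm_mem uv) mem_nth ?su.
    by rewrite -index_mem sv.
  have tab (W : seq (seq int)) : size W = n ->
      [seq [seq nth [::] W i | _ : 'I_1] | i : 'I_n] = [seq [:: D] | D <- W].
    move=> <-; rewrite -[in RHS](image_nth [::] (erefl (size W))) /image_mem -map_comp.
    by apply: eq_map => i; rewrite /image_mem enum_ordSl (size0nil (size_enum_ord 0)).
  exists n, 1, 1, D, (KV ord0 ord0), Min; split.
  - by rewrite /enc_keysorting !enc_tuple_domsE !enc_domsE !tab // image_const.
  - by [].
  - move=> [i k|i k|i]; [apply: (chosen_neq0 uU); rewrite ?sU // | exact: (chosen_neq0 vV) |].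
    by [].
  - by move=> i; apply: positions_domain.
  exists d; split; last by rewrite /= v0; split=> // z; rewrite inE => /eqP ->.
  split.
    move=> [i k|i k|i]; [apply: chosen_nth; rewrite ?sU // | exact: chosen_nth |].
    exact: mem_positions.
  have v_sorted : sorted <=%R v by rewrite vE sort_sorted //; apply: le_total.
  split.
  - move=> i j ij; rewrite !sort_key1 /=.
    have le_ij : (nth 0 v i <= nth 0 v j)%R.
      by apply: (sorted_leq_nth le_trans le_refl) => //; rewrite inE sv.
    by rewrite lexi_cons le_ij /=; apply/implyP.
  - move=> i j [] /(congr1 (nth 0%R v)); rewrite !nth_index -?(perm_mem uv) ?mem_nth ?su //.
    by move=> /eqP; rewrite nth_uniq ?su // => /eqP /val_inj.
  - move=> i; exists (Ordinal (idx i)); split=> //= _.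
    by rewrite nth_index // -(perm_mem uv) mem_nth ?su.
  - move=> i j ij; rewrite !sort_key1 /= => -[] /eqP; rewrite nth_uniq ?su // => /eqP ij'.
    by rewrite ij' ltnn in ij.
case=> n [h [keys [D [w [b [E _ _ _ [d [[dD [d1 d2 d3 _]] _]]]]]]]].
move: E; rewrite /key_code /enc_keysorting !enc_tuple_domsE !enc_domsE.
move=> /prefix_free_nat[ek /prefix_free_dom_table[EU /prefix_free_dom_table[EV _]]].
have n_gt0 : 0 < n by have := congr1 size EU; rewrite size_image_ord size_map => <-.
(* The code has no separate field for [h], which is read off the first tuple; there is one because
   of the added domain. *)
have h1 : h = 1.
  have := congr1 (fun t => size (nth [::] t 0)) EU.
  by rewrite (nth_image _ _ (Ordinal n_gt0)) size_image_ord.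
move: D w b d dD d1 d2 d3 EU EV; rewrite {}h1 -{}ek => D w b d dD d1 d2 d3 EU EV.
have untab (W : seq (seq int)) (F : 'I_n -> 'I_1 -> seq int) :
    [seq [:: D] | D <- W] = [seq [seq F i k | k : 'I_1] | i : 'I_n] ->
    [seq F i ord0 | i : 'I_n] = W.
  move=> EW; have -> : W = map (head [::]) [seq [:: D'] | D' <- W].
    by elim: (W) => //= D' W' <-.
  rewrite EW /image_mem -map_comp; apply: eq_map => i /=.
  by rewrite /image_mem enum_ordSl.
(* This constraint relates the values of [U] and [V] only through [P]; injectivity makes [f] a
   permutation. *)
have [f Hf] := fin_all_exists d3.
have f_inj : injective f.
  by move=> i j fij; apply: d2; have [-> _] := Hf i; have [-> _] := Hf j; rewrite fij.
apply: (solvable_of (u := fun i => d (KU i ord0)) (v := fun i => d (KV i ord0))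
  (untab _ _ EU) (untab _ _ EV)) => //.
  rewrite (_ : [seq d (KU i ord0) | i : 'I_n] = [seq d (KV (f i) ord0) | i : 'I_n]).
    exact: (perm_eq_inj (fun i => d (KV i ord0))).
  by rewrite /image_mem; apply: eq_map => i; have [_ ->] := Hf i.
rewrite sorted_pairwise; last exact: le_trans.
apply/(pairwiseP 0%R) => i j; rewrite !inE !size_image_ord => iN jN ij.
have /= := nth_image 0%R (fun i => d (KV i ord0)).
move=> N; rewrite (N (Ordinal iN)) (N (Ordinal jN)).
have := d1 (Ordinal iN) (Ordinal jN) (ltnW ij); rewrite !sort_key1.
by rewrite lexi_cons => /andP[].
Qed.
End Hardness.

(** * The reduction is computable in polynomial time *)

(** Tiles, colours and edge marks belong to a fixed machine, so their unary ranks are bounded by a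
    constant. *)
Definition Enc_fin (T : finType) : Enc T := fun t => enc (rk t).
Arguments Enc_fin T _ : clear implicits.

Lemma PT_rk (T : finType) E {eE : Enc E} (f : E -> T) :
  PT (eB := Enc_fin T) f -> PT (fun e => rk (f e)).
Proof. exact: (PT_cast (h := id)). Qed.

Lemma rk_inj (T : finType) : injective (@rk T).
Proof.
move=> x y xy; have := nth_index x (mem_enum T x); rewrite -/(rk x) xy.
by rewrite nth_index // mem_enum.
Qed.

Lemma PT_eq_fin (T : finType) E {eE : Enc E} (f g : E -> T) :
  PT (eB := Enc_fin T) f -> PT (eB := Enc_fin T) g -> PT (fun e => f e == g e).
Proof.
move=> Hf Hg; apply: PT_ext (PT_eqn (PT_rk Hf) (PT_rk Hg)) => e.
exact: (inj_eq (@rk_inj T)).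
Qed.

Lemma PT_all_const E {eE : Enc E} C (F : E -> C -> bool) (cs : seq C) :
  (forall c, PT (fun e => F e c)) -> PT (fun e => all (F e) cs).
Proof. by move=> HF; elim: cs => [|c cs IH] /=; [apply: PT_const|apply: PT_andb]. Qed.

Lemma PT_forall_const E {eE : Enc E} (C : finType) (F : E -> C -> bool) :
  (forall c, PT (fun e => F e c)) -> PT (fun e => [forall c, F e c]).
Proof.
move=> HF; apply: PT_ext (PT_all_const (enum C) HF) => e.
by apply/allP/forallP => [H c|H c _]; [apply: H; rewrite mem_enum|apply: H].
Qed.

Lemma PT_if_const E {eE : Enc E} A {eA : Enc A} (b : bool) (f g : E -> A) :
  PT f -> PT g -> PT (fun e => if b then f e else g e).
Proof. by case: b. Qed.

Section Slots.
Variables (Tile C : finType) (col_out col_in : bool -> Tile -> C).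

Definition mark : finType := (bool + bool * C)%type.

#[local] Instance Enc_tile : Enc Tile := Enc_fin Tile.
#[local] Instance Enc_mark : Enc mark := Enc_fin mark.
#[local] Instance Enc_slot : Enc (slot Tile C) :=
  (_ : Enc ((nat * Tile) * nat * (nat * mark))).

Lemma PT_shift E {eE : Enc E} (w : E -> nat) dir : PT w -> PT (fun e => shift (w e) dir).
Proof. by move=> Hw; case: dir; rewrite /shift /=; pt. Qed.

Ltac pt_more ::= first [ pt_int | match goal with
  | |- PT (fun e => shift (@?w e) ?d) => apply (PT_shift d (w := w))
  end ].

Section Compute.
Context (E : Type) {eE : Enc E}.
Variables (N W : E -> nat) (allowed : E -> nat -> pred Tile).
Hypotheses (HN : PT N) (HW : PT W).
Hypothesis Hallowed : forall t, PT (fun q : E * nat => allowed q.1 q.2 t).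

Lemma PT_slots_of t : PT (B := seq (nat * (nat * mark)))
  (fun q : E * nat => slots_of col_out col_in (N q.1) (W q.1) q.2 t).
Proof.
rewrite /slots_of; apply: PT_cons; first by pt.
apply: PT_cat; last by pt.
apply: (PT_flatten_const (F := fun (q : E * nat) dc =>
  edge_slots col_out col_in (N q.1) (W q.1) q.2 t dc)) => -[dir [c|]];
  by rewrite /edge_slots /=; pt.
Qed.

Lemma PT_slots : PT (fun e => slots col_out col_in (N e) (W e) (allowed e)).
Proof.
apply: PT_flatten; apply: (PT_map (f := fun e p =>
  pos_slots col_out col_in (N e) (W e) (allowed e) p)); last by pt.
apply: (PT_flatten_const (F := fun (q : E * nat) t => if allowed q.1 q.2 t then
  tile_slots col_out col_in (N q.1) (W q.1) q.2 t else [::])) => t.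
apply: PT_if => //; last exact: PT_const.
apply: (PT_map (f := fun (q : E * nat) (a : nat * (nat * mark)) => ((q.2, t), a.1, a.2))).
  by pt.
exact: PT_slots_of.
Qed.

Lemma PT_keys : PT (B := seq (nat * mark)) (fun e => keys C (N e) (W e)).
Proof.
apply: PT_flatten; apply: (PT_map (Y := seq (nat * mark))
  (f := fun e p => pos_keys C (N e) (W e) p)); last by pt.
do 2 (apply: PT_cons; first by pt).
by apply: (PT_flatten_const (F := fun (q : E * nat) dc =>
  if q.2 + shift (W q.1) dc.1 < N q.1 then [:: (q.2, inr dc)] else [::])) => dc; pt.
Qed.
End Compute.

Lemma PT_low F {eF : Enc F} (x : F -> slot Tile C) : PT x -> PT (fun e => low (x e)).
Proof.
apply: PT_comp; apply: PT_addn; last by pt.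
apply: PT_muln; last exact: PT_const.
by apply: PT_addn; [pt|apply: PT_rk; pt].
Qed.

Lemma PT_high F {eF : Enc F} (x : F -> slot Tile C) : PT x -> PT (fun e => high (x e)).
Proof. by move=> /PT_low Hx; rewrite /high; pt. Qed.

Ltac pt_more ::= first [ pt_int | match goal with
  | |- PT (fun e => low (@?x e)) => apply (PT_low (x := x))
  | |- PT (fun e => high (@?x e)) => apply (PT_high (x := x))
  end ].

Lemma PT_group_doms F {eF : Enc F} (s : F -> seq (slot Tile C)) : PT s ->
  PT (fun e => group_doms (@low Tile C) (@high Tile C) (s e)).
Proof.
move=> Hs; apply: PT_cons; first by pt.
apply: (PT_ext (f := fun e => nseq (size (s e) - 1) [seq Posz (low x).+1 | x <- s e])).
  by move=> e; rewrite subn1.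
by pt.
Qed.

Lemma PT_U_tail F {eF : Enc F} (s : F -> seq (slot Tile C)) (ks : F -> seq (nat * mark)) :
  PT s -> PT ks ->
  PT (fun e => flatten [seq group_doms (@low Tile C) (@high Tile C)
                         (group (s e) (@skey Tile C) g) | g <- ks e]).
Proof.
move=> Hs Hk; apply: PT_flatten; apply: (PT_map (f := fun e (g : nat * mark) =>
  group_doms (@low Tile C) (@high Tile C) (group (s e) (@skey Tile C) g))) => //.
apply: PT_group_doms.
apply: (PT_filter (f := fun (q : F * (nat * mark)) (x : slot Tile C) => skey x == q.2));
  last by pt.
apply: (PT_ext (f := fun (q : F * (nat * mark) * slot Tile C) =>
  (q.2.2.1 == q.1.2.1) && (q.2.2.2 == q.1.2.2 :> mark))); first by [].
by apply: PT_andb; [apply: PT_eqn|apply: PT_eq_fin]; pt_proj.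
Qed.

Lemma PT_V_tail F {eF : Enc F} (s : F -> seq (slot Tile C)) : PT s ->
  PT (fun e => [seq [:: Posz (low x).+1; Posz (high x).+1] | x <- s e]).
Proof. by move=> Hs; pt. Qed.
End Slots.

Section Hard.
Variable M : tm.

Section TileOk.
Variables (P T : seq bool -> nat).
Hypotheses (HP : PT P) (HT : PT T).

Lemma PT_top_is E {eE : Enc E} (c : option (bool + aux M)) (s : E -> seq bool) :
  PT s -> PT (fun e => top_is c (s e)).
Proof.
move=> Hs; case: c => [[d|a]|] /=; [|exact: PT_const|exact: PT_nilp].
apply: (PT_case (g := fun _ e' _ => d == e')) => //; first exact: PT_const.
by apply: PT_eqb; [apply: PT_const|pt_proj].
Qed.

Lemma PT_start_ok (u : tile M) :
  PT (fun r : seq bool * nat => start_ok r.1 (P r.1) (T r.1) r.2 u).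
Proof.
apply: PT_if; [by pt|exact: PT_const|apply: PT_andb].
  apply: (PT_ext (f := fun r : seq bool * nat => if r.2 == centre (T r.1)
    then (tmid u).1 == Some (Some (start M)) else (tmid u).1 == Some None)).
    by move=> r; case: (r.2 == _).
  by rewrite /centre; pt.
apply: (PT_forall_const (F := fun (r : seq bool * nat) j => if nat_of_ord j == 0 then
       if centre (T r.1) <= r.2 then top_is ((tmid u).2 j) (drop (r.2 - centre (T r.1)) r.1)
       else (tmid u).2 j == None
     else if (nat_of_ord j == 1) && (centre (T r.1) <= r.2 < centre (T r.1) + P r.1) then
       bit_or_blank ((tmid u).2 j) &&
       (((tmid u).2 j == None) ==> ((tright_cell u).2 j == None))
     else (tmid u).2 j == None)) => j.
rewrite /centre; apply: PT_if_const; last by pt.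
by apply: PT_if; [|apply: PT_top_is|]; pt.
Qed.

Lemma PT_width : PT (fun x => width (T x)).
Proof. by rewrite /width; pt. Qed.

Lemma PT_tile_ok (u : tile M) :
  PT (fun r : seq bool * nat => tile_ok r.1 (P r.1) (T r.1) r.2 u).
Proof.
apply: PT_andb; first exact: PT_const.
by apply: PT_andb; apply: PT_implb; rewrite /width; [|exact: PT_start_ok| |]; pt.
Qed.

Definition tableau_slots (x : seq bool) : seq (slot (tile M) (colour M)) :=
  slots (@tile_out M) (@tile_in M) (area (T x)) (width (T x)) (tile_ok x (P x) (T x)).

Definition tableau_keys (x : seq bool) : seq (slot_key (colour M)) :=
  keys (colour M) (area (T x)) (width (T x)).

Definition tableau_U (x : seq bool) : seq (seq int) :=
  flatten [seq group_doms (@low _ _) (@high _ _)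
            (group (tableau_slots x) (@skey _ _) g) | g <- tableau_keys x].

Definition tableau_V (x : seq bool) : seq (seq int) :=
  [seq [:: Posz (low s).+1; Posz (high s).+1] | s <- tableau_slots x].

Lemma PT_area : PT (fun x => area (T x)).
Proof. by rewrite /area /width /height; pt. Qed.

Lemma PT_tableau_slots : PT (eB := Enc_seq (eA := Enc_slot (Tile := tile M) (C := colour M)))
  tableau_slots.
Proof.
have H := @PT_slots (tile M) (colour M) (@tile_out M) (@tile_in M) _ _ _ _
  (fun x => tile_ok x (P x) (T x)) PT_area PT_width PT_tile_ok.
exact H.
Qed.

Lemma PT_tableau_U : PT tableau_U.
Proof.
apply: PT_U_tail; first exact: PT_tableau_slots.
exact (PT_keys (colour M) PT_area PT_width).
Qed.

Lemma PT_tableau_V : PT tableau_V.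
Proof. apply: PT_V_tail; exact: PT_tableau_slots. Qed.
End TileOk.
End Hard.

Lemma PT_positions E {eE : Enc E} (n : E -> nat) : PT n -> PT (fun e => positions (n e)).
Proof. by move=> Hn; rewrite /positions; pt. Qed.

Section Codes.
Context (E : Type) {eE : Enc E} (Us Vs : E -> seq (seq int)).
Hypotheses (HU : PT Us) (HV : PT Vs).

Lemma PT_P_doms : PT (fun e => nseq (size ([:: 0%R] :: Vs e))
                             (positions (size ([:: 0%R] :: Vs e)))).
Proof. by apply: PT_nseq; [|apply: PT_positions]; pt. Qed.

Lemma PT_UV_code : PT (fun e => UV_code (Us e) (Vs e)).
Proof. by rewrite /UV_code; pt. Qed.

Lemma PT_UVP_code : PT (fun e => UVP_code (Us e) (Vs e)).
Proof. by have HP := PT_P_doms; rewrite /UVP_code; pt. Qed.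

Lemma PT_key_code : PT (fun e => key_code (Us e) (Vs e)).
Proof. by have HP := PT_P_doms; rewrite /key_code; pt. Qed.
End Codes.

(* The three reductions differ only in the final encoding. *)
Lemma NP_hard_of_code (L : language) (cd : seq (seq int) -> seq (seq int) -> seq bool) :
  (forall Us Vs, PT Us -> PT Vs -> PT (fun x : seq bool => cd (Us x) (Vs x))) ->
  (forall Q Us Vs,
     (Q -> exists u v, [/\ chosen u ([:: 0%R] :: Us), chosen v ([:: 0%R] :: Vs),
        perm_eq u v, sorted <=%R v & uniq v]) ->
     (sort_solvable ([:: 0%R] :: Us) ([:: 0%R] :: Vs) -> Q) -> Q <-> L (cd Us Vs)) ->
  NP_hard L.
Proof.
move=> Hcd HL L' [M [p [q [halts L'E]]]].
pose P (x : seq bool) := ev p (size x).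
(* Adding [P x] makes the certificate fit into the columns from the centre on. *)
pose T (x : seq bool) := ev q (size x + P x) + P x.
have HP : PT P by apply: PT_horner; apply: PT_size_seq PT_id.
have HT : PT T by apply: PT_addn => //; apply: PT_horner; pt.
exists (fun x => cd (tableau_U M P T x) (tableau_V M P T x)); split.
  by apply: PT_poly_time; apply: Hcd; [apply: PT_tableau_U|apply: PT_tableau_V].
move=> x.
have t0 : tile M.
  pose v : vcell M := sep_cell M; exact: ((start M, v.2), (v, v, v)).
have [H1 H2] := @tiling_iff_sortable (tile M) (colour M) (@tile_out M) (@tile_in M)
  (area (T x)) (width (T x)) (tile_ok x (P x) (T x)) t0 isT.
rewrite L'E -(HL (exists tau, is_tiling (@tile_out M) (@tile_in M) (area (T x)) (width (T x))
  (tile_ok x (P x) (T x)) tau)); first last.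
- exact: H2.
- by move=> [tau /H1].
apply: iff_sym; apply: tiling_iff_accepts.
  by rewrite /T leqW ?leq_addl.
move=> y y_le; have [c Hc] := halts x y; exists c.
apply: halts_within_le Hc; apply: leq_trans (leq_addr _ _).
by apply: ev_mono; rewrite leq_add2l.
Qed.

Lemma sort_UV_hard : NP_hard sort_UV_bounds_D.
Proof.
by apply: (NP_hard_of_code (cd := UV_code)) => *; [apply: PT_UV_code|apply: hard_UV].
Qed.

Lemma sort_UVP_hard : NP_hard sort_UVP_bounds_D.
Proof.
by apply: (NP_hard_of_code (cd := UVP_code)) => *; [apply: PT_UVP_code|apply: hard_UVP].
Qed.

Lemma keysorting_hard : NP_hard keysorting_bounds_D.
Proof.
by apply: (NP_hard_of_code (cd := key_code)) => *; [apply: PT_key_code|apply: hard_key].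
Qed.

(** * Verifying certificates *)

Lemma PT_mem E {eE : Enc E} (f : E -> int) (s : E -> seq int) : PT f -> PT s ->
  PT (fun e => f e \in s e).
Proof.
move=> Hf Hs; have H : PT (fun e => has (fun z => z == f e) (s e)) by pt.
by apply: PT_ext H => e; rewrite -has_pred1; apply: eq_has => z.
Qed.

Lemma PT_chosen E {eE : Enc E} (u : E -> seq int) (Us : E -> seq (seq int)) :
  PT u -> PT Us -> PT (fun e => chosen (u e) (Us e)).
Proof.
move=> Hu HU.
have H : PT (fun e => (size (u e) == size (Us e)) && all (fun p => p.1 \in p.2) (zip (u e) (Us e))).
  by apply: PT_andb; [|apply: PT_all; [apply: PT_mem|]]; pt.
by apply: PT_ext H => e; rewrite /chosen all2E; congr (_ && _); apply: eq_all => -[].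
Qed.

Definition table_chosen (u : seq (seq int)) (Us : seq (seq (seq int))) : bool :=
  (size u == size Us) && all (fun p => chosen p.1 p.2) (zip u Us).

Lemma table_chosen_nth u Us i : table_chosen u Us -> i < size Us ->
  chosen (nth [::] u i) (nth [::] Us i).
Proof.
move=> /andP[/eqP su /allP H] iU.
have := H (nth [::] u i, nth [::] Us i); apply.
by rewrite -nth_zip // mem_nth // size_zip su minnn.
Qed.

Lemma PT_table_chosen E {eE : Enc E} (u : E -> seq (seq int)) (Us : E -> seq (seq (seq int))) :
  PT u -> PT Us -> PT (fun e => table_chosen (u e) (Us e)).
Proof.
by move=> Hu HU; apply: PT_andb; [|apply: PT_all; [apply: PT_chosen|]]; pt.
Qed.

Definition pairs (n : nat) (r : nat -> nat -> bool) : bool :=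
  all (fun i => all (r i) (iota 0 n)) (iota 0 n).

Lemma pairsP n (r : nat -> nat -> bool) : reflect (forall i j, i < n -> j < n -> r i j) (pairs n r).
Proof.
apply: (iffP allP) => [H i j iN jN|H i].
  by move: (H i); rewrite mem_iota => /(_ iN)/allP; apply; rewrite mem_iota.
rewrite mem_iota => iN; apply/allP => j; rewrite mem_iota => jN; exact: H.
Qed.

Lemma PT_pairs E {eE : Enc E} (n : E -> nat) (r : E -> nat -> nat -> bool) : PT n ->
  PT (fun q : E * nat * nat => r q.1.1 q.1.2 q.2) -> PT (fun e => pairs (n e) (r e)).
Proof.
move=> Hn Hr; apply: (PT_all (f := fun e i => all (r e i) (iota 0 (n e)))); last by pt.
by apply: (PT_all (f := fun (q : E * nat) j => r q.1 q.2 j)); pt.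
Qed.

Lemma PT_count_mem E {eE : Enc E} (z : E -> int) (s : E -> seq int) : PT z -> PT s ->
  PT (fun e => count_mem (z e) (s e)).
Proof. by move=> Hz Hs; apply: (PT_count (f := fun e y => y == z e)); pt. Qed.

Lemma PT_perm_eq E {eE : Enc E} (s t : E -> seq int) : PT s -> PT t ->
  PT (fun e => perm_eq (s e) (t e)).
Proof.
move=> Hs Ht.
apply: (PT_all (f := fun e z => count_mem z (s e) == count_mem z (t e))); last by pt.
by apply: PT_eqn; apply: PT_count_mem; pt.
Qed.

(** The first difference decides; the final [true] makes the order weak. Truncation by [zip] is
    harmless for keys, which have equal length. *)
Definition lex_le (s t : seq int) : bool :=
  foldr (fun (p : int * int) b => if p.1 == p.2 then b else (p.1 <= p.2)%R) true (zip s t).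

Lemma lex_leE (s t : seq int) : size s = size t ->
  lex_le s t = ((s : seqlexi int) <= t)%O.
Proof.
elim: s t => [|x s IH] [|y t] //= [st]; rewrite lexi_cons -IH // /lex_le /=.
by case: (ltgtP x y).
Qed.

Lemma PT_lex_le E {eE : Enc E} (s t : E -> seq int) : PT s -> PT t ->
  PT (fun e => lex_le (s e) (t e)).
Proof.
by move=> Hs Ht; apply: (PT_foldr_bool (f := fun _ (p : int * int) b =>
  if p.1 == p.2 then b else (p.1 <= p.2)%R) (i := fun=> true)); pt.
Qed.

Definition extremal (mx : bool) (D : seq int) (v : int) : bool :=
  all (fun u => if mx then (u <= v)%R else (v <= u)%R) D.

Lemma extremalP b D v : v \in D ->
  reflect (is_bound b D v) (extremal (if b is Max then true else false) D v).
Proof.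
move=> vD; apply: (iffP allP) => [H|[_ H] u uD]; last by case: b H => /(_ u uD).
by split=> // u uD; case: b H => /(_ u uD).
Qed.

Lemma PT_extremal E {eE : Enc E} (m : E -> bool) (D : E -> seq int) (v : E -> int) :
  PT m -> PT D -> PT v -> PT (fun e => extremal (m e) (D e) (v e)).
Proof.
move=> Hm HD Hv.
by apply: (PT_all (f := fun e u => if m e then (u <= v e)%R else (v e <= u)%R)); pt.
Qed.

Definition sorted_check (s : seq int) : bool :=
  pairs (size s) (fun i j => (i <= j) ==> (nth 0 s i <= nth 0 s j)%R).

Lemma sorted_checkE s : sorted_check s = sorted <=%R s.
Proof.
apply/pairsP/idP => [H|s_sorted i j si sj].
  rewrite sorted_pairwise; last exact: le_trans.
  by apply/(pairwiseP 0%R) => i j; rewrite !inE => si sj ij; have := H i j si sj; rewrite ltnW.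
by apply/implyP => ij; apply: (sorted_leq_nth le_trans le_refl).
Qed.

Lemma PT_sorted_check E {eE : Enc E} (s : E -> seq int) : PT s ->
  PT (fun e => sorted_check (s e)).
Proof.
move=> Hs; apply: (PT_pairs (r := fun e i j =>
  (i <= j) ==> (nth 0 (s e) i <= nth 0 (s e) j)%R)); by pt.
Qed.

Ltac pt_check := match goal with
  | |- PT (fun e => chosen (@?u e) (@?v e)) => apply (PT_chosen (u := u) (Us := v))
  | |- PT (fun e => sorted_check (@?s e)) => apply (PT_sorted_check (s := s))
  | |- PT (fun e => perm_eq (@?s e) (@?t e)) => apply (PT_perm_eq (s := s) (t := t))
  | |- PT (fun e => extremal (@?m e) (@?d e) (@?v e)) =>
      apply (PT_extremal (m := m) (D := d) (v := v))
  end.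

Ltac pt_more ::= first [ pt_int | pt_check ].

Lemma sz_mem (s : seq int) x : x \in s -> sz x <= sz s.
Proof.
elim: s => //= y s IH; rewrite inE sz_cons => /predU1P[->|/IH]; lia.
Qed.

Lemma sz_chosen u Us : chosen u Us -> sz u <= sz Us.
Proof.
rewrite /chosen; elim: u Us => [|x u IH] [|D Us] //= /andP[/sz_mem xD /IH H].
by rewrite !sz_cons ltnS leq_add.
Qed.

Lemma size_enc_seq T (e : T -> seq bool) s : size s < size (enc_seq e s).
Proof. by elim: s => //= x s IH; rewrite size_cat; lia. Qed.

(** ** sort(U,V) *)

(** The domains of [U] and of [V]; side, index and bound of the queried variable, with [true] for
    [V] and for [Max]; the values of a support. *)
Definition UV_cert : Type :=
  (seq (seq int) * seq (seq int) * (bool * nat * bool) * (seq int * seq int))%type.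

Definition UV_check (xc : seq bool * UV_cert) : bool :=
  [&& xc.1 == enc_dom_list xc.2.1.1.1 ++ enc_dom_list xc.2.1.1.2 ++
        (xc.2.1.2.1.1 :: enc_nat xc.2.1.2.1.2) ++ [:: xc.2.1.2.2],
      size xc.2.1.1.1 == size xc.2.1.1.2, xc.2.1.2.1.2 < size xc.2.1.1.1,
      chosen xc.2.2.1 xc.2.1.1.1, chosen xc.2.2.2 xc.2.1.1.2,
      sorted_check xc.2.2.2, perm_eq xc.2.2.1 xc.2.2.2 &
      extremal xc.2.1.2.2
        (nth [::] (if xc.2.1.2.1.1 then xc.2.1.1.2 else xc.2.1.1.1) xc.2.1.2.1.2)
        (nth 0%R (if xc.2.1.2.1.1 then xc.2.2.2 else xc.2.2.1) xc.2.1.2.1.2)].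

Lemma PT_UV_check : PT UV_check.
Proof. by rewrite /UV_check /UV_cert; pt. Qed.

Lemma sort_UV_in_NP : in_NP sort_UV_bounds_D.
Proof.
(* Domain lists cost at most five units per bit of input, supports no more than their domains, and
   the unary index is below the number of variables, itself below the input length. *)
apply: (PT_in_NP (p := fun n => 30 * n + 30) PT_UV_check); first by pbound.
  move=> x [[[Us Vs] [[tag i] mx]] [du dv]]; rewrite /UV_check /=.
  case/and5P => /eqP -> /eqP sUV iU duU /and4P[dvV dv_sorted uv bound].
  set n := size Us in sUV iU.
  pose D (w : sort_var n) := match w with inl i => nth [::] Us i | inr i => nth [::] Vs i end.
  pose d (w : sort_var n) := match w with inl i => nth 0%R du i | inr i => nth 0%R dv i end.
  pose w : sort_var n := if tag then inr (Ordinal iU) else inl (Ordinal iU).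
  pose b := if mx then Max else Min.
  have dD v : d v \in D v by case: v => j; apply: chosen_nth => //; rewrite -?sUV.
  exists n, D, w, b; split.
  - rewrite /enc_sort_UV !enc_domsE !image_nth // /w /b.
    by case: (tag); case: (mx).
  - by move=> v E; have := dD v; rewrite E.
  have su : size du = n by apply: chosen_size duU.
  have sv : size dv = n by rewrite (chosen_size dvV).
  exists d; split.
    split=> //; rewrite /sort_UV /d !image_nth //.
    rewrite sorted_checkE in dv_sorted.
    apply/esym; rewrite -[RHS](sorted_sort le_trans dv_sorted).
    by apply/perm_sortP => //; [apply: le_total|apply: le_trans|apply: le_anti].
  apply/extremalP => //; move: bound; rewrite /w /b.
  by case: (tag); case: (mx).
move=> x [n [D [w [b [-> _ [d [[dD dC] db]]]]]]].
pose Us := [seq D (inl i) | i : 'I_n]; pose Vs := [seq D (inr i) | i : 'I_n].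
pose du := [seq d (inl i) | i : 'I_n]; pose dv := [seq d (inr i) | i : 'I_n].
pose mx := if b is Max then true else false.
pose tag := if w is inr _ then true else false.
pose j : 'I_n := match w with inl i => i | inr i => i end.
have duU : chosen du Us by apply: chosen_map.
have dvV : chosen dv Vs by apply: chosen_map.
exists (Us, Vs, (tag, nat_of_ord j, mx), (du, dv)).
  rewrite !sz_pair sz_nat /enc_sort_UV !enc_domsE !size_cat.
  have := sz_dom_list Us; have := sz_dom_list Vs.
  have := sz_chosen duU; have := sz_chosen dvV.
  have : n < size (enc_dom_list Us) by
    rewrite -{1}(size_image_ord (fun i => D (inl i))); apply: size_enc_seq.
  have := sz_bool tag; have := sz_bool mx; have := ltn_ord j; rewrite -/Us -/Vs -addnn.
  by lia.
have uv : perm_eq du dv by rewrite /dv dC perm_sym perm_sort.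
have dv_sorted : sorted <=%R dv by rewrite /dv dC sort_sorted //; apply: le_total.
have jE : extremal mx (nth [::] (if tag then Vs else Us) j) (nth 0%R (if tag then dv else du) j).
  have -> : nth [::] (if tag then Vs else Us) j = D w.
    by rewrite /tag /j; case: (w) => i; rewrite nth_image.
  have -> : nth 0%R (if tag then dv else du) j = d w.
    by rewrite /tag /j; case: (w) => i; rewrite nth_image.
  exact/extremalP.
rewrite /UV_check /= duU dvV !size_image_ord eqxx ltn_ord sorted_checkE uv dv_sorted jE !andbT.
apply/eqP; rewrite /enc_sort_UV !enc_domsE; do 2 congr (_ ++ _).
by rewrite /tag /j /mx; case: (w) => i; case: (b).
Qed.

(** ** sort(U,V,P) *)

(* Certificates number the positions from 0. *)
Definition pos_values (dp : seq nat) : seq int := [seq Posz k.+1 | k <- dp].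

Definition positions_ok (n : nat) (Ps : seq (seq int)) : bool :=
  all (fun D => all (fun v => (1 <= v)%R && (v <= Posz n)%R) D) Ps.

Definition injection_ok (n : nat) (dp : seq nat) : bool :=
  [&& size dp == n, all (fun p => p < n) dp &
      pairs n (fun i j => (nth 0 dp i == nth 0 dp j) ==> (i == j))].

Definition linked (A : eqType) (z : A) (n : nat) (du dv : seq A) (dp : seq nat) : bool :=
  all (fun i => nth z du i == nth z dv (nth 0 dp i)) (iota 0 n).

Definition tag_bits (k : nat) : seq bool := [:: k == 2; k == 1].

Definition select (A : Type) (k : nat) (a b c : A) : A :=
  if k == 0 then a else if k == 1 then b else c.

Lemma PT_pos_values E {eE : Enc E} (dp : E -> seq nat) : PT dp ->
  PT (fun e => pos_values (dp e)).
Proof. by move=> Hd; rewrite /pos_values; pt. Qed.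

Lemma PT_positions_ok E {eE : Enc E} (n : E -> nat) (Ps : E -> seq (seq int)) :
  PT n -> PT Ps -> PT (fun e => positions_ok (n e) (Ps e)).
Proof. by move=> Hn HP; rewrite /positions_ok; pt. Qed.

Lemma PT_injection_ok E {eE : Enc E} (n : E -> nat) (dp : E -> seq nat) :
  PT n -> PT dp -> PT (fun e => injection_ok (n e) (dp e)).
Proof. by move=> Hn Hd; rewrite /injection_ok /pairs; pt. Qed.

Lemma PT_linked E {eE : Enc E} (A : eqType) {eA : Enc A} (z : A) (n : E -> nat)
    (du dv : E -> seq A) (dp : E -> seq nat) :
  PT (fun p : A * A => p.1 == p.2) -> PT n -> PT du -> PT dv -> PT dp ->
  PT (fun e => linked z (n e) (du e) (dv e) (dp e)).
Proof.
move=> HA Hn Hu Hv Hp.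
apply: (PT_all (f := fun e i => nth z (du e) i == nth z (dv e) (nth 0 (dp e) i))); last by pt.
have H : PT (fun q : E * nat => (nth z (du q.1) q.2, nth z (dv q.1) (nth 0 (dp q.1) q.2))).
  by pt.
exact: (PT_comp HA H).
Qed.

Lemma PT_select E {eE : Enc E} A {eA : Enc A} (k : E -> nat) (a b c : E -> A) :
  PT k -> PT a -> PT b -> PT c -> PT (fun e => select (k e) (a e) (b e) (c e)).
Proof. by move=> Hk Ha Hb Hc; rewrite /select; pt. Qed.

Lemma PT_tag_bits E {eE : Enc E} (k : E -> nat) : PT k -> PT (fun e => tag_bits (k e)).
Proof. by move=> Hk; rewrite /tag_bits; pt. Qed.

Ltac pt_key := match goal with
  | |- PT (fun e => pos_values (@?d e)) => apply (PT_pos_values (dp := d))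
  | |- PT (fun e => positions_ok (@?n e) (@?d e)) => apply (PT_positions_ok (n := n) (Ps := d))
  | |- PT (fun e => injection_ok (@?n e) (@?d e)) => apply (PT_injection_ok (n := n) (dp := d))
  | |- PT (fun e => linked _ (@?n e) (@?u e) (@?v e) (@?d e)) =>
      apply (PT_linked _ (n := n) (du := u) (dv := v) (dp := d))
  | |- PT (fun e => select (@?k e) (@?a e) (@?b e) (@?c e)) =>
      apply (PT_select (k := k) (a := a) (b := b) (c := c))
  | |- PT (fun e => tag_bits (@?k e)) => apply (PT_tag_bits (k := k))
  end.

Ltac pt_more ::= first [ pt_int | pt_check | pt_key ].

Lemma sz_nats (m : nat) (s : seq nat) : all (fun k => k < m) s ->
  sz s <= size s * (2 * m + 2) + 1.
Proof.
elim: s => //= k s IH /andP[km /IH]; rewrite sz_cons sz_nat -addnn.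
by rewrite [(size s).+1 * _]mulSn; move: (sz s) (size s * _) => a b; lia.
Qed.

Lemma linkedP (A : eqType) (z : A) n du dv dp : reflect
  (forall i, i < n -> nth z du i = nth z dv (nth 0 dp i)) (linked z n du dv dp).
Proof.
apply: (iffP allP) => [H i iN|H i]; first by apply/eqP/H; rewrite mem_iota.
by rewrite mem_iota => iN; apply/eqP/H.
Qed.

Lemma injection_okP n dp : injection_ok n dp ->
  exists2 f : 'I_n -> 'I_n, injective f & forall i : 'I_n, nth 0 dp i = f i.
Proof.
case/and3P=> /eqP sdp /allP dp_lt /pairsP dp_inj.
have f_lt (i : 'I_n) : nth 0 dp i < n by apply: dp_lt; rewrite mem_nth ?sdp.
exists (fun i => Ordinal (f_lt i)) => // i j /(congr1 val) /= /eqP ij.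
by apply: val_inj; have := dp_inj i j (ltn_ord i) (ltn_ord j); rewrite ij => /eqP.
Qed.

Lemma injection_ok_image n (f : 'I_n -> 'I_n) : injective f ->
  injection_ok n [seq nat_of_ord (f i) | i : 'I_n].
Proof.
move=> f_inj; apply/and3P; split; first by rewrite size_image_ord.
  by apply/allP => k /mapP[i _ ->].
apply/pairsP => i j iN jN.
have N := nth_image 0 (fun i => nat_of_ord (f i)).
rewrite (N (Ordinal iN)) (N (Ordinal jN)); apply/implyP => /eqP /val_inj /f_inj [ij].
by rewrite ij.
Qed.

Lemma positions_okP n (Ps : seq (seq int)) :
  reflect (forall D, D \in Ps -> position_domain n D) (positions_ok n Ps).
Proof.
by apply: (iffP allP) => H D DP; [have /allP := H D DP|apply/allP; apply: (H D DP)].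
Qed.

Definition UVP_ok x (Us Vs Ps : seq (seq int)) (k i : nat) (mx : bool)
    (du dv : seq int) (dp : seq nat) : bool :=
  [&& x == enc_dom_list Us ++ enc_dom_list Vs ++ enc_dom_list Ps ++
        (tag_bits k ++ enc_nat i) ++ [:: mx],
      size Vs == size Us, size Ps == size Us, (k < 3) && (i < size Us) &
  [&& chosen du Us, chosen dv Vs, chosen (pos_values dp) Ps, positions_ok (size Us) Ps &
  [&& sorted_check dv, perm_eq du dv, injection_ok (size Us) dp,
      linked (0%R : int) (size Us) du dv dp &
      extremal mx (nth [::] (select k Us Vs Ps) i)
                  (nth 0%R (select k du dv (pos_values dp)) i)]]].

Definition UVP_cert : Type :=
  (seq (seq int) * seq (seq int) * seq (seq int) * (nat * nat * bool) *
   (seq int * seq int * seq nat))%type.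

Definition UVP_check (xc : seq bool * UVP_cert) : bool :=
  UVP_ok xc.1 xc.2.1.1.1.1 xc.2.1.1.1.2 xc.2.1.1.2 xc.2.1.2.1.1 xc.2.1.2.1.2 xc.2.1.2.2
    xc.2.2.1.1 xc.2.2.1.2 xc.2.2.2.

Lemma PT_UVP_check : PT UVP_check.
Proof. by rewrite /UVP_check /UVP_ok /UVP_cert; pt. Qed.

Lemma sort_UVP_in_NP : in_NP sort_UVP_bounds_D.
Proof.
(* The quadratic term pays for the permutation: [n] numbers below [n], in unary. *)
apply: (PT_in_NP (p := fun n => 100 * n + n * (2 * n + 2) + 100) PT_UVP_check); first by pbound.
  move=> x [[[[Us Vs] Ps] [[k i] mx]] [[du dv] dp]]; rewrite /UVP_check /UVP_ok /=.
  case/and5P=> /eqP -> /eqP sV /eqP sP /andP[k3 iU].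
  case/and5P=> duU dvV dpP /positions_okP posP /and5P[dv_sorted uv dp_inj /linkedP link bound].
  set n := size Us in sV sP iU posP dp_inj link bound.
  have [f f_inj fE] := injection_okP dp_inj.
  have sdp : size dp = n by have /and3P[/eqP] := dp_inj.
  pose D (w : sortP_var n) := match w with
    PU i => nth [::] Us i | PV i => nth [::] Vs i | PP i => nth [::] Ps i end.
  pose d (w : sortP_var n) := match w with
    PU i => nth 0%R du i | PV i => nth 0%R dv i | PP i => nth 0%R (pos_values dp) i end.
  pose w : sortP_var n := select k (PU (Ordinal iU)) (PV (Ordinal iU)) (PP (Ordinal iU)).
  pose b := if mx then Max else Min.
  have dD v : d v \in D v by case: v => j; apply: chosen_nth => //; rewrite ?sV ?sP.
  have dP (j : 'I_n) : d (PP j) = Posz (f j).+1 by rewrite /d (nth_map 0) ?sdp // fE.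
  have su : size du = n by apply: chosen_size duU.
  have sv : size dv = n by rewrite (chosen_size dvV).
  exists n, D, w, b; split.
  - rewrite /enc_sort_UVP !enc_domsE !image_nth //.
    by rewrite /w /b; case: (k) k3 => [|[|[|]]] //= _; case: (mx).
  - by move=> v E; have := dD v; rewrite E.
  - by move=> j; apply: posP; rewrite mem_nth ?sP.
  exists d; split.
    split=> //; split; first rewrite /d !image_nth //.
    - rewrite sorted_checkE in dv_sorted.
      apply/esym; rewrite -[RHS](sorted_sort le_trans dv_sorted).
      by apply/perm_sortP => //; [apply: le_total|apply: le_trans|apply: le_anti].
    - by move=> j j'; rewrite !dP => -[] /val_inj /f_inj.
    - by move=> j; exists (f j); rewrite dP /d -fE link.
  apply/extremalP => //; move: bound; rewrite /w /b /select.
  by case: (k) k3 => [|[|[|]]] //= _; case: (mx).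
move=> x [n [D [w [b [-> _ posP [d [[dD [dC d_inj dlink]] db]]]]]]].
(* The constraint yields some index for each position value; the certificate stores a choice of
   them. *)
have [f Hf] := fin_all_exists dlink.
have f_inj : injective f.
  by move=> i j fij; apply: d_inj; have [-> _] := Hf i; have [-> _] := Hf j; rewrite fij.
pose Us := [seq D (PU i) | i : 'I_n]; pose Vs := [seq D (PV i) | i : 'I_n].
pose Ps := [seq D (PP i) | i : 'I_n]; pose dp := [seq nat_of_ord (f i) | i : 'I_n].
pose du := [seq d (PU i) | i : 'I_n]; pose dv := [seq d (PV i) | i : 'I_n].
pose mx := if b is Max then true else false.
pose k := match w with PU _ => 0 | PV _ => 1 | PP _ => 2 end.
pose j : 'I_n := match w with PU i => i | PV i => i | PP i => i end.
have dpE : pos_values dp = [seq d (PP i) | i : 'I_n].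
  by rewrite /pos_values -map_comp; apply: eq_map => i /=; have [-> _] := Hf i.
have duU : chosen du Us by apply: chosen_map.
have dvV : chosen dv Vs by apply: chosen_map.
have dpP : chosen (pos_values dp) Ps by rewrite dpE; apply: chosen_map.
have dp_ok : injection_ok n dp by apply: injection_ok_image.
have k3 : k < 3 by rewrite /k; case: (w).
exists (Us, Vs, Ps, (k, nat_of_ord j, mx), (du, dv, dp)).
  rewrite !sz_pair !sz_nat /enc_sort_UVP !enc_domsE !size_cat.
  have := sz_dom_list Us; have := sz_dom_list Vs; have := sz_dom_list Ps.
  have := sz_chosen duU; have := sz_chosen dvV.
  have nU : n < size (enc_dom_list Us).
    by rewrite -{1}(size_image_ord (fun i => D (PU i))); apply: size_enc_seq.
  have /and3P[/eqP sdp /sz_nats dp_sz _] := dp_ok; rewrite sdp in dp_sz.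
  set N := size _ + _; have nN : n * (2 * n + 2) <= N * (2 * N + 2).
    have nN : n <= N by rewrite /N -/Us; lia.
    by apply: leq_mul; lia.
  have := sz_bool mx; have := ltn_ord j; rewrite -!addnn.
  move: nN dp_sz; move: (n * _) (N * (2 * N + 2)) => A B; rewrite /N -/Us -/Vs -/Ps.
  by lia.
have uv : perm_eq du dv by rewrite /dv dC perm_sym perm_sort.
have dv_sorted : sorted <=%R dv by rewrite /dv dC sort_sorted //; apply: le_total.
have jE : extremal mx (nth [::] (select k Us Vs Ps) j)
    (nth 0%R (select k du dv (pos_values dp)) j).
  have -> : nth [::] (select k Us Vs Ps) j = D w.
    by rewrite /k /j; case: (w) => i; rewrite nth_image.
  have -> : nth 0%R (select k du dv (pos_values dp)) j = d w.
    by rewrite /k /j dpE; case: (w) => i; rewrite nth_image.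
  exact/extremalP.
have posP' : positions_ok n Ps by apply/positions_okP => D' /mapP[i _ ->].
have link' : linked (0%R : int) n du dv dp.
  apply/linkedP => i iN; have N := nth_image 0%R (fun i => d (PU i)).
  rewrite (N (Ordinal iN)) (nth_image 0 (fun i => nat_of_ord (f i)) (Ordinal iN)).
  by rewrite nth_image; have [_ ->] := Hf (Ordinal iN).
rewrite /UVP_check /UVP_ok /= !size_image_ord !eqxx k3 ltn_ord duU dvV dpP posP'.
rewrite sorted_checkE dv_sorted uv dp_ok link' jE !andbT /=.
apply/eqP; rewrite /enc_sort_UVP !enc_domsE; do 3 congr (_ ++ _).
by rewrite /k /j /mx; case: (w) => i; case: (b).
Qed.

(** ** keysorting(U,V,Keys,P) *)

Definition key_le (keys n : nat) (dv : seq (seq int)) : bool :=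
  pairs n (fun i j => (i <= j) ==>
    lex_le (take keys (nth [::] dv i)) (take keys (nth [::] dv j))).

Definition stable_check (keys n : nat) (du : seq (seq int)) (dp : seq nat) : bool :=
  pairs n (fun i j => (i < j) ==>
    ((take keys (nth [::] du i) == take keys (nth [::] du j)) ==> (nth 0 dp i < nth 0 dp j))).

(** The component index [c] must be below [h] for every kind of variable, although the code of a
    position variable omits it. *)
Definition key_ok x (keys h : nat) (Us Vs : seq (seq (seq int))) (Ps : seq (seq int))
    (k i c : nat) (mx : bool) (du dv : seq (seq int)) (dp : seq nat) : bool :=
  [&& x == enc_nat keys ++ enc_dom_table Us ++ enc_dom_table Vs ++ enc_dom_list Ps ++
        (tag_bits k ++ enc_nat i ++ (if k == 2 then [::] else enc_nat c)) ++ [:: mx],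
      (size Vs == size Us) && (size Ps == size Us),
      all (fun D => size D == h) Us && all (fun D => size D == h) Vs,
      [&& 0 < keys, keys <= h, k < 3, i < size Us & c < h] &
  [&& table_chosen du Us, table_chosen dv Vs, chosen (pos_values dp) Ps,
      positions_ok (size Us) Ps &
  [&& key_le keys (size Us) dv, stable_check keys (size Us) du dp,
      injection_ok (size Us) dp, linked ([::] : seq int) (size Us) du dv dp &
      extremal mx
        (select k (nth [::] (nth [::] Us i) c) (nth [::] (nth [::] Vs i) c) (nth [::] Ps i))
        (select k (nth 0%R (nth [::] du i) c) (nth 0%R (nth [::] dv i) c)
                  (nth 0%R (pos_values dp) i))]]].

(** Number of keys and tuple length, then the domains; kind, index, component and bound of the
    queried variable; the support, with positions as unary numbers. *)
Definition key_cert : Type :=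
  (((nat * nat) * (seq (seq (seq int)) * seq (seq (seq int))) * seq (seq int)) *
   ((nat * nat) * (nat * bool)) * ((seq (seq int) * seq (seq int)) * seq nat))%type.

Definition key_check (xc : seq bool * key_cert) : bool :=
  key_ok xc.1 xc.2.1.1.1.1.1 xc.2.1.1.1.1.2 xc.2.1.1.1.2.1 xc.2.1.1.1.2.2 xc.2.1.1.2
    xc.2.1.2.1.1 xc.2.1.2.1.2 xc.2.1.2.2.1 xc.2.1.2.2.2 xc.2.2.1.1 xc.2.2.1.2 xc.2.2.2.

Lemma PT_key_le E {eE : Enc E} (keys n : E -> nat) (dv : E -> seq (seq int)) :
  PT keys -> PT n -> PT dv -> PT (fun e => key_le (keys e) (n e) (dv e)).
Proof.
move=> Hk Hn Hd; apply: (PT_pairs (r := fun e i j => (i <= j) ==>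
    lex_le (take (keys e) (nth [::] (dv e) i)) (take (keys e) (nth [::] (dv e) j)))) => //.
by apply: PT_implb; [|apply: PT_lex_le]; pt.
Qed.

Lemma PT_stable_check E {eE : Enc E} (keys n : E -> nat) (du : E -> seq (seq int))
    (dp : E -> seq nat) :
  PT keys -> PT n -> PT du -> PT dp ->
  PT (fun e => stable_check (keys e) (n e) (du e) (dp e)).
Proof. by move=> Hk Hn Hu Hd; rewrite /stable_check /pairs; pt. Qed.

Ltac pt_more ::= first [ pt_int | pt_check | pt_key | match goal with
  | |- PT (fun e => table_chosen (@?u e) (@?v e)) => apply (PT_table_chosen (u := u) (Us := v))
  | |- PT (fun e => key_le (@?k e) (@?n e) (@?d e)) =>
      apply (PT_key_le (keys := k) (n := n) (dv := d))
  | |- PT (fun e => stable_check (@?k e) (@?n e) (@?u e) (@?d e)) =>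
      apply (PT_stable_check (keys := k) (n := n) (du := u) (dp := d))
  end ].

Lemma PT_key_check : PT key_check.
Proof. by rewrite /key_check /key_ok /key_cert; pt. Qed.

Lemma sz_table_chosen u Us : table_chosen u Us -> sz u <= sz Us.
Proof.
rewrite /table_chosen; elim: u Us => [|x u IH] [|D Us] //=.
rewrite eqSS andbCA => /andP[/sz_chosen xD /IH H].
by rewrite !sz_cons ltnS leq_add.
Qed.

Lemma table_image n h (T : Type) (z : T) (s : seq (seq T)) : size s = n ->
  all (fun D => size D == h) s ->
  [seq [seq nth z (nth [::] s i) k | k : 'I_h] | i : 'I_n] = s.
Proof.
move=> sn /(all_nthP [::]) sh; rewrite -[RHS](image_nth [::] sn) /image_mem.
apply: eq_map => i; apply: (image_nth z (n := h)); apply/eqP/sh.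
by rewrite sn.
Qed.

Lemma table_chosen_image n h (d : 'I_n -> 'I_h -> int) (D : 'I_n -> 'I_h -> seq int) :
  (forall i k, d i k \in D i k) ->
  table_chosen [seq [seq d i k | k : 'I_h] | i : 'I_n] [seq [seq D i k | k : 'I_h] | i : 'I_n].
Proof.
move=> dD; rewrite /table_chosen !size_image_ord eqxx /=.
rewrite /image_mem; elim: (enum 'I_n) => //= i s ->.
by rewrite andbT; apply: chosen_map.
Qed.

Lemma keysorting_in_NP : in_NP keysorting_bounds_D.
Proof.
apply: (PT_in_NP (p := fun n => 100 * n + n * (2 * n + 2) + 100) PT_key_check); first by pbound.
  move=> x [[[[[keys h] [Us Vs]] Ps] [[k i] [c mx]]] [[du dv] dp]].
  rewrite /key_check /key_ok /=.
  case/and5P=> /eqP -> /andP[/eqP sV /eqP sP] /andP[hU hV] /and5P[keys0 keysh k3 iU ch].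
  case/and5P=> duU dvV dpP /positions_okP posP.
  case/and5P=> /pairsP le_keys /pairsP stab dp_inj /linkedP link bound.
  set n := size Us in sV sP iU posP dp_inj link bound le_keys stab.
  have [f f_inj fE] := injection_okP dp_inj.
  have sdp : size dp = n by have /and3P[/eqP] := dp_inj.
  pose D (w : keysort_var n h) := match w with
    KU i c => nth [::] (nth [::] Us i) c | KV i c => nth [::] (nth [::] Vs i) c
  | KP i => nth [::] Ps i end.
  pose d (w : keysort_var n h) := match w with
    KU i c => nth 0%R (nth [::] du i) c | KV i c => nth 0%R (nth [::] dv i) c
  | KP i => nth 0%R (pos_values dp) i end.
  pose w : keysort_var n h := select k (KU (Ordinal iU) (Ordinal ch))
    (KV (Ordinal iU) (Ordinal ch)) (KP h (Ordinal iU)).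
  pose b := if mx then Max else Min.
  have hUi (j : 'I_n) : size (nth [::] Us j) = h.
    by apply/eqP; apply: (all_nthP [::] hU).
  have hVi (j : 'I_n) : size (nth [::] Vs j) = h.
    by apply/eqP; apply: (all_nthP [::] hV); rewrite sV.
  have duUi (j : 'I_n) : chosen (nth [::] du j) (nth [::] Us j).
    exact: table_chosen_nth.
  have dvVi (j : 'I_n) : chosen (nth [::] dv j) (nth [::] Vs j).
    by apply: table_chosen_nth; rewrite ?sV.
  have dD v : d v \in D v.
    case: v => [j j'|j j'|j]; apply: chosen_nth => //; rewrite ?hUi ?hVi ?sP //.
  have dP (j : 'I_n) : d (KP h j) = Posz (f j).+1 by rewrite /d (nth_map 0) ?sdp // fE.
  have keyU (j : 'I_n) : sort_key keys (fun c => d (KU j c)) = take keys (nth [::] du j).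
    by rewrite /sort_key /d image_nth // (chosen_size (duUi j)).
  have keyV (j : 'I_n) : sort_key keys (fun c => d (KV j c)) = take keys (nth [::] dv j).
    by rewrite /sort_key /d image_nth // (chosen_size (dvVi j)).
  exists n, h, keys, D, w, b; split.
  - rewrite /enc_keysorting !enc_tuple_domsE !enc_domsE !table_image // image_nth //.
    by rewrite /w /b; case: (k) k3 => [|[|[|]]] //= _; case: (mx); rewrite ?cats0.
  - by rewrite keys0.
  - by move=> v E; have := dD v; rewrite E.
  - by move=> j; apply: posP; rewrite mem_nth ?sP.
  exists d; split.
    split=> //; split.
    - move=> j j' jj; rewrite !keyV -lex_leE.
        by have := le_keys j j' (ltn_ord j) (ltn_ord j'); rewrite jj.
      by rewrite !size_take !(chosen_size (dvVi _)) !hVi.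
    - by move=> j j'; rewrite !dP => -[] /val_inj /f_inj.
    - by move=> j; exists (f j); split; [rewrite dP | move=> c'; rewrite /d -fE link].
    - move=> j j' jj; rewrite !keyU !dP => E.
      have := stab j j' (ltn_ord j) (ltn_ord j'); rewrite jj E eqxx /= !fE.
      by rewrite ltz_nat ltnS.
  apply/extremalP => //; move: bound; rewrite /w /b /select.
  by case: (k) k3 => [|[|[|]]] //= _; case: (mx).
move=> x [n [h [keys [D [w [b [-> /andP[keys0 keysh] _ posP]]]]]]].
case=> d [[dD [dle d_inj dlink dstab]] db].
have [f Hf] := fin_all_exists dlink.
have f_inj : injective f.
  by move=> i j fij; apply: d_inj; have [-> _] := Hf i; have [-> _] := Hf j; rewrite fij.
pose tab A (F : 'I_n -> 'I_h -> A) := [seq [seq F i c | c : 'I_h] | i : 'I_n].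
pose Us := tab _ (fun i c => D (KU i c)); pose Vs := tab _ (fun i c => D (KV i c)).
pose du := tab _ (fun i c => d (KU i c)); pose dv := tab _ (fun i c => d (KV i c)).
pose Ps := [seq D (KP h i) | i : 'I_n]; pose dp := [seq nat_of_ord (f i) | i : 'I_n].
pose mx := if b is Max then true else false.
(* A position variable has no component; zero serves, and is an index because [0 < keys <= h]. *)
pose c0 : 'I_h := Ordinal (leq_trans keys0 keysh).
pose k := match w with KU _ _ => 0 | KV _ _ => 1 | KP _ => 2 end.
pose j : 'I_n := match w with KU i _ => i | KV i _ => i | KP i => i end.
pose c : 'I_h := match w with KU _ c => c | KV _ c => c | KP _ => c0 end.
have dpE : pos_values dp = [seq d (KP h i) | i : 'I_n].
  by rewrite /pos_values -map_comp; apply: eq_map => i /=; have [-> _] := Hf i.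
have duU : table_chosen du Us by apply: table_chosen_image.
have dvV : table_chosen dv Vs by apply: table_chosen_image.
have dpP : chosen (pos_values dp) Ps by rewrite dpE; apply: chosen_map.
have dp_ok : injection_ok n dp by apply: injection_ok_image.
have k3 : k < 3 by rewrite /k; case: (w).
have nthU A (F : 'I_n -> 'I_h -> A) (i : 'I_n) : nth [::] (tab A F) i = [seq F i c | c : 'I_h].
  by rewrite /tab nth_image.
exists ((keys, h, (Us, Vs), Ps), ((k, nat_of_ord j), (nat_of_ord c, mx)), ((du, dv), dp)).
  have UsE : [seq [seq D (KU i k0) | k0 : 'I_h] | i : 'I_n] = Us by [].
  have VsE : [seq [seq D (KV i k0) | k0 : 'I_h] | i : 'I_n] = Vs by [].
  rewrite !sz_pair !sz_nat /enc_keysorting !enc_tuple_domsE !enc_domsE UsE VsE !size_cat.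
  have := sz_dom_table Us; have := sz_dom_table Vs; have := sz_dom_list Ps.
  have := sz_table_chosen duU; have := sz_table_chosen dvV.
  have nU : n < size (enc_dom_table Us).
    by rewrite -{1}(size_image_ord (fun i => [seq D (KU i c) | c : 'I_h])); apply: size_enc_seq.
  (* The certificate holds [h] in unary; this is affordable because the row of the queried variable
     exists and already spells out [h] domains. *)
  have hU : h < size (enc_dom_table Us).
    rewrite /Us /tab /image_mem; have := mem_enum 'I_n j; rewrite inE.
    elim: (enum 'I_n) => //= i s IH; rewrite inE => /predU1P[_|/IH H];
      rewrite size_cat; last by lia.
    have := @size_enc_seq _ enc_dom [seq D (KU i c') | c' : 'I_h].
    rewrite size_image_ord => H; apply: leq_trans H _.
    by rewrite leqW // leq_addr.
  have /and3P[/eqP sdp /sz_nats dp_sz _] := dp_ok; rewrite sdp in dp_sz.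
  set N := size _ + _; have nN : n * (2 * n + 2) <= N * (2 * N + 2).
    have nN : n <= N by rewrite /N; lia.
    by apply: leq_mul; lia.
  have := sz_bool mx; have := ltn_ord j; have := ltn_ord c; rewrite -!addnn.
  move: nN dp_sz; move: (n * _) (N * (2 * N + 2)) => A B; rewrite /N -/Ps.
  by lia.
have jE : extremal mx
    (select k (nth [::] (nth [::] Us j) c) (nth [::] (nth [::] Vs j) c) (nth [::] Ps j))
    (select k (nth 0%R (nth [::] du j) c) (nth 0%R (nth [::] dv j) c)
       (nth 0%R (pos_values dp) j)).
  have -> : select k (nth [::] (nth [::] Us j) c) (nth [::] (nth [::] Vs j) c)
      (nth [::] Ps j) = D w.
    by rewrite /Us /Vs /Ps !nthU /k /j /c; case: (w) => [i c1|i c1|i]; rewrite !nth_image.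
  have -> : select k (nth 0%R (nth [::] du j) c) (nth 0%R (nth [::] dv j) c)
       (nth 0%R (pos_values dp) j) = d w.
    by rewrite /du /dv dpE !nthU /k /j /c; case: (w) => [i c1|i c1|i]; rewrite !nth_image.
  exact/extremalP.
have posP' : positions_ok n Ps by apply/positions_okP => D' /mapP[i _ ->].
have dpi (i : 'I_n) : nth 0 dp i = f i by rewrite nth_image.
have link' : linked ([::] : seq int) n du dv dp.
  apply/linkedP => i iN; rewrite (dpi (Ordinal iN)) (nthU _ _ (Ordinal iN)) nthU.
  by rewrite /image_mem; apply: eq_map => c'; have [_ ->] := Hf (Ordinal iN).
have keyE (F : 'I_n -> 'I_h -> int) (i : 'I_n) :
    take keys (nth [::] (tab _ F) i) = sort_key keys (F i) by rewrite nthU.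
have le_keys : key_le keys n dv.
  apply/pairsP => i1 i2 lt1 lt2; apply/implyP => i12.
  rewrite (keyE _ (Ordinal lt1)) (keyE _ (Ordinal lt2)) lex_leE.
    exact: (dle (Ordinal lt1) (Ordinal lt2)).
  by rewrite /sort_key !size_take !size_image_ord.
have stab : stable_check keys n du dp.
  apply/pairsP => i1 i2 lt1 lt2; apply/implyP => i12; apply/implyP.
  rewrite (keyE _ (Ordinal lt1)) (keyE _ (Ordinal lt2)) => /eqP E.
  have := dstab (Ordinal lt1) (Ordinal lt2) i12 E.
  have [-> _] := Hf (Ordinal lt1); have [-> _] := Hf (Ordinal lt2).
  by rewrite ltz_nat ltnS (dpi (Ordinal lt1)) (dpi (Ordinal lt2)).
have all_h A (F : 'I_n -> 'I_h -> A) : all (fun D => size D == h) (tab A F).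
  by apply/(all_nthP [::]) => i; rewrite size_image_ord => iN;
    rewrite (nthU _ _ (Ordinal iN)) size_image_ord.
rewrite /key_check /key_ok /= !size_image_ord !eqxx !all_h keys0 keysh k3 !ltn_ord duU dvV dpP.
rewrite posP' le_keys stab dp_ok link' jE !andbT /=.
apply/eqP; rewrite /enc_keysorting !enc_tuple_domsE !enc_domsE; do 4 congr (_ ++ _).
by rewrite /k /j /c /mx; case: (w) => [i c1|i c1|i]; case: (b); rewrite /= ?cats0.
Qed.

Theorem theorem2 :
  NP_complete sort_UV_bounds_D /\
  NP_complete sort_UVP_bounds_D /\
  NP_complete keysorting_bounds_D.
Proof.
split; first exact: conj sort_UV_in_NP sort_UV_hard.
split; first exact: conj sort_UVP_in_NP sort_UVP_hard.
exact: conj keysorting_in_NP keysorting_hard.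
Qed.
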